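(* Suppose that the flow assumption, the rate assumption, the boundary-measure assumption and the jump assumption (all stated in the context) hold. The transition kernel $\mathcal{K}(x,\cdot)$ of the discrete-time Markov process $(X(\tau_n))_{n\ge0}$ is given by $$\mathcal{K}(x,F)=\int_0^{t_+(x)}e^{-\int_0^sq(\phi_r(x))dr}q(\phi_s(x))\mathcal{P}(\phi_s(x),F)\,ds+\mathbf{1}_{\{t_+(x)<\infty\}}e^{-\int_0^{t_+(x)}q(\phi_r(x))dr}\mathcal{P}(\phi_{t_+(x)}(x),F)$$ for $x\in E$, $F\in\mathcal{B}(E)$. The operator $K=(K_0,K_\partial)$ defined in the context is substochastic on $L^1(E,m)\times L^1(\Gamma^-,m^-)$ and satisfies $$\int_E\mathcal{K}(x,F)f(x)m(dx)+\int_{\Gamma^-}\mathcal{K}(x,F)f_\partial(x)m^-(dx)=\int_{F\cap E^0}K_0(f,f_\partial)(x)m(dx)+\int_{F\cap\Gamma^-}K_\partial(f,f_\partial)(x)m^-(dx)$$ for all $F\in\mathcal{B}(E)$, $(f,f_\partial)\in L^1(E,m)\times L^1(\Gamma^-,m^-)$. Moreover, $K$ is stochastic if for every $x$ with $t_+(x)=\infty$ we have $$\lim_{t\to t_+(x)}\int_0^tq(\phi_r(x))\,dr=\infty.$$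
   Context: **Flow and state space.** Let $\widetilde{E}$ be a separable metric space and let $\phi\colon\mathbb{R}\times\widetilde{E}\to\widetilde{E}$, $(t,x)\mapsto\phi_t(x)$, be a flow: it is continuous, $\phi_0(x)=x$ and $\phi_s(\phi_t(x))=\phi_{t+s}(x)$ for all $s,t\in\mathbb{R}$, $x\in\widetilde{E}$. Let $E^0\subset\widetilde{E}$ be a Borel set and let $$\Gamma^{\pm}=\{z\in\overline{E^0}\setminus E^0: z=\phi_{\pm t}(x)\text{ for some }x\in E^0,\ t>0,\text{ and }\phi_{\pm s}(x)\in E^0\text{ for }s\in[0,t)\}.$$ For $x\in E^0$ let $t_+(x)=\inf\{t>0:\phi_t(x)\in\Gamma^+\}$ and $t_-(x)=\inf\{t>0:\phi_{-t}(x)\in\Gamma^-\}$ ($\inf\emptyset=\infty$); set $t_{\pm}(x)=0$ for $x\in\Gamma^{\pm}$ and extend these formulas to points of $\Gamma^{\mp}$. The state space is $E=E^0\cup\Gamma^-\setminus(\Gamma^-\cap\Gamma^+)$ with its Borel $\sigma$-algebra $\mathcal{B}(E)$. **Characteristics.** $q\colon E\to[0,\infty)$ is measurable and for each $x\in E$ the function $r\mapsto q(\phi_r(x))$ is integrable on $[0,\varepsilon(x))$ for some $\varepsilon(x)>0$. $\mathcal{P}\colon(E\cup\Gamma^+)\times\mathcal{B}(E)\to[0,1]$ is a transition probability (measurable in the first argument, a probability measure in the second). **Minimal process.** Let $F_x(t)=\mathbf{1}_{[0,t_+(x))}(t)\exp\{-\int_0^tq(\phi_r(x))dr\}$, $x\in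 E$, $t\ge0$. Let $\Delta\notin E$ be an isolated dead state, $F_\Delta\equiv1$, $\phi_t(\Delta)=\Delta$, $\mathcal{P}(\Delta,\{\Delta\})=1$, $\phi_\infty(x)=\Delta$. Put $\tau_0=0$, $X(0)=X_0$. For $n\ge1$ choose a $[0,\infty]$-valued $\sigma_n$ with $\mathbb{P}(\sigma_n>t\mid X_{n-1}=x)=F_x(t)$, $t\ge0$; put $\tau_n=\tau_{n-1}+\sigma_n$, $X(t)=\phi_{t-\tau_{n-1}}(X_{n-1})$ for $\tau_{n-1}\le t<\tau_n$, and $X(\tau_n)=X_n$, where $\mathbb{P}(X_n\in F\mid X(\tau_n^-)=x)=\mathcal{P}(x,F)$. With $\tau_\infty=\lim_n\tau_n$ set $X(t)=\Delta$ for $t\ge\tau_\infty$. The (sub-Markov) kernel of $(X(\tau_n))_{n\ge0}$ on $E$ is $\mathcal{K}(x,F)=\mathbb{P}_x(X(\tau_1)\in F)$, $F\in\mathcal{B}(E)$; for points $x\in\Gamma^-$ outside $E$ the symbol $\mathcal{K}(x,F)$ is read through the displayed formula. **Flow assumption.** There are Borel measurable nonnegative functions $J_t$, $t\in\mathbb{R}$, on $\widetilde{E}$ with $J_0(x)=1$, $J_{t+s}(x)=J_t(\phi_s(x))J_s(x)$ for all $s,t\in\mathbb{R}$, $x\in\widetilde{E}$, and a $\sigma$-finite Radon measure $m$ on $\mathcal{B}(\widetilde{E})$ with $m(\partial E)=0$ such that $m(\phi_t^{-1}(F))=\int_FJ_{-t}(x)\,m(dx)$ for $t\in\mathbb{R}$,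 $F\in\mathcal{B}(\widetilde{E})$. **Rate assumption.** With $q$ extended by $0$ to $\widetilde{E}\setminus E$, for each $x$ the function $\mathbb{R}\ni t\mapsto\int_0^tq(\phi_r(x))dr$ is absolutely continuous. **Boundary-measure assumption.** Let $E_{\pm}=\{x\in E:0<t_{\pm}(x)<\infty\}$, $W_{\pm}=\{(s,z):0<s<t_{\mp}(z),\ z\in\Gamma^{\pm}\}$, and $w_{\pm}\colon E_{\pm}\to W_{\pm}$, $w_{\pm}(x)=(t_{\pm}(x),\phi_{\pm t_{\pm}(x)}(x))$. There are finite Borel measures $m^{\pm}$ on $\Gamma^{\pm}$ with $m(w_{\pm}^{-1}(F))=\int_FJ_{\mp s}(z)\,ds\,m^{\pm}(dz)$ for $F\in\mathcal{B}(W_{\pm})$. **Jump assumption.** There are positive linear operators $P_0\colon L^1(E,m)\times L^1(\Gamma^+,m^+)\to L^1(E,m)$ and $P_\partial\colon L^1(E,m)\times L^1(\Gamma^+,m^+)\to L^1(\Gamma^-,m^-)$ such that for every $F\in\mathcal{B}(E)$ and all nonnegative $f\in L^1(E,m)$, $f_{\partial^+}\in L^1(\Gamma^+,m^+)$, $$\int_E\mathcal{P}(x,F)f(x)m(dx)+\int_{\Gamma^+}\mathcal{P}(x,F)f_{\partial^+}(x)m^+(dx)=\int_{F\cap E^0}P_0(f,f_{\partial^+})(x)m(dx)+\int_{F\cap\Gamma^-}P_\partial(f,f_{\partial^+})(x)m^-(dx).$$ **Operator $K$.** For nonnegative $(f,f_\partial)\in L^1(E,m)\times L^1(\Gamma^-,m^-)$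 and $x\in E\cup\Gamma^+$ let $$R_0(f,f_\partial)(x)=\int_0^{t_-(x)}e^{-\int_0^tq(\phi_{-r}(x))dr}f(\phi_{-t}(x))J_{-t}(x)\,dt+\mathbf{1}_{\{t_-(x)<\infty\}}e^{-\int_0^{t_-(x)}q(\phi_{-r}(x))dr}f_\partial(\phi_{-t_-(x)}(x))J_{-t_-(x)}(x),$$ and $$K(f,f_\partial)=\bigl(P_0(qR_0(f,f_\partial),R_0(f,f_\partial)),\ P_\partial(qR_0(f,f_\partial),R_0(f,f_\partial))\bigr),$$ where in each pair the first entry is considered on $E$ and the second on $\Gamma^+$; $K$ is extended by linearity. The norm on $L^1(E,m)\times L^1(\Gamma^-,m^-)$ is $\|f\|+\|f_\partial\|$. A linear operator is substochastic if it is a positive contraction, and stochastic if it is positive and preserves the norm of nonnegative elements.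
   Formalization: Added: trajectories stay in E until t_± and then reach Γ^± (automatic for open E^0); P_∂ vanishes on Γ^-∖E; Γ^± Borel, t_± and (t,x)↦J_t(x) measurable. On Γ^+∩Γ^-, t_± is the infimum, not 0. Without these, formulas are undefined or contraction fails. *)

(* Defs.v *)
From HB Require Import structures.
From mathcomp Require Import all_boot all_order all_algebra.
From mathcomp Require Import all_classical all_reals all_analysis.
From mathcomp Require Import measurable_realfun.

Set Implicit Arguments.
Unset Strict Implicit.
Unset Printing Implicit Defensive.
Import Order.TTheory GRing.Theory Num.Theory.
Import numFieldNormedType.Exports.

Local Open Scope classical_set_scope.
Local Open Scope ring_scope.

(* Measurable types of the library are pointed, hence pointed metric spaces. *)
#[short(type="pmetricType")]
HB.structure Definition PointedMetric (K : numDomainType) :=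
  {M of Pointed M & Metric K M}.

Notation borel T := (g_sigma_algebraType (@open T)).

Section topology_measure.
Context {R : realType} {T : pmetricType R}.
Implicit Types (m : set (borel T) -> \bar R) (A : set T).

Definition separable := exists2 D : set T, countable D & dense D.

Definition frontier A : set T := closure A `\` interior A.

Definition radon m :=
  (forall C : set T, compact C -> (m C < +oo)%E) /\
  (forall F : set (borel T), measurable F ->
    m F = ereal_sup [set m C | C in [set C : set T | compact C /\ C `<=` F]]).

End topology_measure.
Arguments separable {R} T.

Section absolute_continuity.
Context {R : realType}.

Definition absolutely_continuous_on (a b : R) (f : R -> R) :=
  forall e, 0 < e -> exists2 d, 0 < d &
    forall (n : nat) (l r : 'I_n -> R),
      (forall i, a <= l i /\ l i <= r i /\ r i <= b) ->
      trivIset setT (fun i => [set x | l i < x < r i]) ->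
      \sum_(i < n) (r i - l i) < d ->
      \sum_(i < n) `|f (r i) - f (l i)| < e.

Definition oriented_integral (g : R -> R) (t : R) : R :=
  if 0 <= t then \int[lebesgue_measure]_(r in `[0, t]) g r
  else - \int[lebesgue_measure]_(r in `[t, 0]) g r.

End absolute_continuity.

(* Elements of L^1(A, mu) are represented by functions, up to equality almost
   everywhere on A; values outside of A are irrelevant. *)
Section L1_operators.
Context {d : measure_display} {T : measurableType d} {R : realType}.
Implicit Types (mu nu : set T -> \bar R) (A B D : set T) (f g : T -> R).

Definition L1 mu A f := mu.-integrable A (EFin \o f).

Record positive_linear_operator mu A nu B rho D
    (P : (T -> R) -> (T -> R) -> T -> R) : Prop := {
  plo_L1 : forall f g, L1 mu A f -> L1 nu B g -> L1 rho D (P f g) ;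
  plo_ae : forall f f' g g', L1 mu A f -> L1 mu A f' -> L1 nu B g -> L1 nu B g' ->
    f = f' %[ae mu in A] -> g = g' %[ae nu in B] ->
    P f g = P f' g' %[ae rho in D] ;
  plo_linear : forall a f f' g g',
    L1 mu A f -> L1 mu A f' -> L1 nu B g -> L1 nu B g' ->
    P (a \*: f \+ f') (a \*: g \+ g') =
      a \*: P f g \+ P f' g' %[ae rho in D] ;
  plo_ge0 : forall f g, L1 mu A f -> L1 nu B g ->
    (\forall x \ae mu, A x -> 0 <= f x) -> (\forall x \ae nu, B x -> 0 <= g x) ->
    \forall x \ae rho, D x -> 0 <= P f g x }.

Definition pair_norm mu A nu B f g : \bar R :=
  (\int[mu]_(x in A) `|f x|%:E + \int[nu]_(x in B) `|g x|%:E)%E.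

Record positive_pair_operator mu A nu B
    (K : (T -> R) -> (T -> R) -> (T -> R) * (T -> R)) : Prop := {
  ppo_1 : positive_linear_operator mu A nu B mu A (fun f g => (K f g).1) ;
  ppo_2 : positive_linear_operator mu A nu B nu B (fun f g => (K f g).2) }.

Definition substochastic mu A nu B K :=
  positive_pair_operator mu A nu B K /\
  forall f g, L1 mu A f -> L1 nu B g ->
    (pair_norm mu A nu B (K f g).1 (K f g).2 <= pair_norm mu A nu B f g)%E.

Definition stochastic mu A nu B K :=
  positive_pair_operator mu A nu B K /\
  forall f g, L1 mu A f -> L1 nu B g ->
    (\forall x \ae mu, A x -> 0 <= f x) -> (\forall x \ae nu, B x -> 0 <= g x) ->
    pair_norm mu A nu B (K f g).1 (K f g).2 = pair_norm mu A nu B f g.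

End L1_operators.

(* A sign + or - is a boolean, true standing for +. *)
Section state_space.
Context {R : realType} {T : pmetricType R}.
Variables (phi : R -> T -> T) (E0 : set T).

Definition sgt (b : bool) (t : R) : R := if b then t else - t.

Record flow : Prop := {
  flow_continuous : continuous (fun p : R * T => phi p.1 p.2) ;
  flow0 : forall x, phi 0 x = x ;
  flowD : forall s t x, phi s (phi t x) = phi (t + s) x }.

Definition Gamma (b : bool) : set T :=
  [set z | (closure E0 `\` E0) z /\
    exists x t, [/\ E0 x, 0 < t, z = phi (sgt b t) x &
      forall s, 0 <= s < t -> E0 (phi (sgt b s) x)]].

Definition state : set T :=
  E0 `|` (Gamma false `\` (Gamma false `&` Gamma true)).

(* On Gamma^+ :&: Gamma^- the infimum is used for both signs: such a point is
   at once an endpoint of a trajectory and the start of the next one. *)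
Definition hit (b : bool) (x : T) : \bar R :=
  if x \in Gamma b `\` Gamma (~~ b) then 0%E
  else ereal_inf
    [set t%:E | t in [set t : R | 0 < t /\ Gamma b (phi (sgt b t) x)]].

Definition hit_point (b : bool) (x : T) : T := phi (sgt b (fine (hit b x))) x.

(* The displayed formulas evaluate functions given on E only, resp. on E and
   Gamma^+ or on Gamma^- only, at points of the trajectory of x: it must run
   in E before the time t_+(x), resp. t_-(x), and reach the boundary at that
   time if it is finite. This is automatic when E0 is open. *)
Definition well_posed :=
  forall b x, (state `|` Gamma (~~ b)) x ->
    (forall s, 0 < s -> (s%:E < hit b x)%E -> state (phi (sgt b s) x)) /\
    ((hit b x < +oo)%E -> Gamma b (hit_point b x)).

(* Needed for the integrals below to make sense; a Borel set E0 alone does not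
   ensure it. *)
Record boundary_measurable : Prop := {
  Gamma_measurable : forall b, measurable (Gamma b : set (borel T)) ;
  hit_measurable : forall b,
    measurable_fun (state `|` Gamma (~~ b) : set (borel T))
      (fun x : borel T => hit b x) }.

Definition strip (b : bool) : set T :=
  [set x | state x /\ (0 < hit b x)%E /\ (hit b x < +oo)%E].

Definition W (b : bool) : set (R * T) :=
  [set p | Gamma b p.2 /\ 0 < p.1 /\ (p.1%:E < hit (~~ b) p.2)%E].

Definition w (b : bool) (x : T) : R * T := (fine (hit b x), hit_point b x).

Record flow_assumption (J : R -> T -> R)
    (m : set (borel T) -> \bar R) : Prop := {
  J_measurable : measurable_fun setT (fun p : R * borel T => J p.1 p.2) ;
  J_ge0 : forall t x, 0 <= J t x ;
  J0 : forall x, J 0 x = 1 ;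
  J_cocycle : forall t s x, J (t + s) x = J t (phi s x) * J s x ;
  m_radon : radon m ;
  m_frontier : m (frontier state) = 0%E ;
  m_flow : forall t (F : set (borel T)), measurable F ->
    m (phi t @^-1` F) = (\int[m]_(x in F) (J (- t) x)%:E)%E }.

(* mb b is a measure on Gamma^+ or Gamma^-, extended by 0 to T. *)
Definition boundary_measure_assumption (J : R -> T -> R)
    (m : set (borel T) -> \bar R)
    (mb : bool -> {finite_measure set (borel T) -> \bar R}) :=
  forall b, mb b (~` Gamma b) = 0%E /\
    forall F : set (R * borel T), measurable F -> F `<=` W b ->
      m (strip b `&` w b @^-1` F) =
      (\int[lebesgue_measure \x mb b]_(p in F) (J (sgt (~~ b) p.1) p.2)%:E)%E.

Section characteristics.
Variable q : T -> R.

Record rate_function : Prop := {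
  q_measurable : measurable_fun (state : set (borel T)) (fun x : borel T => q x) ;
  q_ge0 : forall x, state x -> 0 <= q x ;
  q_outside : forall x, ~ state x -> q x = 0 ;
  q_integrable : forall x, state x -> exists2 e : R, 0 < e &
    lebesgue_measure.-integrable `[0, e[ (fun r => (q (phi r x))%:E) }.

(* Absolute continuity on R is meant on every compact interval. *)
Definition rate_assumption :=
  forall x, forall a b : R,
    lebesgue_measure.-integrable `[a, b] (fun r => (q (phi r x))%:E) /\
    absolutely_continuous_on a b (oriented_integral (fun r => q (phi r x))).

Definition cumul (b : bool) (x : T) (t : R) : R :=
  \int[lebesgue_measure]_(r in `[0, t]) q (phi (sgt b r) x).

Definition survival (x : T) (t : R) : R :=
  if (t%:E < hit true x)%E then expR (- cumul true x t) else 0.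

Variable P : R.-pker (borel T) ~> (borel T).

(* A transition probability from E :|: Gamma^+ to E, extended outside. *)
Definition jump_kernel_on_state :=
  forall x, (state `|` Gamma true) x -> P x (~` state) = 0%E.

Definition kernelK (x : T) (F : set (borel T)) : \bar R :=
  (\int[lebesgue_measure]_(s in [set s : R | (0 < s)%R /\ s%:E < hit true x])
     ((expR (- cumul true x s) * q (phi s x))%:E * P (phi s x) F) +
   if hit true x < +oo then
     (expR (- cumul true x (fine (hit true x))))%:E * P (hit_point true x) F
   else 0)%E.

(* As P x is carried by E, the integral identity is for F included in E; it
   leaves the values of Pd on Gamma^- outside of E free, whence Pd_state. *)
Record jump_assumption (m : set (borel T) -> \bar R)
    (mb : bool -> {finite_measure set (borel T) -> \bar R})
    (P0 Pd : (T -> R) -> (T -> R) -> T -> R) : Prop := {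
  P0_operator : @positive_linear_operator _ (borel T) R
    m state (mb true) (Gamma true) m state P0 ;
  Pd_operator : @positive_linear_operator _ (borel T) R
    m state (mb true) (Gamma true) (mb false) (Gamma false) Pd ;
  Pd_state : forall f g : T -> R,
    @L1 _ (borel T) R m state f ->
    @L1 _ (borel T) R (mb true) (Gamma true) g ->
    \forall x \ae mb false, (Gamma false `\` state) x -> Pd f g x = 0 ;
  P_operators : forall (F : set (borel T)) (f g : T -> R),
    measurable F -> F `<=` state ->
    @L1 _ (borel T) R m state f ->
    @L1 _ (borel T) R (mb true) (Gamma true) g ->
    (forall x, state x -> 0 <= f x) -> (forall x, Gamma true x -> 0 <= g x) ->
    (\int[m]_(x in state) (P x F * (f x)%:E) +
     \int[mb true]_(x in Gamma true) (P x F * (g x)%:E) =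
     \int[m]_(x in F `&` E0) (P0 f g x)%:E +
     \int[mb false]_(x in F `&` Gamma false) (Pd f g x)%:E)%E }.

Definition R0 (J : R -> T -> R) (f fd : T -> R) (x : T) : \bar R :=
  (\int[lebesgue_measure]_(t in [set t : R | (0 < t)%R /\ t%:E < hit false x])
     (expR (- cumul false x t) * f (phi (- t) x) * J (- t) x)%:E +
   if hit false x < +oo then
     let t := fine (hit false x) in
     (expR (- cumul false x t) * fd (phi (- t) x) * J (- t) x)%:E
   else 0)%E.

Definition qR0 J f fd (x : T) : \bar R := ((q x)%:E * R0 J f fd x)%E.

Definition opK_ge0 J (P0 Pd : (T -> R) -> (T -> R) -> T -> R) (f fd : T -> R) :
    (T -> R) * (T -> R) :=
  (P0 (fine \o qR0 J f fd) (fine \o R0 J f fd),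
   Pd (fine \o qR0 J f fd) (fine \o R0 J f fd)).

(* Linear extension from nonnegative pairs. *)
Definition opK J P0 Pd (f fd : T -> R) : (T -> R) * (T -> R) :=
  ((opK_ge0 J P0 Pd (f^\+) (fd^\+)).1 \- (opK_ge0 J P0 Pd (f^\-) (fd^\-)).1,
   (opK_ge0 J P0 Pd (f^\+) (fd^\+)).2 \- (opK_ge0 J P0 Pd (f^\-) (fd^\-)).2).

(* The dead state is None. *)
Section minimal_process.

Definition flow_ext (t : \bar R) (x : option T) : option T :=
  match t, x with t'%:E, Some y => Some (phi t' y) | _, _ => None end.

Definition survival_ext (x : option T) (t : R) : R :=
  if x is Some y then survival y t else 1.

(* For F included in E, hence not containing the dead state. *)
Definition jump_ext (x : option T) (F : set (borel T)) : \bar R :=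
  if x is Some y then P y F else 0%E.

Context {d : measure_display} {Omega : measurableType d}.
Variables (Pr : probability Omega R).
Variables (X : nat -> Omega -> option T) (sigma : nat -> Omega -> \bar R).

Definition tau (n : nat) (o : Omega) : \bar R :=
  (\sum_(1 <= k < n.+1) sigma k o)%E.

(* X(t), with X n standing for the post-jump state X_n. *)
Definition jump_path (t : \bar R) (o : Omega) : option T :=
  xget None [set y | exists2 n, (tau n o <= t < tau n.+1 o)%E &
    y = flow_ext (t - tau n o)%E (X n o)].

(* The events determined by X_0, ..., X_n and sigma_1, ..., sigma_k. *)
Definition history (n k : nat) : set (set Omega) :=
  <<s [set A | (exists2 i, (i <= n)%N & exists2 F : set (borel T), measurable F &
                  A = X i @^-1` (Some @` F)) \/
               (exists2 i, (1 <= i <= k)%N & exists t : R,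
                  A = [set o | (t%:E < sigma i o)%E])] >>.

(* X(tau_n -) is flow_ext sigma_n X_(n-1). *)
Record minimal_process : Prop := {
  X_measurable : forall n (F : set (borel T)), measurable F ->
    measurable (X n @^-1` (Some @` F)) ;
  X_state : forall n o y, X n o = Some y -> state y ;
  sigma_measurable : forall n, measurable_fun setT (sigma n.+1) ;
  sigma_ge0 : forall n o, (0 <= sigma n.+1 o)%E ;
  sigma_law : forall n (A : set Omega) (t : R), history n n A -> 0 <= t ->
    Pr (A `&` [set o | (t%:E < sigma n.+1 o)%E]) =
    (\int[Pr]_(o in A) (survival_ext (X n o) t)%:E)%E ;
  X_law : forall n (A : set Omega) (F : set (borel T)),
    history n n.+1 A -> measurable F -> F `<=` state ->
    Pr (A `&` X n.+1 @^-1` (Some @` F)) =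
    (\int[Pr]_(o in A) jump_ext (flow_ext (sigma n.+1 o) (X n o)) F)%E }.

End minimal_process.

End characteristics.
End state_space.

(* Main.v *)
(* Up to its first jump the process runs along the flow, so the time sigma_1 has
   the density q e^{-Q} on (0, t_+(x)), Q being the integrated rate, and an atom
   of mass e^{-Q(t_+(x))} at t_+(x); the jump law then gives the transition
   kernel, because sigma_2 > 0 almost surely.  For the operator, write S g for
   this kernel applied to a nonnegative g, that is, with g (y) in place of
   P (y, F).  The core is the duality
     int_E g q R_0(f, f_d) dm + int_{G^+} g R_0(f, f_d) dm^+
       = int_E (S g) f dm + int_{G^-} (S g) f_d dm^- :
   each side splits into four terms, according to whether a trajectory is
   followed between interior points or up to the boundary, and these agree term
   by term by the change of variables for the flow and by the description of m
   on E_+ and E_- through the boundary measures.  With g = P(., F) and the jump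
   assumption it becomes the integral identity for K, and with F = E it computes
   the norm of K (f, f_d), as S 1 <= 1, with equality where the integrated rate
   is infinite or the boundary is reached. *)
Require Import Defs.
From HB Require Import structures.
From mathcomp Require Import all_boot all_order all_algebra.
From mathcomp Require Import all_classical all_reals all_analysis.
From mathcomp Require Import measurable_realfun.
From mathcomp Require Import ring lra.

Set Implicit Arguments.
Unset Strict Implicit.
Unset Printing Implicit Defensive.
Import Order.TTheory GRing.Theory Num.Theory.
Import numFieldNormedType.Exports.

Local Open Scope classical_set_scope.
Local Open Scope ring_scope.

(** * Change of variables and integrated rates *)

(** Two obstacles shape the proof. The substitutions reverse trajectories, and a reversed trajectory
    stops at the first point of Gamma^- that it meets; but before its exit a trajectory is only
    known to run in E, which contains points of Gamma^-. Such inner entrances are excluded by nested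
    intervals: each of them would be a limit of earlier ones and be followed by a gap. The second
    obstacle is that R_0 may be infinite at some points and is then not linear there. The duality
    with g = 1 is therefore used first, as a bound on the mass of R_0 (|f|, |f_d|): it makes q R_0
    finite m-almost everywhere and R_0 finite m^+-almost everywhere, and compatible with equality
    almost everywhere. Only then is K an operator on classes of functions, and the duality with g =
    P(., F) applies to it. Moreover, the rate is merely integrable along trajectories, so the
    density of the first jump time is integrated by means of additivity and a quadratic error bound
    rather than by a derivative. *)

Section change_of_variables.
Context d1 d2 (X : measurableType d1) (Y : measurableType d2) (R : realType).
Variables (mu : {measure set X -> \bar R}) (nu : {measure set Y -> \bar R}).
Variables (D : set X) (W : set Y) (w : X -> Y) (j : Y -> R).
Hypotheses (mD : measurable D) (mW : measurable W) (mw : measurable_fun D w).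
Hypotheses (mj : measurable_fun W j) (j0 : forall y, W y -> 0 <= j y).
Hypothesis DW : forall x, D x -> W (w x).
Hypothesis muE : forall F, measurable F -> F `<=` W ->
  mu (D `&` w @^-1` F) = (\int[nu]_(y in F) (j y)%:E)%E.

Import HBNNSimple.
Local Open Scope ereal_scope.

Let change_nnsfun (h : {nnsfun Y >-> R}) :
  \int[mu]_(x in D) (h (w x))%:E = \int[nu]_(y in W) ((h y)%:E * (j y)%:E).
Proof.
have mhw r : measurable (D `&` w @^-1` (h @^-1` [set r])) by exact: mw.
transitivity (\sum_(r \in range h)
    \int[mu]_(x in D) (r * \1_(D `&` w @^-1` (h @^-1` [set r])) x)%:E).
  under eq_integral do rewrite fimfunE -fsumEFin//.
  rewrite ge0_integral_fsum//; last 2 first.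
  - move=> r; apply/measurable_EFinP/measurable_funM => //.
    by apply: (@measurable_comp _ _ _ _ _ _ setT) => //.
  - by move=> r x _; rewrite nnfun_muleindic_ge0.
  apply: eq_fsbigr => r _; apply: eq_integral => x xD.
  by congr (_ * _)%:E; rewrite !indicE in_setI xD.
transitivity (\sum_(r \in range h)
    \int[nu]_(y in W) ((r * \1_(h @^-1` [set r]) y)%:E * (j y)%:E)); last first.
  rewrite -ge0_integral_fsum//; last 2 first.
  - move=> r; apply: emeasurable_funM; last exact/measurable_EFinP.
    by apply/measurable_EFinP/measurable_funM.
  - move=> r y Wy; apply: mule_ge0; first by rewrite nnfun_muleindic_ge0.
    by rewrite lee_fin j0.
  apply: eq_integral => y; rewrite inE => Wy; rewrite [X in _ = (X)%:E * _]fimfunE.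
  rewrite -fsumEFin// ge0_mule_fsuml// => r.
  by rewrite nnfun_muleindic_ge0.
apply: eq_fsbigr => r; rewrite inE => -[y0 _ hy0].
have r0 : (0 <= r)%R by rewrite -hy0.
under eq_integral do rewrite EFinM.
rewrite ge0_integralZl//; last first.
- by apply/measurable_EFinP.
under [RHS]eq_integral do rewrite EFinM -muleA.
rewrite ge0_integralZl//; last 2 first.
- apply: emeasurable_funM; last exact/measurable_EFinP.
  by apply/measurable_EFinP.
- by move=> y Wy; rewrite mule_ge0// lee_fin j0.
congr (_ * _); rewrite integral_indic//.
(* [muE] only speaks of subsets of [W]; cutting the level set down to [W] changes nothing, since [w]
   maps [D] into [W]. *)
rewrite setIAC setIid [LHS](_ : _ = mu (D `&` w @^-1` (W `&` h @^-1` [set r]))); last first.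
  congr (mu _); apply/seteqP; split => x /= [Dx].
    by move=> hr; split=> //; split => //; exact: DW.
  by move=> [].
rewrite muE; [|exact: measurableI|by move=> ? []].
rewrite integral_mkcondr; apply: eq_integral => y Wy.
by rewrite epatch_indic /= muleC.
Qed.

(** [muE] says that the image of [mu] under [w] has density [j] with respect to [nu]; level sets
    give simple functions, and monotone convergence gives the rest. It serves the flow, the boundary
    measures and the law of the first jump time alike. *)
Lemma integral_image_density (k : Y -> \bar R) :
  measurable_fun W k -> (forall y, W y -> 0 <= k y) ->
  \int[mu]_(x in D) k (w x) = \int[nu]_(y in W) (k y * (j y)%:E).
Proof.
move=> mk k0; pose h := nnsfun_approx mW mk.
have hk y : W y -> (h n y)%:E @[n --> \oo] --> k y.
  by move=> Wy; exact: cvg_nnsfun_approx.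
have nd_h y : nondecreasing_seq (fun n => (h n y)%:E).
  by move=> m n mn; rewrite lee_fin; exact/lefP/nd_nnsfun_approx.
transitivity (limn (fun n => \int[mu]_(x in D) (h n (w x))%:E)).
  rewrite -monotone_convergence//.
  - apply: eq_integral => x; rewrite inE => Dx; apply/esym/cvg_lim => //.
    by apply: hk; exact: DW.
  - move=> n; apply/measurable_EFinP.
    by apply: (@measurable_comp _ _ _ _ _ _ setT).
  - by move=> n x _; rewrite lee_fin.
rewrite (funext (fun n => change_nnsfun (h n))).
rewrite -monotone_convergence//.
- apply: eq_integral => y; rewrite inE => Wy; apply/cvg_lim => //.
  by apply: cvgeZr => //; exact: hk.
- move=> n; apply: emeasurable_funM; last exact/measurable_EFinP.
  by apply/measurable_EFinP/measurable_funTS.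
- by move=> n y Wy; rewrite mule_ge0// lee_fin// j0.
- move=> y Wy m n mn; apply: lee_wpmul2r; first by rewrite lee_fin j0.
  exact: nd_h.
Qed.

End change_of_variables.

(** * Integration of a rate against its exponential, without derivatives *)

Section additive_error.
Context {R : realType}.

(** Both [I] and the increment of the exponential lie between [expR (- v) * (v - u)] and
    [expR (- u) * (v - u)], and these bounds differ by at most [(v - u) ^+ 2]. Below, [u] and [v]
    are the values of the integrated rate at the ends of an interval. *)
Lemma expR_mean_value (u v I : R) : 0 <= u -> u <= v ->
  expR (- v) * (v - u) <= I <= expR (- u) * (v - u) ->
  `|I - (expR (- u) - expR (- v))| <= (v - u) ^+ 2.
Proof.
move=> u0 uv /andP[h1 h2].
have d0 : 0 <= v - u by rewrite subr_ge0.
have e1 : expR (- v) * (v - u) <= expR (- u) - expR (- v).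
  have : 1 + (v - u) <= expR (v - u) by exact: expR_ge1Dx.
  move/(ler_wpM2l (expR_ge0 (- v))); rewrite -expRD.
  have -> : - v + (v - u) = - u by ring.
  move: (expR _) (expR _) => x y; nra.
have e2 : expR (- u) - expR (- v) <= expR (- u) * (v - u).
  have : 1 + - (v - u) <= expR (- (v - u)) by exact: expR_ge1Dx.
  move/(ler_wpM2l (expR_ge0 (- u))); rewrite -expRD.
  have -> : - u - (v - u) = - v by ring.
  move: (expR _) (expR _) => x y; nra.
have eu : expR (- u) <= 1 by rewrite -expR0 ler_expR oppr_le0.
move: (expR _) (expR _) h1 h2 e1 e2 eu => x y h1 h2 e1 e2 eu.
have e3 : (x - y) * (v - u) <= (v - u) ^+ 2.
  by rewrite expr2 ler_wpM2r//; apply: (le_trans e2); rewrite ler_piMl.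
rewrite ler_norml; apply/andP; split; nra.
Qed.

Variables (Q : R -> R) (err : R -> R -> R) (T : R).
Hypothesis cQ : {within `[0, T], continuous Q}.
Hypothesis Q_le : forall (a b : R), 0 <= a -> a <= b -> Q a <= Q b.
Hypothesis errD : forall (a b c : R), 0 <= a -> a <= b -> b <= c -> c <= T ->
  err a c = err a b + err b c.
Hypothesis err_le : forall (a b : R), 0 <= a -> a <= b -> b <= T ->
  `|err a b| <= (Q b - Q a) ^+ 2.

(* Bisecting the increment of [Q] halves a quadratic bound on an additive
   function of intervals. *)
Let err_le_pow n (a b : R) : 0 <= a -> a <= b -> b <= T ->
  `|err a b| <= (Q b - Q a) ^+ 2 / 2 ^+ n.
Proof.
elim: n a b => [|n ihn] a b a0 ab bT; first by rewrite expr0 divr1 err_le.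
have [||c] := @IVT R Q a b ((Q a + Q b) / 2) ab.
- by apply: continuous_subspaceW cQ; apply: subset_itv; rewrite bnd_simp.
- have Qab := Q_le a0 ab; rewrite (min_idPl Qab) (max_idPr Qab).
  by apply/andP; split; lra.
rewrite in_itv/= => /andP[ac cb] Qc.
rewrite (errD a0 ac cb bT) (le_trans (ler_normD _ _))//.
have c0 : 0 <= c by exact: le_trans ac.
apply: (le_trans (lerD (ihn _ _ a0 ac (le_trans cb bT)) (ihn _ _ c0 cb bT))).
rewrite Qc (exprS 2 n) invfM.
rewrite le_eqVlt; apply/orP; left; apply/eqP.
by field; rewrite expf_neq0.
Qed.

(** Repeated bisection sends the quadratic bound to zero. With [err] the defect of an integration
    formula, this takes the place of differentiation. *)
Lemma additive_error_eq0 : 0 <= T -> err 0 T = 0.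
Proof.
move=> T0; apply/eqP; rewrite -normr_eq0; apply/negPn/negP => e0.
have {}e0 : 0 < `|err 0 T| by rewrite lt_neqAle eq_sym e0 normr_ge0.
(* This [n] exceeds [(Q T - Q 0) ^+ 2] divided by the supposed error, and [n < 2 ^ n] then
   contradicts the bound. *)
pose n := (Num.truncn ((Q T - Q 0) ^+ 2 / `|err 0 T|)).+1.
have := err_le_pow n (lexx 0) T0 (lexx T); apply/negP; rewrite -ltNge.
rewrite ltr_pdivrMr ?exprn_gt0// mulrC -ltr_pdivrMr//.
apply: (lt_trans (truncnS_gt _)).
by rewrite -natrX ltr_nat ltn_expl.
Qed.

End additive_error.

Section exponential_law.
Context {R : realType}.
Variables (g Q : R -> R).
Local Notation mu := (@lebesgue_measure R).
Hypotheses (mg : measurable_fun setT g) (g0 : forall s, 0 <= g s).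
Hypothesis ig : forall (a b : R), mu.-integrable `[a, b] (EFin \o g).
Hypothesis QE : Q = (fun t => \int[mu]_(r in `[0, t]) g r).

Let igoc (a b : R) : mu.-integrable `]a, b] (EFin \o g).
Proof.
by apply: integrableS (ig a b) => //; apply: subset_itvr; rewrite bnd_simp.
Qed.

Let QB (a b : R) : 0 <= a -> a <= b -> Q b - Q a = \int[mu]_(r in `]a, b]) g r.
Proof. by move=> a0 ab; rewrite QE (Rintegral_itvB (ig 0 b))//= bnd_simp. Qed.

Lemma cumul_le (a b : R) : 0 <= a -> a <= b -> Q a <= Q b.
Proof.
by move=> a0 ab; rewrite -subr_ge0 QB//; apply: Rintegral_ge0 => x _.
Qed.

Lemma cumul_ge0 t : 0 <= Q t.
Proof. by rewrite QE; apply: Rintegral_ge0 => x _. Qed.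

Lemma cumul0 : Q 0 = 0.
Proof. by rewrite QE set_itv1 Rintegral_set1. Qed.

(** [Q] is monotone on the whole line: at negative times it is an integral over an empty interval,
    hence zero. *)
Lemma measurable_expR_cumul (D : set R) : measurable D ->
  measurable_fun D (fun x => expR (- Q x)).
Proof.
move=> mD; apply: measurableT_comp => //; apply: measurable_funN.
apply: nondecreasing_measurable => // x y xy.
have [x0|x0] := leP 0 x; first exact: cumul_le.
by rewrite {1}QE set_itv_ge ?Rintegral_set0 ?cumul_ge0// bnd_simp -ltNge.
Qed.

Let h x := expR (- Q x) * g x.

Let ih (a b : R) : mu.-integrable `]a, b] (EFin \o h).
Proof.
apply: le_integrable (igoc a b) => //.
  apply/measurable_EFinP; apply: measurable_funM; last exact: measurable_funTS.
  exact: measurable_expR_cumul.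
move=> x _ /=; rewrite lee_fin !ger0_norm ?mulr_ge0 ?expR_ge0//.
by rewrite ler_piMl// -expR0 ler_expR oppr_le0 cumul_ge0.
Qed.

Let h_le (a b : R) : 0 <= a -> a <= b ->
  expR (- Q b) * (Q b - Q a) <= \int[mu]_(x in `]a, b]) h x <=
  expR (- Q a) * (Q b - Q a).
Proof.
move=> a0 ab; rewrite (QB a0 ab).
have mab : measurable (`]a, b] : set (measurableTypeR R)) by exact: measurable_itv.
have Z c : c * \int[mu]_(x in `]a, b]) g x = \int[mu]_(x in `]a, b]) (c * g x).
  by rewrite (RintegralZl c mab (igoc a b)).
have iZ c : mu.-integrable `]a, b] (EFin \o (fun x => c * g x)).
  exact: (integrableZl mab c (igoc a b)).
rewrite (Z (expR (- Q b))) (Z (expR (- Q a))); apply/andP; split.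
- apply: (le_Rintegral mab (iZ _) (ih a b)) => x.
  rewrite /= in_itv/= => /andP[ax xb].
  apply: ler_wpM2r; [exact: g0 x|rewrite ler_expR lerN2; apply: cumul_le => //].
  exact/ltW/(le_lt_trans a0 ax).
- apply: (le_Rintegral mab (ih a b) (iZ _)) => x.
  rewrite /= in_itv/= => /andP[ax xb].
  by apply: ler_wpM2r; [exact: g0 x|rewrite ler_expR lerN2; exact/cumul_le/ltW].
Qed.

(** The integrand is formally the derivative of [- expR (- Q x)]. The difference of the two sides,
    taken over []a, b]], is additive in the interval and bounded by the squared increment of [Q], so
    it vanishes. *)
Lemma integral_expR_cumul t : 0 <= t ->
  (\int[mu]_(x in `]0%R, t[) (expR (- Q x) * g x)%:E)%E = (1 - expR (- Q t))%:E.
Proof.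
move=> t0; rewrite -(@integral_itv_bndoo _ _ _ _ false false); last first.
  have /measurable_int := ih 0 t; apply: measurable_funS => //.
  by apply: subset_itvl; rewrite bnd_simp.
rewrite -[LHS]fineK; last exact: integrable_fin_num.
have -> : 1 - expR (- Q t) = expR (- Q 0) - expR (- Q t).
  by rewrite cumul0 oppr0 expR0.
congr EFin; apply/eqP; rewrite -subr_eq0; apply/eqP.
apply: (@additive_error_eq0 R Q (fun a b => \int[mu]_(x in `]a, b]) h x -
  (expR (- Q a) - expR (- Q b))) t) => //.
- by rewrite QE; exact: (@parameterized_integral_continuous R 0 t g t0 (ig 0 t)).
- exact: cumul_le.
- move=> a b c a0 ab bc ct.
  rewrite -(@Rintegral_itvB _ h (BRight a) (BRight c) b) ?bnd_simp//.
  by ring.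
- by move=> a b a0 ab bt; apply: expR_mean_value;
    [exact: cumul_ge0|exact: cumul_le|exact: h_le].
Qed.

End exponential_law.

Section reflection.
Context {R : realType}.
Local Notation mu := (@lebesgue_measure R).

Let measurable_reflect (s : R) :
  measurable_fun setT (fun r : measurableTypeR R => s - r : measurableTypeR R).
Proof. by apply: measurable_funB. Qed.

Let lebesgue_measure_reflect (s : R) (A : set R) : measurable A ->
  pushforward mu (fun r => s - r : measurableTypeR R) A = mu A.
Proof.
move=> mA; apply/esym/lebesgue_measure_unique => //=.
move=> _ [[a b]] _ <-.
rewrite /pushforward (_ : _ @^-1` _ = `[s - b, s - a[%classic); last first.
  apply/seteqP; split => x /=; rewrite !in_itv/= => /andP[h1 h2];
    apply/andP; split; lra.
rewrite !lebesgue_measure_itv/= !lte_fin ltrD2l ltrN2; case: ifPn => // _.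
by rewrite -!EFinD; congr EFin; ring.
Qed.

(** The reflection at [s / 2] preserves Lebesgue measure and maps the interval onto itself. It makes
    the integrated rate of a trajectory the same in both directions. *)
Lemma integral_reflect (s : R) (f : R -> \bar R) :
  measurable_fun setT f -> (forall r, 0 <= f r)%E ->
  (\int[mu]_(r in `[0%R, s]) f (s - r)%R = \int[mu]_(r in `[0%R, s]) f r)%E.
Proof.
move=> mf f0; rewrite [in LHS](_ : `[0, s]%classic =
    (fun r => s - r : measurableTypeR R) @^-1` `[0, s]); last first.
  apply/seteqP; split => x /=; rewrite !in_itv/= => /andP[h1 h2];
    apply/andP; split; lra.
have mr := measurable_reflect s.
rewrite -(ge0_integral_pushforward mr)//; last exact: measurable_funTS.
by apply: eq_measure_integral => //= A mA _; exact: lebesgue_measure_reflect.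
Qed.

End reflection.

(** * Joint measurability of the flow *)

Section measurable_flow.
Context {R : realType} {T : pmetricType R} {phi : R -> T -> T}.
Hypothesis phi_flow : flow phi.

(** The domain carries the product sigma-algebra, so the preimage of an open set has to be a
    countable union of measurable rectangles. By continuity, rational time intervals suffice, each
    paired with the interior of the set of points that stay in the open set throughout the
    interval. *)
Lemma measurable_flow :
  measurable_fun setT (fun p : R * borel T => phi p.1 p.2 : borel T).
Proof.
apply: (@measurability _ _ (R * borel T)%type (borel T) setT _ (@open T)) => //.
move=> _ [U oU <-]; rewrite setTI.
have -> : (fun p : R * T => phi p.1 p.2) @^-1` U =
    \bigcup_a \bigcup_b (`]ratr a, ratr b[%classic `*`
      (interior [set x | forall t : R, ratr a < t < ratr b -> U (phi t x)])).
  apply/seteqP; split => [[t x]/= Utx|[t x]/=]; last first.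
    move=> [a _ [b _ [/= tab]]] /interior_subset/=; apply.
    by move: tab; rewrite in_itv.
  have : nbhs (t, x) ((fun p : R * T => phi p.1 p.2) @^-1` U).
    by apply: (flow_continuous phi_flow); exact: open_nbhs_nbhs.
  move=> [[A B]/= [nA nB] AB].
  have [e /= e0 eA] := nA.
  have [a] : exists a : rat, ratr a \in `]t - e, t[ by apply: rat_in_itvoo; lra.
  have [b] : exists b : rat, ratr b \in `]t, t + e[ by apply: rat_in_itvoo; lra.
  rewrite !in_itv/= => /andP[b1 b2] /andP[a1 a2].
  exists a => //; exists b => //; split => /=; first by rewrite in_itv/= a2 b1.
  apply: filterS nB => y By s /andP[s1 s2].
  apply: (AB (s, y)); split => //=; apply: eA.
  by rewrite /ball_/= distrC ltr_distl; apply/andP; split; lra.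
apply: bigcupT_measurable_rat => a; apply: bigcupT_measurable_rat => b.
apply: measurableX; first exact: measurable_itv.
by apply: sub_sigma_algebra; exact: open_interior.
Qed.

End measurable_flow.

(** * Absence of entrance times inside a trajectory *)

Section isolated_entrances.
Context {R : realType}.
Variables (N : set R) (T : R).
Hypothesis right_isolated : forall n : R, N n -> 0 < n < T ->
  exists2 e : R, 0 < e & forall r, n < r < n + e -> ~ N r.
Hypothesis left_limit : forall n : R, N n -> 0 < n < T ->
  forall e : R, 0 < e -> exists2 r, N r & 0 < r /\ n - e < r < n.
Hypothesis left_closed : forall r : R, 0 < r < T -> ~ N r ->
  exists2 e : R, 0 < e & forall n : R, r - e < n < r -> ~ N n.

(** [N] will be the set of times at which a forward trajectory meets Gamma^-. Strict nesting in
    [narrow] keeps the common point away from all end points, and the factor 2 makes the lengths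
    tend to zero. *)
Let bracket (p : R * R) := [/\ N p.1, N p.2 & (0 < p.1 < p.2) && (p.2 < T)].
Let narrow (p p' : R * R) :=
  [/\ bracket p', p.1 < p'.1, p'.2 < p.2 & 2 * (p'.2 - p'.1) <= p.2 - p.1].

(** Both new ends are approximations from the left: first one of [b], then one of the point just
    found. *)
Let narrowing p : bracket p -> exists p', narrow p p'.
Proof.
case: p => a b [/= Na Nb /andP[/andP[a0 ab] bT]].
have [||b' Nb' [b'0 /andP[bb1 bb2]]] := left_limit Nb _ (e := b - a).
- by apply/andP; split; lra.
- lra.
(* The first bound keeps the new left end beyond [a], the second halves the length. *)
pose e := Num.min (b' - a) ((b - a) / 2).
have e0 : 0 < e by rewrite lt_min; apply/andP; split; lra.
have b'T : 0 < b' < T by apply/andP; split; lra.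
have [a' Na' [a'0 /andP[aa1 aa2]]] := left_limit Nb' b'T e0.
have e1 : e <= b' - a by rewrite ge_min lexx.
have e2 : e <= (b - a) / 2 by rewrite ge_min lexx orbT.
exists (a', b'); split => /=; try lra.
by split => //=; apply/andP; split; [apply/andP; split|]; lra.
Qed.

(* Otherwise nested intervals with end points in [N] shrink to a point which
   lies in [N], being an increasing limit, and which is not isolated on the
   right. *)
Lemma no_isolated_entrance (n : R) : 0 < n < T -> ~ N n.
Proof.
move=> nT Nn; have /andP[n0 nltT] := nT.
have [a Na [a0 /andP[_ an]]] := left_limit Nn nT n0.
pose next p := xget p (narrow p).
pose u k := iter k next (a, n).
have ub k : bracket (u k).
  elim: k => [|k ih] /=; first by split => //=; rewrite a0 an.
  by have [p' pp'] := narrowing ih; rewrite /next; case: xgetP => [_ -> []|/(_ p')].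
have un k : narrow (u k) (u k.+1).
  have [p' pp'] := narrowing (ub k).
  rewrite /u iterS -/(u k) /next.
  by case: xgetP => [//|/(_ p')].
have mono k l : (k <= l)%N -> (u k).1 <= (u l).1 /\ (u l).2 <= (u k).2.
  move=> /subnK <-; elim: (l - k)%N => [//|i [ih1 ih2]].
  have [_ h1 h2 _] := un (i + k)%N.
  by rewrite addSn; split; [apply: (le_trans ih1 (ltW h1))|
                            apply: (le_trans (ltW h2) ih2)].
have lt12 k l : (u k).1 < (u l).2.
  have [h1 _] := mono _ _ (leq_maxl k l); have [_ h2] := mono _ _ (leq_maxr k l).
  have [_ _ /andP[/andP[_ h3] _]] := ub (maxn k l).
  by apply: le_lt_trans h1 _; apply: lt_le_trans h3 h2.
pose A := range (fun k => (u k).1).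
have ubA l : ubound A (u l).2 by move=> _ [k _ <-]; exact/ltW.
have hA : has_sup A by split; [exists a, 0%N|exists n; exact: (ubA 0%N)].
pose r := sup A.
have r1 k : (u k).1 < r.
  have [_ h _ _] := un k; apply: (lt_le_trans h).
  by apply: (sup_upper_bound hA); exists k.+1.
have r2 k : r < (u k).2.
  have [_ _ h _] := un k; apply: le_lt_trans h.
  by apply: ge_sup; [exists a, 0%N|exact: ubA].
have rT : 0 < r < T by rewrite (lt_trans a0 (r1 0%N)) (lt_trans (r2 0%N) nltT).
(* Otherwise [left_closed] would clear a left neighbourhood of [r], where the left ends
   accumulate. *)
have Nr : N r.
  apply: contrapT => /(left_closed rT)[e e0 eN].
  have [_ [k _ <-] rek] := sup_adherent e0 hA.
  by have [Nk _ _] := ub k; apply: eN Nk; rewrite rek r1.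
have [e e0 eN] := right_isolated Nr rT.
have small k : 2 ^+ k * ((u k).2 - (u k).1) <= n - a.
  elim: k => [|k ih]; first by rewrite expr0 mul1r.
  apply: le_trans ih; rewrite exprSr -mulrA ler_wpM2l ?exprn_ge0//.
  by have [] := un k.
(* After [k] halvings the interval is shorter than the gap [e] to the right of [r], and its right
   end is a point of [N] in that gap. *)
pose k := (Num.truncn ((n - a) / e)).+1.
have [_ Nk _] := ub k; apply: eN Nk; rewrite r2/=.
have : (u k).2 - (u k).1 < e; last by have := r1 k; lra.
rewrite -(@ltr_pM2l _ (2 ^+ k)) ?exprn_gt0//; apply: le_lt_trans (small k) _.
rewrite -ltr_pdivrMr//; apply: (lt_trans (truncnS_gt _)).
by rewrite -natrX ltr_nat ltn_expl.
Qed.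

End isolated_entrances.

(** Each point gets a rational number in the gap to its right; of two points sharing one, the larger
    would lie in the gap of the smaller. *)
Lemma right_isolated_countable (R : realType) (N : set R) :
  (forall n, N n -> exists2 e, 0 < e & forall r, n < r < n + e -> ~ N r) ->
  countable N.
Proof.
move=> isoN.
have rat_in n : exists p : rat, N n ->
    n < ratr p /\ forall r, n < r -> r <= ratr p -> ~ N r.
  have [Nn|nNn] := pselect (N n); last by exists 0.
  have [e e0 eN] := isoN n Nn.
  have [p] : exists p : rat, ratr p \in `]n, n + e[ by apply: rat_in_itvoo; lra.
  rewrite in_itv/= => /andP[p1 p2]; exists p => _; split => // r nr rp.
  by apply: eN; rewrite nr (le_lt_trans rp p2).
have [p pN] := choice rat_in.
apply/countable_injP; exists (fun n => pickle (p n)) => n n'.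
rewrite !inE => Nn Nn' /(pcan_inj pickleK) pp.
have [p1 N1] := pN n Nn; have [p2 N2] := pN n' Nn'.
have [nn'|nn'|//] := ltgtP n n'.
- by exfalso; apply: (N1 n') => //; rewrite pp ltW.
- by exfalso; apply: (N2 n) => //; rewrite -pp ltW.
Qed.

Lemma ge0_integral_eq0_ae d (X : measurableType d) (R : realType)
    (mu : {measure set X -> \bar R}) (D : set X) (f : X -> \bar R) :
  measurable D -> measurable_fun D f -> (forall x, D x -> 0 <= f x)%E ->
  (\int[mu]_(x in D) f x = 0)%E -> ae_eq mu D f (cst 0%E).
Proof.
move=> mD mf f0 if0; apply/ae_eq_integral_abs => //.
rewrite -[RHS]if0; apply: eq_integral => x; rewrite inE => Dx.
by rewrite gee0_abs// f0.
Qed.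

(** Rays are stable under intersection and generate the Borel sets, so a distribution function
    determines the law. This identifies the law of the first jump time. *)
Lemma measure_unique_rays (R : realType)
    (m1 m2 : {measure set (measurableTypeR R) -> \bar R}) :
  (forall t : R, m1 `]-oo, t]%classic = m2 `]-oo, t]%classic) ->
  (forall t : R, (m1 `]-oo, t]%classic < +oo)%E) ->
  forall A, measurable A -> m1 A = m2 A.
Proof.
move=> m12 m1oo; pose H := [set A : set R | exists t : R, A = `]-oo, t]%classic].
have mH : (@measurable _ (measurableTypeR R)) = <<s H >>.
  apply/seteqP; split => [A|].
    rewrite (RGenOInfty.measurableE R).
    apply: smallest_sub; first exact: smallest_sigma_algebra.
    move=> _ [t ->]; rewrite -setCitvl.
    have sH := smallest_sigma_algebra setT H.
    by rewrite -setTD; apply: sigma_algebraCD => //; apply: sub_gen_smallest; exists t.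
  apply: smallest_sub; first exact: sigma_algebra_measurable.
  by move=> _ [t ->]; exact: measurable_itv.
move=> A; pose g (n : nat) : set (measurableTypeR R) := `]-oo, n%:R]%classic.
apply: (@measure_unique _ R (measurableTypeR R) H g mH _ _ _ m1 m2) => //.
- move=> _ _ [s ->] [t ->]; exists (Num.min s t).
  by apply/seteqP; split => u /=; rewrite !in_itv/= le_min => /andP.
- by move=> n; exists n%:R.
- apply/seteqP; split => // t _; exists (Num.truncn t).+1 => //=.
  by rewrite /g /= in_itv/= ltW// truncnS_gt.
- by move=> _ [t ->].
- by move=> k; exact: m1oo.
Qed.

(** * Positive operators on pairs of integrable functions *)

Section operators.
Context d (X : measurableType d) (R : realType).
Implicit Types (mu nu : {measure set X -> \bar R}) (A B : set X) (f g : X -> R).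

Lemma L1_linear mu A (a : R) f f' : measurable A -> L1 mu A f -> L1 mu A f' ->
  L1 mu A (a \*: f \+ f').
Proof.
move=> mA Lf Lf'.
apply: (@eq_integrable _ _ _ mu A mA (fun x => a%:E * (f x)%:E + (f' x)%:E)%E) => //.
by apply: integrableD => //; exact: (integrableZl mA a Lf).
Qed.

Lemma L1_funrpos mu A f : measurable A -> L1 mu A f -> L1 mu A f^\+.
Proof. by move=> mA Lf; exact: integrable_funrpos. Qed.

Lemma L1_funrneg mu A f : measurable A -> L1 mu A f -> L1 mu A f^\-.
Proof. by move=> mA Lf; exact: integrable_funrneg. Qed.

Lemma ae_ge0_funrpos mu A f : (\forall x \ae mu, A x -> 0 <= f x) ->
  ae_eq mu A f f^\+.
Proof. by apply: filterS => x /[apply] fx; rewrite /funrpos (max_idPl fx). Qed.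

(** As [k] is nonnegative, the positive and negative parts of the product are [k] times those of
    [f], so that the equality is the definition of the integral and includes infinite values. *)
Lemma integral_signed nu A (k : X -> \bar R) f : (forall x, 0 <= k x)%E ->
  (\int[nu]_(x in A) (k x * (f x)%:E) =
   \int[nu]_(x in A) (k x * (f^\+ x)%:E) - \int[nu]_(x in A) (k x * (f^\- x)%:E))%E.
Proof.
move=> k0; have maxM x (u : R) : (maxe (k x * u%:E) 0)%E = (k x * (Num.max u 0)%:E)%E.
  have [u0|/ltW u0] := leP 0 u; first by rewrite max_l// mule_ge0.
  by rewrite max_r ?mule0// mule_ge0_le0.
rewrite integralE; congr (_ - _)%E; apply: eq_integral => x _.
  by rewrite funeposE maxM.
by rewrite funenegE -muleN -EFinN maxM.
Qed.

Lemma integralB_L1 nu A B (u v : X -> R) :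
  measurable A -> measurable B -> B `<=` A -> L1 nu A u -> L1 nu A v ->
  (\int[nu]_(x in B) ((u \- v) x)%:E =
   \int[nu]_(x in B) (u x)%:E - \int[nu]_(x in B) (v x)%:E)%E.
Proof.
move=> mA mB BA Lu Lv.
rewrite -(integralB mB (integrableS mA mB BA Lu) (integrableS mA mB BA Lv)).
by apply: eq_integral => x _; rewrite -EFinB.
Qed.

Section composition.
Variables (mu nu mu1 nu1 rho : {measure set X -> \bar R}) (A B A1 B1 D : set X).
Hypotheses (mA : measurable A) (mB : measurable B).
Hypotheses (mA1 : measurable A1) (mB1 : measurable B1).

Lemma plo_comp (S1 S2 Q : (X -> R) -> (X -> R) -> X -> R) :
  positive_linear_operator mu A nu B mu1 A1 S1 ->
  positive_linear_operator mu A nu B nu1 B1 S2 ->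
  positive_linear_operator mu1 A1 nu1 B1 rho D Q ->
  positive_linear_operator mu A nu B rho D (fun f g => Q (S1 f g) (S2 f g)).
Proof.
move=> p1 p2 pQ; split.
- by move=> f g Lf Lg; apply: (plo_L1 pQ); [exact: (plo_L1 p1)|exact: (plo_L1 p2)].
- move=> f f' g g' Lf Lf' Lg Lg' ff' gg'; apply: (plo_ae pQ);
    try exact: (plo_L1 p1); try exact: (plo_L1 p2).
    exact: (plo_ae p1).
  exact: (plo_ae p2).
- move=> a f f' g g' Lf Lf' Lg Lg'.
  have L1f := plo_L1 p1 Lf Lg; have L1f' := plo_L1 p1 Lf' Lg'.
  have L2f := plo_L1 p2 Lf Lg; have L2f' := plo_L1 p2 Lf' Lg'.
  apply: ae_eq_trans (plo_linear pQ a L1f L1f' L2f L2f').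
  apply: (plo_ae pQ); try exact: L1_linear.
  + by apply: (plo_L1 p1); exact: L1_linear.
  + by apply: (plo_L1 p2); exact: L1_linear.
  + exact: (plo_linear p1).
  + exact: (plo_linear p2).
- move=> f g Lf Lg f0 g0; apply: (plo_ge0 pQ).
  + exact: (plo_L1 p1).
  + exact: (plo_L1 p2).
  + exact: (plo_ge0 p1).
  + exact: (plo_ge0 p2).
Qed.

Variable Q : (X -> R) -> (X -> R) -> X -> R.
Hypotheses (mD : measurable D) (pQ : positive_linear_operator mu A nu B rho D Q).

Let Q' f g := Q f^\+ g^\+ \- Q f^\- g^\-.

(** Linearity with the scalar -1 recombines the two parts. Hence an operator already linear on
    signed pairs agrees almost everywhere with its extension from nonnegative pairs, which is the
    form in which [opK] is defined. *)
Lemma plo_signed f g : L1 mu A f -> L1 nu B g ->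
  ae_eq rho D (Q f^\+ g^\+ \- Q f^\- g^\-) (Q f g).
Proof.
move=> Lf Lg.
have pn (h : X -> R) : (-1 : R) \*: h^\- \+ h^\+ = h.
  apply/funext => x; rewrite /= scaleN1r addrC.
  by have := congr1 (fun k => k x) (funrposBneg h); rewrite /= !fctE.
have := plo_linear pQ (-1) (L1_funrneg mA Lf) (L1_funrpos mA Lf)
  (L1_funrneg mB Lg) (L1_funrpos mB Lg).
rewrite !pn; apply: filterS => x /[apply] ->.
by rewrite /= scaleN1r addrC.
Qed.

Lemma plo_signed_extension : positive_linear_operator mu A nu B rho D Q'.
Proof.
have LQ' f g : L1 mu A f -> L1 nu B g -> L1 rho D (Q' f g).
  move=> Lf Lg.
  have L := L1_linear (-1) mD (plo_L1 pQ (L1_funrneg mA Lf) (L1_funrneg mB Lg))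
                     (plo_L1 pQ (L1_funrpos mA Lf) (L1_funrpos mB Lg)).
  suff -> : Q' f g = (-1 : R) \*: Q f^\- g^\- \+ Q f^\+ g^\+ by [].
  by apply/funext => x; rewrite /Q' /= scaleN1r addrC.
split => [//|f f' g g' Lf Lf' Lg Lg' ff' gg'|a f f' g g' Lf Lf' Lg Lg'|f g Lf Lg f0 g0].
- apply: ae_eq_trans (plo_signed Lf Lg) _.
  apply: ae_eq_trans (ae_eq_sym (plo_signed Lf' Lg')).
  exact: (plo_ae pQ).
- apply: ae_eq_trans (plo_signed (L1_linear a mA Lf Lf') (L1_linear a mB Lg Lg')) _.
  apply: ae_eq_trans (plo_linear pQ a Lf Lf' Lg Lg') _.
  apply: filterS2 (plo_signed Lf Lg) (plo_signed Lf' Lg') => x e1 e2 Dx.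
  by rewrite /= -(e1 Dx) -(e2 Dx).
- apply: filterS2 (plo_signed Lf Lg) (plo_ge0 pQ Lf Lg f0 g0) => x e1 e2 Dx.
  by rewrite /Q' (e1 Dx); exact: e2.
Qed.

End composition.

(** Positivity applied to |f| + f and to |f| - f bounds the absolute value of Q f by Q |f|. This
    carries the contraction property from nonnegative pairs to signed ones. *)
Lemma norm_ge0_operator_le mu nu (rho : {measure set X -> \bar R})
    A B (C : set X) (Q : (X -> R) -> (X -> R) -> X -> R) f g :
  measurable A -> measurable B -> measurable C ->
  positive_linear_operator mu A nu B rho C Q -> L1 mu A f -> L1 nu B g ->
  (\int[rho]_(x in C) `|Q f g x|%:E <=
   \int[rho]_(x in C) `|Q (Num.norm \o f) (Num.norm \o g) x|%:E)%E.
Proof.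
move=> mA mB mC pQ Lf Lg.
have Lnf : L1 mu A (Num.norm \o f) by exact: (integrable_norm Lf).
have Lng : L1 nu B (Num.norm \o g) by exact: (integrable_norm Lg).
have LQ := plo_L1 pQ Lf Lg; have LnQ := plo_L1 pQ Lnf Lng.
have ge0 (a : R) : `|a| = 1 -> \forall x \ae rho, C x ->
    0 <= (a \*: Q f g \+ Q (Num.norm \o f) (Num.norm \o g)) x.
  move=> a1; have nge0 h (y : X) : 0 <= (a \*: h \+ (Num.norm \o h)) y.
    rewrite /= /GRing.scale /= addrC -lerBlDr sub0r -(mulN1r (a * h y)).
    by rewrite (le_trans (ler_norm _))// !normrM normrN1 mul1r a1 mul1r.
  have p := plo_ge0 pQ (L1_linear a mA Lf Lnf) (L1_linear a mB Lg Lng)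
    (aeW _ (fun y _ => nge0 f y)) (aeW _ (fun y _ => nge0 g y)).
  by apply: filterS2 p (plo_linear pQ a Lf Lnf Lg Lng) => x /[swap] e px Cx; rewrite -e// px.
apply: ae_ge0_le_integral => //.
- exact: (measurableT_comp (@abse_measurable R setT) (measurable_int _ LQ)).
- exact: (measurableT_comp (@abse_measurable R setT) (measurable_int _ LnQ)).
apply: filterS2 (ge0 1 (normr1 _)) (ge0 (-1) (normrN1 _)) => x u v Cx.
rewrite lee_fin; apply: le_trans (ler_norm _).
move: (u Cx) (v Cx); rewrite /= /GRing.scale /= => u' v'.
by rewrite ler_norml; apply/andP; split; lra.
Qed.

End operators.

(** * Trajectories between entrance and exit *)

Section transport.
Context {R : realType} {T : pmetricType R} {phi : R -> T -> T} {E0 : set T}.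
Hypothesis phi_flow : flow phi.
Hypothesis phi_well_posed : well_posed phi E0.

Local Notation E := (state phi E0).
Local Notation G := (Gamma phi E0).
Local Notation hit := (hit phi E0).
Local Notation D b := (E `|` G (~~ b)).
Local Notation fl b s x := (phi (sgt b s) x).

Lemma sgtN b (s : R) : sgt (~~ b) s = - sgt b s.
Proof. by case: b; rewrite /sgt ?opprK. Qed.

Lemma sgtD b (s t : R) : sgt b (s + t) = sgt b s + sgt b t.
Proof. by case: b; rewrite /sgt ?opprD. Qed.

Lemma flD b s t x : fl b s (fl b t x) = fl b (t + s) x.
Proof. by rewrite (flowD phi_flow) sgtD. Qed.

Lemma flB b s t x : fl (~~ b) s (fl b t x) = fl b (t - s) x.
Proof.
by rewrite (flowD phi_flow) sgtN sgtD; case: b; rewrite /sgt ?opprK.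
Qed.

Lemma fl0 b x : fl b 0 x = x.
Proof. by case: b; rewrite /sgt ?oppr0 (flow0 phi_flow). Qed.

Lemma flK b s x : fl (~~ b) s (fl b s x) = x.
Proof. by rewrite flB subrr fl0. Qed.

Lemma Gamma_notE0 b x : G b x -> ~ E0 x.
Proof. by move=> [[]]. Qed.

Lemma state_notGamma x : E x -> ~ G true x.
Proof. by move=> [E0x /Gamma_notE0//|[Gx] nG Gtx]; apply: nG. Qed.

Lemma state_cases x : E x -> E0 x \/ (G false x /\ ~ G true x).
Proof.
move=> Ex; have := state_notGamma Ex; case: Ex => [|[]]; first by left.
by right.
Qed.

Lemma E0_dom b x : E0 x -> D b x.
Proof. by move=> ?; left; left. Qed.

Lemma Gamma_dom b x : G (~~ b) x -> D b x.
Proof. by right. Qed.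

(** This is the approach to [z] from inside, read in the opposite direction. *)
Lemma E0_before_Gamma b z : G b z ->
  exists2 t, 0 < t & forall s, 0 < s -> s <= t -> E0 (fl (~~ b) s z).
Proof.
move=> [_ [x [t [E0x t0 -> xE0]]]]; exists t => // s s0 st.
by rewrite flB; apply: xE0; apply/andP; split; lra.
Qed.

Lemma hit_ge0 b x : (0 <= hit b x)%E.
Proof.
rewrite /Defs.hit; case: ifPn => // _.
by apply: le_ereal_inf_tmp => _ [t [t0 _] <-]; rewrite lee_fin ltW.
Qed.

Lemma hit_le b x t : 0 < t -> G b (fl b t x) -> (hit b x <= t%:E)%E.
Proof.
move=> t0 Gt; rewrite /Defs.hit; case: ifPn => _; first by rewrite lee_fin ltW.
by apply: ereal_inf_lbound; exists t.
Qed.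

Lemma notGamma_hit b x s : 0 < s -> (s%:E < hit b x)%E -> ~ G b (fl b s x).
Proof. by move=> s0 + /(hit_le s0) => /lt_le_trans h /h; rewrite ltxx. Qed.

(** The condition on [x] excludes the points where [hit b] is zero by convention, so that [hit b x]
    is the infimum. *)
Lemma hit_ge b x t : E0 x \/ G (~~ b) x ->
  (forall s, 0 < s -> s < t -> ~ G b (fl b s x)) -> (t%:E <= hit b x)%E.
Proof.
move=> xreg tx; rewrite /Defs.hit; case: ifPn => [|_].
  by rewrite inE => -[/Gamma_notE0 nE0 nG]; case: xreg.
apply: le_ereal_inf_tmp => _ [s [s0 Gs] <-]; rewrite lee_fin leNgt.
by apply/negP => st; exact: tx Gs.
Qed.

Lemma hit_point_Gamma b x t : D b x -> hit b x = t%:E -> G b (fl b t x).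
Proof.
move=> Dx hx; have [_] := phi_well_posed Dx.
by rewrite /hit_point hx ltry; exact.
Qed.

(** By well-posedness a finite hitting time is attained, so a zero one would put a point of E0 on
    the boundary. From the opposite boundary the trajectory first spends some time inside E0. *)
Lemma hit_gt0 b x : E0 x \/ G (~~ b) x -> (0 < hit b x)%E.
Proof.
move=> xreg; rewrite lt_neqAle hit_ge0 andbT; apply/negP => /eqP h0.
case: (xreg) => [E0x|Gx].
  have := hit_point_Gamma (E0_dom b E0x) (esym h0); rewrite fl0.
  by move/Gamma_notE0.
have [t t0 tE0] := E0_before_Gamma Gx.
have : (t%:E <= hit b x)%E.
  apply: hit_ge => // s s0 st /Gamma_notE0; apply.
  by have := tE0 s s0 (ltW st); rewrite negbK.
by rewrite -h0 lee_fin leNgt t0.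
Qed.

Lemma path_state b x s : D b x -> 0 < s -> (s%:E < hit b x)%E -> E (fl b s x).
Proof. by move=> /phi_well_posed[+ _]; exact. Qed.

(** Well-posedness only places the trajectory in E. A passage through Gamma^- on the way would be
    followed by a stay in E0 and preceded by other passages arbitrarily close to it, and
    [no_isolated_entrance] rules this out. *)
Lemma path_E0 b x s : D b x -> 0 < s -> (s%:E < hit b x)%E -> E0 (fl b s x).
Proof.
move=> Dx s0 sx; have [//|[Gs nGs]] := state_cases (path_state Dx s0 sx).
(* Backwards, a point of Gamma^- before the hitting time contradicts the infimum at once; the
   forward direction remains. *)
case: b Dx sx Gs nGs => Dx sx Gs nGs; last by have := notGamma_hit s0 sx.
exfalso.
(* A finite horizon [t] stands for the hitting time, which may be infinite. *)
have [t [st tx]] : exists t : R, s < t /\ (t%:E <= hit true x)%E.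
  case: (hit true x) sx => [t| |//]; first by exists t; rewrite lexx -lte_fin.
  by exists (s + 1); rewrite leey; split => //; lra.
have in_state r : 0 < r < t -> E (fl true r x).
  move=> /andP[r0 rt]; apply: path_state => //.
  by apply: lt_le_trans tx; rewrite lte_fin.
pose N := [set r | G false (fl true r x)].
have s_t : 0 < s < t by rewrite s0.
apply: (@no_isolated_entrance R N t) s_t Gs => {s s0 sx nGs st}.
- move=> n Nn nt; have [e e0 eE0] := E0_before_Gamma Nn.
  exists e => // r /andP[nr re] /Gamma_notE0; apply.
  have := eE0 (r - n); rewrite (flD true) addrCA subrr addr0; apply; lra.
(* Without earlier entrances close to [n], the trajectory would arrive at time [n] from inside E0;
   the point would then also lie in Gamma^+, which is disjoint from E. *)
- move=> n Nn nt e e0; apply: contrapT => nN.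
  have /andP[n0 nltt] := nt.
  apply: (state_notGamma (in_state n nt)).
  pose d := Num.min (e / 2) (n / 2).
  have d1 : d <= e / 2 by rewrite ge_min lexx.
  have d2 : d <= n / 2 by rewrite ge_min lexx orbT.
  have d0 : 0 < d by rewrite lt_min; apply/andP; split; lra.
  have E0r r : n - d <= r < n -> E0 (fl true r x).
    move=> /andP[r1 r2]; have rt : 0 < r < t by apply/andP; split; lra.
    have [//|[Gr _]] := state_cases (in_state r rt).
    exfalso; apply: nN; exists r => //; split; first by lra.
    by apply/andP; split; lra.
  split; first by case: Nn.
  exists (fl true (n - d) x), d; split => //.
  + by apply: E0r; apply/andP; split; lra.
  + by rewrite (flD true) subrK.
  + move=> r /andP[r1 r2]; rewrite (flD true); apply: E0r.
    by apply/andP; split; lra.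
(* From a point of E0 the backward hitting time is positive, so no entrance occurs shortly before
   [r]. *)
- move=> r rt nNr; have [E0r|[]//] := state_cases (in_state r rt).
  have : (0 < hit false (fl true r x))%E by apply: hit_gt0; left.
  have [e [e0 er]] : exists e : R, 0 < e /\ (e%:E <= hit false (fl true r x))%E.
    have : (0 < hit false (fl true r x))%E by apply: hit_gt0; left.
    case: (hit false _) => [e| |//]; first by exists e; rewrite lexx -lte_fin.
    by exists 1; rewrite leey.
  move=> _; exists e => // n /andP[n1 n2] Nn.
  apply: (@notGamma_hit false (fl true r x) (r - n)); first by lra.
    by apply: lt_le_trans er; rewrite lte_fin; lra.
  by rewrite (flB true) opprB addrCA subrr addr0.
Qed.

(** A backward hit within time [s] would occur on the segment from [x], all of whose points, [x]
    included, lie in E0. This is the time reversal behind the changes of variables. *)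
Lemma E0_hit b x s : E0 x -> 0 < s -> (s%:E < hit b x)%E ->
  (s%:E < hit (~~ b) (fl b s x))%E.
Proof.
move=> E0x s0 sx; rewrite ltNge; apply/negP.
have Dx := E0_dom b E0x.
have E0y := path_E0 Dx s0 sx.
have : (0 < hit (~~ b) (fl b s x))%E by apply: hit_gt0; left.
case hy : (hit _ _) => [t| |]// ; rewrite lte_fin lee_fin => t0 ts.
have := hit_point_Gamma (E0_dom _ E0y) hy; rewrite flB => /Gamma_notE0; apply.
move: ts; rewrite le_eqVlt => /predU1P[->|ts]; first by rewrite subrr fl0.
apply: path_E0 => //; first by lra.
by apply: lt_trans sx; rewrite lte_fin; lra.
Qed.

(** Each inequality uses that a finite hitting time is attained, once from the shifted point and
    once from [x]. *)
Lemma hit_shift b x s : D b x -> 0 < s -> (s%:E < hit b x)%E ->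
  hit b x = (s%:E + hit b (fl b s x))%E.
Proof.
move=> Dx s0 sx; have E0y := path_E0 Dx s0 sx.
have y0 : (0 < hit b (fl b s x))%E by apply: hit_gt0; left.
apply/eqP; rewrite eq_le; apply/andP; split.
  case hy : (hit b (fl b s x)) y0 => [t| |//]; last by rewrite addey ?leey.
  rewrite lte_fin => t0; rewrite -EFinD; apply: hit_le; first by lra.
  by rewrite -flD; exact: hit_point_Gamma (E0_dom _ E0y) hy.
case hx : (hit b x) sx => [t| |//]; last by rewrite leey.
rewrite lte_fin => st; rewrite -leeBrDl//= -EFinB.
apply: hit_le; first by lra.
by rewrite flD addrC subrK; exact: hit_point_Gamma hx.
Qed.

(** The same reversal, started at the exit point itself; it shows that [w b] sends points of E0 into
    [W b]. *)
Lemma E0_hit_end b x t : E0 x -> hit b x = t%:E ->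
  (t%:E < hit (~~ b) (fl b t x))%E.
Proof.
move=> E0x hx; rewrite ltNge; apply/negP.
have Dx := E0_dom b E0x.
have Gz := hit_point_Gamma Dx hx.
have t0 : 0 < t by rewrite -lte_fin -hx; apply: hit_gt0; left.
have Gz' : G (~~ ~~ b) (fl b t x) by rewrite negbK.
have : (0 < hit (~~ b) (fl b t x))%E by apply: hit_gt0; right.
case hz : (hit (~~ b) _) => [u| |]//; rewrite lte_fin lee_fin => u0 ut.
have := hit_point_Gamma (Gamma_dom Gz') hz; rewrite flB => /Gamma_notE0; apply.
move: ut; rewrite le_eqVlt => /predU1P[->|ut]; first by rewrite subrr fl0.
apply: path_E0 => //; first by lra.
by rewrite hx lte_fin; lra.
Qed.


(** * Measurability of hitting times, slices and integrated rates *)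

Hypothesis E0_measurable : measurable (E0 : set (borel T)).
Hypothesis phi_boundary : boundary_measurable phi E0.
Local Notation mu := (@lebesgue_measure R).
Local Notation BT := (borel T).

Lemma mGamma b : measurable (G b : set BT).
Proof. exact: Gamma_measurable. Qed.

Lemma mstate : measurable (E : set BT).
Proof.
apply: measurableU => //; apply: measurableD; first exact: mGamma.
by apply: measurableI; exact: mGamma.
Qed.

Lemma mdom b : measurable (D b : set BT).
Proof. by apply: measurableU; [exact: mstate|exact: mGamma]. Qed.

(* [hit b], set to [0] where it is not assumed to be measurable. *)
Definition hit0 b : BT -> \bar R := (fun x : BT => hit b x) \_ (D b).

Lemma hit0E b x : D b x -> hit0 b x = hit b x.
Proof. by move=> Dx; rewrite /hit0 patchE mem_set. Qed.

Lemma measurable_hit0 b : measurable_fun setT (hit0 b).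
Proof.
by apply/(measurable_restrictT _ (mdom b)); exact: hit_measurable.
Qed.

Definition hitr b x : R := fine (hit0 b x).

Lemma measurable_hitr b : measurable_fun setT (hitr b : BT -> R).
Proof. by apply: measurableT_comp => //; exact: measurable_hit0. Qed.

Lemma hitrE b x t : D b x -> hit b x = t%:E -> hitr b x = t.
Proof. by move=> Dx hx; rewrite /hitr hit0E// hx. Qed.

Definition exits b : set BT := [set x | D b x /\ (hit b x < +oo)%E].

Lemma measurable_exits b : measurable (exits b).
Proof.
have -> : exits b = D b `&` [set x | (hit0 b x < +oo)%E].
  by apply/seteqP; split => x [Dx]; rewrite /= hit0E.
apply: emeasurable_fun_infty_o; first exact: mdom.
by apply: measurable_funTS; exact: measurable_hit0.
Qed.

Lemma exitsE b x : exits b x -> hit b x = (hitr b x)%:E.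
Proof.
move=> [Dx]; rewrite /hitr hit0E//; have := hit_ge0 b x.
by case: (hit b x).
Qed.

Definition slice b x : set R := [set s : R | 0 < s /\ (s%:E < hit b x)%E].

Definition slices b : set (R * BT) := [set p | D b p.2 /\ slice b p.2 p.1].

Lemma measurable_slices b : measurable (slices b).
Proof.
(* Outside its domain [hit0] is zero, so the two inequalities alone force the point into the
   domain. *)
have -> : slices b = [set p | 0 < p.1] `&` [set p | (p.1%:E < hit0 b p.2)%E].
  apply/seteqP; split => -[s x] /=; first by move=> [Dx [s0 sx]]; rewrite hit0E.
  move=> [s0 sx]; have [Dx|nDx] := pselect (D b x).
    by split => //; split => //; rewrite -hit0E.
  by move: sx; rewrite /hit0 patchE memNset// lte_fin ltNge ltW.
apply: measurableI.
  rewrite (_ : mkset _ = setT `&` (fst : R * BT -> R) @^-1` `]0, +oo[); last first.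
    by apply/seteqP; split => -[s x] /=; rewrite in_itv/= andbT// => -[].
  exact: measurable_fst.
rewrite -[X in measurable X]setTI; apply: measurable_lte => //.
  by apply/measurable_EFinP; exact: measurable_fst.
by apply: measurableT_comp; [exact: measurable_hit0|exact: measurable_snd].
Qed.

Lemma slice_integral b x (k : R * BT -> \bar R) : D b x ->
  (\int[mu]_(s in slice b x) k (s, x) = \int[mu]_s (k \_ (slices b)) (s, x))%E.
Proof.
move=> Dx; rewrite integral_mkcond; apply: eq_integral => s _.
rewrite !patchE; congr (if _ then _ else _).
by apply/idP/idP => /set_mem h; apply/mem_set; [split|case: h].
Qed.

Section composition.
Context d (X : measurableType d) (u : X -> R) (v : X -> BT).
Hypotheses (mu_ : measurable_fun setT u) (mv : measurable_fun setT v).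

Lemma measurable_sgt b : measurable_fun setT (fun x => sgt b (u x)).
Proof. by case: b => //; exact: measurable_funN. Qed.

Lemma measurable_phi : measurable_fun setT (fun x => phi (u x) (v x) : BT).
Proof.
exact: (measurableT_comp (measurable_flow phi_flow)
                         (measurable_fun_pair mu_ mv)).
Qed.
End composition.

Variable q : T -> R.
Hypothesis q_rate : rate_function phi E0 q.
Hypothesis rate_hyp : rate_assumption phi q.

Lemma rate_ge0 x : 0 <= q x.
Proof.
have [Ex|nEx] := pselect (E x); first exact: (q_ge0 q_rate).
by rewrite (q_outside q_rate).
Qed.

Lemma measurable_rate : measurable_fun setT (q : BT -> R).
Proof.
have -> : q = (q : BT -> R) \_ E.
  apply/funext => x; rewrite patchE; case: ifPn => //.
  by rewrite notin_setE => /(q_outside q_rate).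
by apply/(measurable_restrictT _ mstate); exact: (q_measurable q_rate).
Qed.

Local Notation cumul := (cumul phi q).

(** Starting point and upper limit vary together: a jointly measurable function, cut off to
    [0 <= r <= u x], is integrated over the whole line, and Tonelli's theorem applies. *)
Lemma measurable_cumul d (X : measurableType d) b (u : X -> R) (v : X -> BT) :
  measurable_fun setT u -> measurable_fun setT v ->
  measurable_fun setT (fun x => cumul b (v x) (u x)).
Proof.
move=> mu_ mv; apply: measurableT_comp => //.
pose A := [set p : X * measurableTypeR R | 0 <= p.2 /\ p.2 <= u p.1].
pose f := (fun p : X * measurableTypeR R => (q (fl b p.2 (v p.1)))%:E) \_ A.
have -> : (fun x => \int[mu]_(r in `[0%R, u x]) (q (fl b r (v x)))%:E)%E =
    (fun x => \int[mu]_r f (x, r))%E.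
  apply/funext => x; rewrite integral_mkcond; apply: eq_integral => r _.
  rewrite /f !patchE; congr (if _ then _ else _).
  apply/idP/idP => /set_mem h; apply/mem_set; move: h; rewrite /= in_itv/=.
    by move=> /andP.
  by move=> h; apply/andP.
have mA : measurable A.
  rewrite (_ : A = [set p | (0%:E <= (p.2)%:E)%E] `&`
                   [set p | ((p.2)%:E <= (u p.1)%:E)%E]); last first.
    by apply/seteqP; split => -[x r] /=; rewrite !lee_fin.
  have m2 : measurable_fun setT (fun p : X * measurableTypeR R => (p.2)%:E).
    by apply/measurable_EFinP; exact: measurable_snd.
  have m1 : measurable_fun setT (fun p : X * measurableTypeR R => (u p.1)%:E).
    by apply/measurable_EFinP; apply: measurableT_comp.
  by apply: measurableI; rewrite -[X in measurable X]setTI; apply: measurable_lee.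
apply: (measurable_fun_fubini_tonelli_F (m2 := mu)) => [|[x r]]; last first.
  by apply: erestrict_ge0 => -[y s] _; rewrite lee_fin rate_ge0.
apply/(measurable_restrictT _ mA)/measurable_funTS/measurable_EFinP.
apply: (measurableT_comp measurable_rate); apply: measurable_phi.
  by apply: measurable_sgt; exact: measurable_snd.
by apply: measurableT_comp => //; exact: measurable_fst.
Qed.

(** * Changes of variables for the measure on the state space *)

Variables (J : R -> T -> R) (m : {sigma_finite_measure set BT -> \bar R}).
Variable mb : bool -> {finite_measure set BT -> \bar R}.
Hypothesis flow_hyp : flow_assumption phi E0 J m.
Hypothesis boundary_hyp : boundary_measure_assumption phi E0 J m mb.

Lemma measurable_J d (X : measurableType d) (u : X -> R) (v : X -> BT) :
  measurable_fun setT u -> measurable_fun setT v ->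
  measurable_fun setT (fun x => J (u x) (v x)).
Proof.
move=> mu_ mv; exact: (measurableT_comp (J_measurable flow_hyp)
                                        (measurable_fun_pair mu_ mv)).
Qed.

Lemma J_flow b t x : J (sgt (~~ b) t) (fl b t x) * J (sgt b t) x = 1.
Proof. by rewrite -(J_cocycle flow_hyp) sgtN addNr (J0 flow_hyp). Qed.

Lemma integral_flow t (k : BT -> \bar R) :
  measurable_fun setT k -> (forall x, 0 <= k x)%E ->
  (\int[m]_x k (phi t x) = \int[m]_x (k x * (J (- t) x)%:E))%E.
Proof.
move=> mk k0; apply: (@integral_image_density _ _ BT BT R m m setT setT (phi t)) => //.
- by apply: measurable_phi.
- by apply: measurable_J.
- by move=> y _; exact: (J_ge0 flow_hyp).
- by move=> F mF _; rewrite setTI; exact: (m_flow flow_hyp t mF).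
Qed.

(** Moving in direction [~~ b], a trajectory meets Gamma^b at times each of which is followed by a
    stay in E0, hence at countably many. By Tonelli's theorem the preimage of Gamma^b under the flow
    is null for almost every time; one such time is enough, as quasi-invariance of [m] carries
    nullity back to Gamma^b. *)
Lemma m_Gamma b : m (G b) = 0%E.
Proof.
pose A := [set p : measurableTypeR R * BT | G b (fl (~~ b) p.1 p.2)].
have mA : measurable A.
  rewrite -[A]setTI; apply: (measurable_phi _ measurable_snd) => //.
    by apply: measurable_sgt; exact: measurable_fst.
  exact: mGamma.
have mA1 : measurable_fun setT (fun p => (\1_A p : R)%:E).
  by apply/measurable_EFinP; exact: measurable_indic.
pose f p := ((\1_A p : R)%:E).
have f0 p : (0 <= f p)%E by rewrite lee_fin.
have : (\int[mu]_t \int[m]_x f (t, x) = 0)%E.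
  rewrite fubini_tonelli//; apply: integral0_eq => x _.
  have -> : (fun t => f (t, x)) = (fun t => (\1_[set t | G b (fl (~~ b) t x)] t)%:E).
    by apply/funext => t; rewrite /f !indicE; congr (nat_of_bool _)%:R%:E;
      apply/idP/idP => /set_mem h; exact/mem_set.
  have mS : measurable [set t : measurableTypeR R | G b (fl (~~ b) t x)].
    have mx : measurable_fun setT (fun t : measurableTypeR R => fl (~~ b) t x : BT).
      by apply: measurable_phi => //; apply: measurable_sgt.
    by have := mx measurableT _ (mGamma b); rewrite setTI.
  rewrite integral_indic// setIT.
  apply: countable_lebesgue_measure0; apply: right_isolated_countable.
  move=> t /E0_before_Gamma[e e0 eE0]; exists e => // r /andP[r1 r2] /Gamma_notE0.
  apply; have := eE0 (r - t); rewrite (flD (~~ b)) addrCA subrr addr0; apply; lra.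
have mF : measurable_fun setT (fun t : measurableTypeR R => \int[m]_x f (t, x))%E.
  exact: (measurable_fun_fubini_tonelli_F (m2 := m)).
move=> if0; have : ae_eq mu setT (fun t => \int[m]_x f (t, x))%E (cst 0%E).
  by apply: ge0_integral_eq0_ae => // t _; exact: integral_ge0.
move=> [N [mN N0 subN]].
(* A null set cannot contain the unit interval. *)
have [t Nt] : exists t, ~ N t.
  apply: contrapT => nN; have : (mu `[0%R, 1%R] <= mu N)%E.
    apply: le_measure; rewrite ?inE//.
    by move=> t _; apply: contrapT => Nt; apply: nN; exists t.
  by rewrite lebesgue_measure_itv/= lte_fin ltr01 N0 sube0 lee_fin ler10.
have : (\int[m]_x f (t, x) = 0)%E.
  by apply: contrapT => ft; apply: Nt; apply: subN => /(_ Logic.I).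
have -> : (fun x => f (t, x)) =
    (fun x : BT => (\1_((fun y => fl (~~ b) t y) @^-1` G b) x : R)%:E).
  by apply/funext => x; rewrite /f !indicE; congr (nat_of_bool _)%:R%:E;
    apply/idP/idP => /set_mem h; exact/mem_set.
set S := (X in \1_X).
have mS : measurable (S : set BT).
  have mt : measurable_fun setT (fun x : BT => fl (~~ b) t x : BT).
    by apply: measurable_phi.
  by have := mt measurableT _ (mGamma b); rewrite setTI.
rewrite integral_indic// setIT => S0.
have -> : G b = phi (sgt b t) @^-1` S.
  by apply/seteqP; split => x; rewrite /S /= flK.
apply: etrans (m_flow flow_hyp (sgt b t) mS) _.
apply: null_set_integral => //; apply/measurable_funTS/measurable_EFinP.
exact: measurable_J.
Qed.

Lemma integral_state (k : BT -> \bar R) :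
  measurable_fun (E : set BT) k -> (forall x, E x -> 0 <= k x)%E ->
  (\int[m]_(x in E) k x = \int[m]_(x in E0) k x)%E.
Proof.
move=> mk k0; rewrite (@ge0_negligible_integral _ _ _ m E (G false))//.
- congr (integral _ _ _); apply/seteqP; split => x.
    by move=> [/state_cases[|[]]].
  by move=> E0x; split; [left|move/Gamma_notE0].
- exact: mGamma.
- exact: mstate.
- exact: m_Gamma.
Qed.

Lemma cumul_reverse b x s : cumul b x s = cumul (~~ b) (fl b s x) s.
Proof.
rewrite /Defs.cumul /Rintegral -integral_reflect; last 2 first.
- apply/measurable_EFinP; apply: (measurableT_comp measurable_rate).
  by apply: measurable_phi => //; exact: measurable_sgt.
- by move=> r; rewrite lee_fin rate_ge0.
by congr fine; apply: eq_integral => r _; rewrite flB.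
Qed.

Let S b : set BT := E0 `&` exits b.

Let mS b : measurable (S b : set BT).
Proof. by apply: measurableI => //; exact: measurable_exits. Qed.

Definition hitw b (x : BT) : measurableTypeR R * BT :=
  (hitr b x, fl b (hitr b x) x).

Lemma measurable_hitw b : measurable_fun setT (hitw b).
Proof.
apply: measurable_fun_pair; first exact: measurable_hitr.
by apply: measurable_phi => //; apply: measurable_sgt; exact: measurable_hitr.
Qed.

(** The assumption on boundary measures concerns [strip], a part of E, whereas the substitutions run
    over E0 with the measurable [hit0]. The two domains differ by points of Gamma^-, which are
    negligible. *)
Let m_strip b (F : set (R * BT)) : measurable F ->
  m (strip phi E0 b `&` w phi E0 b @^-1` F) = m (S b `&` hitw b @^-1` F).
Proof.
move=> mF.
have mwF : measurable (hitw b @^-1` F).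
  by have := @measurable_hitw b measurableT F mF; rewrite setTI.
have mSF : measurable (S b `&` hitw b @^-1` F) by exact: measurableI.
have mstrip : measurable (strip phi E0 b : set BT).
  rewrite (_ : strip _ _ _ = exits b `&` (E `&` [set x : BT | (0 < hit0 b x)%E]) :> set BT).
    apply: measurableI; first exact: measurable_exits.
    apply: emeasurable_fun_o_infty; first exact: mstate.
    by apply: measurable_funTS; exact: measurable_hit0.
  apply/seteqP; split => x.
    move=> [Ex [h0 hoo]]; split; first by split => //; left.
    by split => //=; rewrite hit0E//; left.
  by move=> [[Dx hoo] [Ex /=]]; rewrite hit0E//; split.
have SF : strip phi E0 b `&` w phi E0 b @^-1` F =
          strip phi E0 b `&` hitw b @^-1` F.
  apply/seteqP; split => x [] /[dup] sx [Ex _] /=.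
    by rewrite /w /hitw /hit_point /hitr hit0E//; left.
  by rewrite /w /hitw /hit_point /hitr hit0E//; left.
rewrite SF; apply/eqP; rewrite eq_le; apply/andP; split; last first.
  apply: le_measure; rewrite ?inE//.
    exact: measurableI.
  move=> x [[E0x [Dx hoo]] Fx]; split => //; split; first by left.
  by split => //; apply: hit_gt0; left.
apply: (@le_trans _ _ (m ((S b `&` hitw b @^-1` F) `|` G false))).
  apply: le_measure; rewrite ?inE//.
  - exact: measurableI.
  - by apply: measurableU => //; exact: mGamma.
  - move=> x [[/state_cases[E0x|[Gx _]] [h0 hoo]] Fx]; last by right.
    by left; split => //; split => //; split => //; left; left.
apply: (le_trans (measureU2 _ _ _)) => //; first exact: mGamma.
by rewrite [X in (_ + X <= _)%E]m_Gamma adde0.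
Qed.

(** A point of E0 that reaches Gamma^b is determined by its arrival point [z] and the time [s] it
    takes. In these coordinates [m] has density [J], and Tonelli's theorem separates them. *)
Lemma integral_boundary b (k : R * BT -> \bar R) :
  measurable_fun setT k -> (forall p, 0 <= k p)%E ->
  (\int[m]_(x in E0 `&` exits b) k (hitr b x, x) =
   \int[mb b]_(z in G b) \int[mu]_(s in slice (~~ b) z)
     (k (s, fl (~~ b) s z) * (J (sgt (~~ b) s) z)%:E))%E.
Proof.
move=> mk k0.
pose k' (p : measurableTypeR R * BT) := k (p.1, fl (~~ b) p.1 p.2).
have mk' : measurable_fun setT k'.
  apply: (measurableT_comp mk); apply: measurable_fun_pair; first exact: measurable_fst.
  by apply: measurable_phi => //; apply: measurable_sgt; exact: measurable_fst.
have mJ : measurable_fun setT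
    (fun p : measurableTypeR R * BT => J (sgt (~~ b) p.1) p.2).
  by apply: measurable_J => //; apply: measurable_sgt; exact: measurable_fst.
have WE : W phi E0 b = slices (~~ b) `&` (setT `&` snd @^-1` G b).
  apply/seteqP; split => -[s z] /=.
    by move=> [Gz sz]; split => //; split => //; right; rewrite negbK.
  by move=> [[Dz sz] [_ Gz]]; split.
have mW : measurable (W phi E0 b : set (measurableTypeR R * BT)).
  rewrite WE; apply: measurableI; first exact: measurable_slices.
  by apply: measurable_snd => //; exact: mGamma.
transitivity (\int[m]_(x in S b) k' (hitw b x))%E.
  by apply: eq_integral => x _; rewrite /k' /hitw /= flK.
rewrite (@integral_image_density _ _ BT (measurableTypeR R * BT)%type R m
  (lebesgue_measure \x mb b)%E (S b) (W phi E0 b) (hitw b)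
  (fun p => J (sgt (~~ b) p.1) p.2)) => //.
- rewrite integral_mkcond fubini_tonelli2; last 2 first.
  + apply/(measurable_restrictT _ mW)/measurable_funTS.
    by apply: emeasurable_funM => //; exact/measurable_EFinP.
  + apply: erestrict_ge0 => p _; apply: mule_ge0; first exact: k0.
    by rewrite lee_fin; exact: (J_ge0 flow_hyp).
  rewrite [RHS]integral_mkcond; apply: eq_integral => z _.
  rewrite /fubini_G [RHS]patchE; case: ifPn => [/set_mem Gz|/negP nGz].
    rewrite [RHS]integral_mkcond; apply: eq_integral => s _.
    rewrite !patchE; congr (if _ then _ else _).
    by apply/idP/idP => /set_mem h; apply/mem_set; [case: h|split].
  apply: integral0_eq => s _; rewrite patchE memNset// => -[Gz _].
  by apply: nGz; exact/mem_set.
- by apply: measurable_funTS; exact: measurable_hitw.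
- exact: measurable_funTS.
- by move=> y _; exact: (J_ge0 flow_hyp).
- move=> x [E0x ex]; have hx := exitsE ex.
  have t0 : (0 < hit b x)%E by apply: hit_gt0; left.
  split; first exact: hit_point_Gamma ex.1 hx.
  by split; [rewrite -lte_fin -hx|exact: E0_hit_end].
- move=> F mF FW; apply: etrans (esym (m_strip b mF)) _.
  by have [_ h] := boundary_hyp b; exact: h.
- exact: measurable_funTS.
- by move=> y _; exact: k0.
Qed.

Let V b (A : set BT) : set (R * BT) := slices b `&` snd @^-1` A.

Let mV b (A : set BT) : measurable A -> measurable (V b A).
Proof.
move=> mA; apply: measurableI; first exact: measurable_slices.
by rewrite -[X in measurable X]setTI; exact: measurable_snd.
Qed.

(** Extension by zero outside the slices gives a product domain. With time outermost, the flow at a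
    fixed time can serve as a substitution in the inner integral. *)
Lemma fubini_slices (nu : {sigma_finite_measure set BT -> \bar R}) b (A : set BT)
    (k : R * BT -> \bar R) : measurable A -> A `<=` D b ->
  measurable_fun setT k -> (forall p, 0 <= k p)%E ->
  (\int[nu]_(x in A) \int[mu]_(s in slice b x) k (s, x) =
   \int[mu]_s \int[nu]_x (k \_ (slices b `&` snd @^-1` A)) (s, x))%E.
Proof.
move=> mA AD mk k0.
rewrite -(fubini_tonelli (m1 := nu) (m2 := mu)
  (fun p => (k \_ (slices b `&` snd @^-1` A)) (p.2, p.1))); last 2 first.
- have mkV : measurable_fun (setT : set (measurableTypeR R * BT)) (k \_ (V b A)).
    by apply/(measurable_restrictT _ (mV b mA)); exact: measurable_funTS.
  apply: (measurableT_comp mkV); apply: measurable_fun_pair.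
    exact: measurable_snd.
  exact: measurable_fst.
- by move=> p; apply: erestrict_ge0.
rewrite integral_mkcond; apply: eq_integral => x _.
rewrite patchE; case: ifPn => [/set_mem Ax|/negP nAx].
  rewrite integral_mkcond; apply: eq_integral => s _.
  rewrite !patchE; congr (if _ then _ else _).
  by apply/idP/idP => /set_mem h; apply/mem_set; [split => //; split => //; exact: AD|case: h => -[]].
by rewrite integral0_eq// => s _; rewrite patchE memNset// => -[_ /mem_set].
Qed.

(* Syntax-directed: blind application of composition lemmas diverges. *)
Ltac meas :=
  lazymatch goal with
  | |- measurable_fun _ (fun x => x) => exact: measurable_id
  | |- measurable_fun _ (fun x => fst x) => exact: measurable_fst
  | |- measurable_fun _ (fun x => snd x) => exact: measurable_snd
  | |- measurable_fun _ (fun x => EFin (@?a x)) =>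
      apply/(@measurable_EFinP _ _ _ _ a); meas
  | |- measurable_fun _ (fun x => (@?a x * @?c x)%E) =>
      apply: (@emeasurable_funM _ _ _ _ a c); meas
  | |- measurable_fun _ (fun x => @?a x * @?c x) =>
      apply: (@measurable_funM _ _ _ _ a c); meas
  | |- measurable_fun _ (fun x => @?a x + @?c x) =>
      apply: (@measurable_funD _ _ _ _ a c); meas
  | |- measurable_fun _ (fun x => - @?a x) =>
      apply: (@measurable_funN _ _ _ _ a); meas
  | |- measurable_fun _ (fun x => expR (@?a x)) =>
      apply: (measurableT_comp (@measurable_expR R) (g := a)); meas
  | |- measurable_fun _ (fun x => phi (@?a x) (@?c x)) =>
      apply: (@measurable_phi _ _ a c); meas
  | |- measurable_fun _ (fun x => J (@?a x) (@?c x)) =>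
      apply: (@measurable_J _ _ a c); meas
  | |- measurable_fun _ (fun x => Defs.cumul phi q ?b (@?c x) (@?a x)) =>
      apply: (@measurable_cumul _ _ b a c); meas
  | |- measurable_fun _ (fun x => sgt ?b (@?a x)) =>
      apply: (@measurable_sgt _ _ a _ b); meas
  | |- measurable_fun _ (fun x => hitr ?b (@?a x)) =>
      apply: (measurableT_comp (measurable_hitr b) (g := (a : _ -> BT))); meas
  | |- measurable_fun _ (fun x => q (@?a x)) =>
      apply: (measurableT_comp measurable_rate (g := (a : _ -> BT))); meas
  | Hm : measurable_fun setT ?f |- measurable_fun _ (fun x => ?f (@?a x)) =>
      first [exact: Hm | apply: (measurableT_comp Hm (g := (a : _ -> BT))); meas]
  | _ => idtac
  end.

Lemma measurable_slice b x : D b x ->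
  measurable (slice b x : set (measurableTypeR R)).
Proof.
move=> Dx.
rewrite (_ : slice b x = (fun s : measurableTypeR R => (s, x : BT)) @^-1` slices b).
  rewrite -[X in measurable X]setTI.
  by apply: (@pair2_measurable _ _ (measurableTypeR R) BT x) => //; exact: measurable_slices.
by apply/seteqP; split => s /= => [|[]].
Qed.

Lemma measurable_fun_section (x : BT) (A : set (measurableTypeR R)) (k : R * BT -> \bar R) :
  measurable_fun setT k ->
  measurable_fun A (fun s : measurableTypeR R => k (s, x)).
Proof.
move=> mk; apply: measurable_funTS; apply: (measurableT_comp mk).
exact: (@pair2_measurable _ _ (measurableTypeR R) BT x).
Qed.

Lemma slice_exit b x t : hit b x = t%:E -> slice b x = `]0, t[%classic.
Proof.
move=> hx; rewrite /slice hx; apply/seteqP; split => s /=; rewrite in_itv/=.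
  by move=> [->]; rewrite lte_fin => ->.
by move=> /andP[s0 st]; rewrite lte_fin.
Qed.

Lemma slice_noexit b x : hit b x = +oo%E -> slice b x = `]0, +oo[%classic.
Proof.
move=> hx; rewrite /slice hx; apply/seteqP; split => s /=; rewrite in_itv/= andbT.
  by move=> [].
by rewrite ltry.
Qed.

(** * Duality along trajectories *)

Section duality.
Variables (f fd : BT -> R) (g : BT -> \bar R).
Hypotheses (mf : measurable_fun setT f) (f0 : forall x, 0 <= f x).
Hypotheses (mfd : measurable_fun setT fd) (fd0 : forall x, 0 <= fd x).
Hypotheses (mg : measurable_fun setT g) (g0 : forall x, (0 <= g x)%E).

Let decay b (x : BT) (s : R) := expR (- cumul b x s).

Let back (f : BT -> R) (p : R * BT) :=
  (decay false p.2 p.1 * f (phi (- p.1) p.2) * J (- p.1) p.2)%:E.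

Let fore (p : R * BT) := ((decay true p.2 p.1 * q (phi p.1 p.2))%:E * g (phi p.1 p.2))%E.

(** [inflow] and [inflow_end] are the two terms of [R0]; [outflow] and [outflow_end] are those of
    [kernelK] with [g] in place of the jump probability. *)
Definition inflow (x : BT) : \bar R := (\int[mu]_(s in slice false x) back f (s, x))%E.

Definition inflow_end (x : BT) : \bar R :=
  if (hit false x < +oo)%E then back fd (fine (hit false x), x) else 0%E.

Definition outflow (x : BT) : \bar R := (\int[mu]_(s in slice true x) fore (s, x))%E.

Definition outflow_end (x : BT) : \bar R :=
  if (hit true x < +oo)%E then
    ((decay true x (fine (hit true x)))%:E * g (hit_point phi E0 true x))%E
  else 0%E.

Let mback (h : BT -> R) : measurable_fun setT h -> measurable_fun setT (back h).
Proof. by move=> mh; rewrite /back /decay; meas. Qed.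

Let mfore : measurable_fun setT fore.
Proof. by rewrite /fore /decay; meas. Qed.

Let back0 (h : BT -> R) p : (forall x, 0 <= h x) -> (0 <= back h p)%E.
Proof.
by move=> h0; rewrite lee_fin !mulr_ge0 ?expR_ge0// (J_ge0 flow_hyp).
Qed.

Let fore0 p : (0 <= fore p)%E.
Proof. by rewrite mule_ge0// lee_fin mulr_ge0 ?expR_ge0// rate_ge0. Qed.

(** At a fixed time [t] the substitution [y = phi t x] exchanges the two sides: its Jacobian is the
    factor [J (- t)] of [R0], and the exponentials agree because the integrated rate does not depend
    on the direction. *)
Lemma duality_state_state :
  (\int[m]_(y in E0) (g y * ((q y)%:E * inflow y)) =
   \int[m]_(x in E0) (outflow x * (f x)%:E))%E.
Proof.
pose B (p : R * BT) := (g p.2 * (q p.2 * (decay false p.2 p.1 * f (phi (- p.1) p.2)))%:E)%E.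
pose k1 (p : R * BT) := (B p * (J (- p.1) p.2)%:E)%E.
pose k2 (p : R * BT) := (fore p * (f p.2)%:E)%E.
have mB : measurable_fun setT B by rewrite /B /decay; meas.
have B0 p : (0 <= B p)%E.
  by rewrite mule_ge0// lee_fin !mulr_ge0 ?expR_ge0// rate_ge0.
have mk1 : measurable_fun setT k1 by rewrite /k1; meas.
have k10 p : (0 <= k1 p)%E by rewrite mule_ge0// lee_fin (J_ge0 flow_hyp).
have mk2 : measurable_fun setT k2 by rewrite /k2; meas.
have k20 p : (0 <= k2 p)%E by rewrite mule_ge0// lee_fin.
transitivity (\int[m]_(y in E0) \int[mu]_(s in slice false y) k1 (s, y))%E.
  apply: eq_integral => y /set_mem E0y; rewrite muleA -ge0_integralZl//.
  - by apply: eq_integral => s _; rewrite /k1 /B /back /= !EFinM !muleA.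
  - exact: (measurable_slice (E0_dom false E0y)).
  - exact: (@measurable_fun_section y _ _ (mback mf)).
  - by move=> s _; exact: back0.
  - by rewrite mule_ge0// lee_fin rate_ge0.
transitivity (\int[m]_(x in E0) \int[mu]_(s in slice true x) k2 (s, x))%E; last first.
  apply: eq_integral => y /set_mem E0y; rewrite -ge0_integralZr//.
  - exact: (measurable_slice (E0_dom true E0y)).
  - exact: (@measurable_fun_section y _ _ mfore).
  - by rewrite lee_fin.
have E0D b : E0 `<=` D b by move=> x; exact: E0_dom.
apply: (etrans (fubini_slices m E0_measurable (E0D false) mk1 k10)).
apply: etrans (esym (fubini_slices m E0_measurable (E0D true) mk2 k20)).
apply: eq_integral => t _.
transitivity (\int[m]_x ((B \_ (V false E0)) (t, x) * (J (- t) x)%:E))%E.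
  apply: eq_integral => x _; rewrite !patchE; case: ifPn => //.
  by rewrite mul0e.
rewrite -(@integral_flow t (fun x => (B \_ (V false E0)) (t, x))); last 2 first.
- have mBV : measurable_fun setT (B \_ (V false E0)).
    by apply/(measurable_restrictT _ (mV false E0_measurable)); exact: measurable_funTS.
  by apply: (measurableT_comp mBV); exact: pair1_measurable.
- by move=> x; apply: erestrict_ge0.
apply: eq_integral => x _; rewrite !patchE.
(* The two domains correspond because a trajectory has no entrance strictly inside it: [x] runs
   forwards for time [t] before its exit exactly when [phi t x] runs backwards for time [t] before
   its entrance. *)
have VV : ((t, phi t x) \in V false E0) = ((t, x) \in slices true `&` snd @^-1` E0).
  apply/idP/idP => /set_mem [[_ [/= t0 tx]] /= E0x]; apply/mem_set.
    have := path_E0 (E0_dom _ E0x) t0 tx; have := E0_hit E0x t0 tx.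
    rewrite (flB true) subrr fl0 => ? E0y; split => //; split => //; exact: E0_dom.
  split; last exact: (path_E0 (E0_dom true E0x) t0 tx).
  split; first exact: E0_dom (path_E0 (E0_dom true E0x) t0 tx).
  by split => //; exact: (E0_hit (b := true) E0x t0 tx).
rewrite VV; case: ifPn => // _; rewrite /B /k2 /fore /=.
rewrite (flK true t x) {1}/decay -(cumul_reverse true).
by rewrite [RHS]muleAC -EFinM muleC; congr (_%:E * _)%E; rewrite /decay; ring.
Qed.

Let integral_exits b (nu : {measure set BT -> \bar R}) (A : set BT) (k : BT -> \bar R) :
  A `<=` D b ->
  (\int[nu]_(x in A) (if (hit b x < +oo)%E then k x else 0) =
   \int[nu]_(x in A `&` exits b) k x)%E.
Proof.
move=> AD; rewrite [RHS]integral_mkcondr; apply: eq_integral => x /set_mem Ax.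
rewrite patchE; congr (if _ then _ else _).
by apply/idP/idP => [h|/set_mem[]//]; apply/mem_set; split => //; exact: AD.
Qed.

(** In the coordinates of Gamma^- one has [y = phi s z], and the factor [J s z] from the boundary
    measure cancels the factor [J (- s) y] of [R0]. *)
Lemma duality_boundary_state :
  (\int[m]_(y in E0) (g y * ((q y)%:E * inflow_end y)) =
   \int[mb false]_(z in G false) (outflow z * (fd z)%:E))%E.
Proof.
pose k (p : R * BT) := (g p.2 * ((q p.2)%:E * back fd p))%E.
have mk : measurable_fun setT k.
  by rewrite /k /back /decay; meas.
have k0 p : (0 <= k p)%E.
  by rewrite mule_ge0// mule_ge0 ?lee_fin ?rate_ge0//; exact: back0.
transitivity (\int[m]_(x in E0 `&` exits false) k (hitr false x, x))%E.
  rewrite -integral_exits; last by move=> x; exact: E0_dom.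
  apply: eq_integral => x /set_mem E0x; rewrite /inflow_end; case: ifPn => h.
    by rewrite /k /= /hitr hit0E//; exact: E0_dom.
  by rewrite !mule0.
rewrite integral_boundary//; apply: eq_integral => z /set_mem Gz.
rewrite -ge0_integralZr//.
- apply: eq_integral => s _; rewrite /k /back /fore /=.
  rewrite (flK true s z) {1}/decay -(cumul_reverse true).
  have /= Jz := J_flow true s z.
  rewrite [RHS]muleAC -!EFinM -muleA -EFinM muleC; congr (_%:E * _)%E.
  by rewrite -[RHS]mulr1 -[X in _ = _ * X]Jz /decay; ring.
- exact: (@measurable_slice true z (@Gamma_dom true z Gz)).
- exact: (@measurable_fun_section z _ _ mfore).
- by rewrite lee_fin.
Qed.

(** In the coordinates of Gamma^+ the density of [m] is already the factor [J (- s) z] of [R0]. *)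
Lemma duality_state_boundary :
  (\int[mb true]_(z in G true) (g z * inflow z) =
   \int[m]_(x in E0) (outflow_end x * (f x)%:E))%E.
Proof.
pose k (p : R * BT) := ((decay true p.2 p.1)%:E * g (phi p.1 p.2) * (f p.2)%:E)%E.
have mk : measurable_fun setT k by rewrite /k /decay; meas.
have k0 p : (0 <= k p)%E by rewrite !mule_ge0 ?lee_fin ?expR_ge0.
transitivity (\int[m]_(x in E0 `&` exits true) k (hitr true x, x))%E; last first.
  rewrite -integral_exits; last by move=> x; exact: E0_dom.
  apply: eq_integral => x /set_mem E0x; rewrite /outflow_end; case: ifPn => h.
    by rewrite /k /= /hit_point /hitr hit0E//; exact: E0_dom.
  by rewrite mul0e.
rewrite integral_boundary//; apply: eq_integral => z /set_mem Gz.
rewrite -ge0_integralZl//.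
- apply: eq_integral => s _; rewrite /k /back /=.
  have /= zK := flK false s z; rewrite zK.
  rewrite /decay; have /= <- := cumul_reverse false z s.
  rewrite -[RHS]muleA -EFinM [RHS]muleAC -EFinM muleC; congr (_%:E * _)%E.
  by rewrite mulrA.
- exact: (@measurable_slice false z (@Gamma_dom false z Gz)).
- exact: (@measurable_fun_section z _ _ (mback mf)).
- by move=> s _; exact: back0.
Qed.

(** Integrating along a whole trajectory undoes the division by its duration [t]. *)
Let integral_mean b x t (k : R -> \bar R) (c : \bar R) : hit b x = t%:E -> 0 < t ->
  (forall s, 0 < s -> s < t -> k s = (c * (t^-1)%:E)%E) ->
  (\int[mu]_(s in slice b x) k s = c)%E.
Proof.
move=> hx t0 kc; rewrite (slice_exit hx).
rewrite (eq_integral (cst (c * (t^-1)%:E)%E)); last first.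
  by move=> s /set_mem/=; rewrite in_itv/= => /andP[]; exact: kc.
rewrite integral_cst//= lebesgue_measure_itv/= lte_fin t0 sube0.
by rewrite -muleA -EFinM mulVf ?mule1// gt_eqF.
Qed.

(* A trajectory from an entrance [z] to an exit [z'] is parametrised both from
   [z] and from [z'], so that the state space integral of a function depending
   on the trajectory only, divided by its duration, can be computed from both
   boundary measures. *)
Lemma duality_boundary_boundary :
  (\int[mb true]_(z in G true) (g z * inflow_end z) =
   \int[mb false]_(z in G false) (outflow_end z * (fd z)%:E))%E.
Proof.
(* The exponential of [- ln] is the reciprocal of the duration of the trajectory. Together with the
   domains of integration, the indicators keep the trajectories that have both an entrance and an
   exit. *)
pose k1 (p : R * BT) := ((g (phi (hitr true p.2) p.2) *
  (fd (phi (- p.1) p.2) *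
   decay true (phi (- p.1) p.2) (p.1 + hitr true p.2) * J (- p.1) p.2 *
   expR (- ln (p.1 + hitr true p.2)))%:E) * (\1_(exits true) p.2 : R)%:E)%E.
pose k2 (p : R * BT) := ((g (phi p.1 p.2) *
  (fd (phi (- hitr false p.2) p.2) *
   decay true (phi (- hitr false p.2) p.2) (hitr false p.2 + p.1) *
   J (- hitr false p.2) p.2 *
   expR (- ln (hitr false p.2 + p.1)))%:E) * (\1_(exits false) p.2 : R)%:E)%E.
have m1 b : measurable_fun setT (fun p : R * BT => (\1_(exits b) p.2 : R)).
  apply: (measurableT_comp _ measurable_snd).
  by apply: measurable_indic; exact: measurable_exits.
have mk1 : measurable_fun setT k1.
  rewrite /k1 /decay; meas; last exact: m1.
  by apply: (measurableT_comp (@measurable_ln R)); meas.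
have mk2 : measurable_fun setT k2.
  rewrite /k2 /decay; meas; last exact: m1.
  by apply: (measurableT_comp (@measurable_ln R)); meas.
have k10 p : (0 <= k1 p)%E.
  rewrite mule_ge0 ?lee_fin// mule_ge0// lee_fin !mulr_ge0 ?expR_ge0//.
  exact: (J_ge0 flow_hyp).
have k20 p : (0 <= k2 p)%E.
  rewrite mule_ge0 ?lee_fin// mule_ge0// lee_fin !mulr_ge0 ?expR_ge0//.
  exact: (J_ge0 flow_hyp).
transitivity (\int[m]_(x in E0 `&` exits true) k2 (hitr true x, x))%E.
  rewrite integral_boundary//; apply: eq_integral => z /set_mem Gz.
  have Dz : D false z by exact: (@Gamma_dom false z Gz).
  rewrite /inflow_end; case: ifPn => [hz|hz].
    have ez : exits false z by split.
    have hzE := exitsE ez.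
    have t0 : 0 < hitr false z by rewrite -lte_fin -hzE; apply: hit_gt0; right.
    apply/esym; apply: (integral_mean hzE t0) => s s0 st.
    have sz : (s%:E < hit false z)%E by rewrite hzE lte_fin.
    have /= E0y := path_E0 Dz s0 sz.
    have /= := hit_shift Dz s0 sz; rewrite hzE => /esym hy.
    have hy' : hit false (phi (- s) z) = (hitr false z - s)%:E.
      by rewrite EFinB -hy addeAC subee// add0e.
    have eh : hitr false (phi (- s) z) = hitr false z - s.
      exact: (hitrE (E0_dom false E0y)).
    rewrite /k2 /=; rewrite eh.
    have /= -> := flK false s z.
    have -> : phi (- (hitr false z - s)) (phi (- s) z) = phi (- hitr false z) z.
      by rewrite (flowD phi_flow); congr (phi _ z); ring.
    rewrite subrK indicE mem_set ?mule1; last first.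
      by split; [exact: E0_dom|rewrite hy' ltry].
    rewrite /back /=.
    have := cumul_reverse false z (hitr false z); rewrite /= => cE.
    have Jz : J (- (hitr false z - s)) (phi (- s) z) * J (- s) z = J (- hitr false z) z.
      by rewrite -(J_cocycle flow_hyp); congr (J _ z); ring.
    rewrite -muleA -EFinM -[RHS]muleA -EFinM; congr (_ * _%:E)%E.
    by rewrite -Jz /decay -cE (expRN (ln _)) (lnK t0); ring.
  (* If [z] comes from no entrance, neither does any earlier point of its trajectory, and the
     indicator in [k2] vanishes. *)
  rewrite mule0; apply/esym/integral0_eq => s [s0 sz].
  have /= E0y := path_E0 Dz s0 sz.
  have /= := hit_shift Dz s0 sz; rewrite (_ : hit false z = +oo%E) => [hy|]; last first.
    by apply/eqP; rewrite -leye_eq leNgt.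
  rewrite /k2 /= indicE memNset ?mule0 ?mul0e// => -[_].
  by case: (hit false (phi (- s) z)) hy.
(* At points with both an entrance and an exit the two integrands coincide; at the others both sides
   contribute zero. *)
transitivity (\int[m]_(x in E0 `&` exits false) k1 (hitr false x, x))%E.
  rewrite [LHS]integral_mkcondr [RHS]integral_mkcondr; apply: eq_integral => x /set_mem E0x.
  rewrite !patchE /k1 /k2 /= !indicE.
  have [ef|ef] := boolP (x \in exits false);
  have [et|et] := boolP (x \in exits true); rewrite ?mule0//=.
rewrite integral_boundary//; apply: eq_integral => z /set_mem Gz.
have Dz : D true z by exact: (@Gamma_dom true z Gz).
rewrite /outflow_end; case: ifPn => [hz|hz].
  have ez : exits true z by split.
  have hzE := exitsE ez.
  have t0 : 0 < hitr true z by rewrite -lte_fin -hzE; apply: hit_gt0; right.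
  apply: (integral_mean hzE t0) => s s0 st.
  have sz : (s%:E < hit true z)%E by rewrite hzE lte_fin.
  have /= E0y := path_E0 Dz s0 sz.
  have /= := hit_shift Dz s0 sz; rewrite hzE => /esym hy.
  have hy' : hit true (phi s z) = (hitr true z - s)%:E.
    by rewrite EFinB -hy addeAC subee// add0e.
  have eh : hitr true (phi s z) = hitr true z - s.
    exact: (hitrE (E0_dom true E0y)).
  rewrite /k1 /=; rewrite eh.
  have /= -> := flK true s z.
  have -> : phi (hitr true z - s) (phi s z) = phi (hitr true z) z.
    by rewrite (flowD phi_flow); congr (phi _ z); ring.
  rewrite addrC subrK indicE mem_set ?mule1; last first.
    by split; [exact: E0_dom|rewrite hy' ltry].
  rewrite /hit_point hzE [fine _]/=.
  have /= Jz := J_flow true s z.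
  rewrite -[LHS]muleA -EFinM muleC -[RHS]muleA -EFinM [RHS]muleAC -EFinM.
  congr (_%:E * _)%E; rewrite (expRN (ln _)) (lnK t0) -[RHS]mulr1 -[X in _ = _ * X]Jz; ring.
rewrite mul0e; apply: integral0_eq => s [s0 sz].
have /= E0y := path_E0 Dz s0 sz.
have /= := hit_shift Dz s0 sz; rewrite (_ : hit true z = +oo%E) => [hy|]; last first.
  by apply/eqP; rewrite -leye_eq leNgt.
rewrite /k1 /= indicE memNset ?mule0 ?mul0e// => -[_].
by case: (hit true (phi s z)) hy.
Qed.

End duality.

Lemma measurable_slice_integral b (k : R * BT -> \bar R) :
  measurable_fun setT k -> (forall p, 0 <= k p)%E ->
  measurable_fun (D b : set BT) (fun x => \int[mu]_(s in slice b x) k (s, x))%E.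
Proof.
move=> mk k0; apply: (eq_measurable_fun (fun x : BT => \int[mu]_s (k \_ (slices b)) (s, x))%E).
  by move=> x /set_mem Dx; rewrite slice_integral.
apply: measurable_funTS.
pose kS (p : measurableTypeR R * BT) := (k \_ (slices b)) p.
have mkS : measurable_fun setT kS.
  by apply/(measurable_restrictT _ (measurable_slices b)); exact: measurable_funTS.
apply: (measurable_fun_fubini_tonelli_G (m1 := mu) kS mkS).
by move=> p; apply: erestrict_ge0.
Qed.

Lemma measurable_at_exit b (k : BT -> \bar R) : measurable_fun setT k ->
  measurable_fun (D b : set BT) (fun x => if (hit b x < +oo)%E then k x else 0%E).
Proof.
move=> mk; apply: (eq_measurable_fun (k \_ (exits b))).
  move=> x /set_mem Dx; rewrite patchE; congr (if _ then _ else _).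
  by apply/idP/idP => [/set_mem[]//|h]; apply/mem_set.
apply: measurable_funTS.
by apply/(measurable_restrictT _ (measurable_exits b)); exact: measurable_funTS.
Qed.

Local Notation R0 := (R0 phi E0 q J).

Section nonnegative.
Variables (f fd : BT -> R) (g : BT -> \bar R).
Hypotheses (mf : measurable_fun setT f) (f0 : forall x, 0 <= f x).
Hypotheses (mfd : measurable_fun setT fd) (fd0 : forall x, 0 <= fd x).
Hypotheses (mg : measurable_fun setT g) (g0 : forall x, (0 <= g x)%E).

(** The transition kernel acting on [g]: [kernelK x F] is the case [P^~ F], and the constant 1 gives
    the total mass. *)
Definition outflux x : \bar R := (outflow g x + outflow_end g x)%E.

Lemma measurable_inflow : measurable_fun (D false : set BT) (inflow f).
Proof.
apply: (@measurable_slice_integral false) => [|p]; first by meas.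
by rewrite lee_fin !mulr_ge0 ?expR_ge0// (J_ge0 flow_hyp).
Qed.

Lemma measurable_inflow_end : measurable_fun (D false : set BT) (inflow_end fd).
Proof.
pose k (x : BT) := (expR (- cumul false x (hitr false x)) *
  fd (phi (- hitr false x) x) * J (- hitr false x) x)%:E.
apply: (eq_measurable_fun (fun x : BT => if (hit false x < +oo)%E then k x else 0%E)).
  by move=> x /set_mem Dx; rewrite /k /inflow_end /hitr hit0E.
by apply: measurable_at_exit; rewrite /k; meas.
Qed.

Lemma measurable_outflow : measurable_fun (D true : set BT) (outflow g).
Proof.
apply: (@measurable_slice_integral true) => [|p]; first by meas.
by rewrite mule_ge0// lee_fin mulr_ge0 ?expR_ge0// rate_ge0.
Qed.

Lemma measurable_outflow_end : measurable_fun (D true : set BT) (outflow_end g).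
Proof.
pose k (x : BT) := ((expR (- cumul true x (hitr true x)))%:E *
  g (phi (hitr true x) x))%E.
apply: (eq_measurable_fun (fun x : BT => if (hit true x < +oo)%E then k x else 0%E)).
  by move=> x /set_mem Dx; rewrite /k /outflow_end /hitr hit0E.
by apply: measurable_at_exit; rewrite /k; meas.
Qed.

Lemma inflow_ge0 x : (0 <= inflow f x)%E.
Proof.
apply: integral_ge0 => s _.
by rewrite lee_fin !mulr_ge0 ?expR_ge0// (J_ge0 flow_hyp).
Qed.

Lemma inflow_end_ge0 x : (0 <= inflow_end fd x)%E.
Proof.
rewrite /inflow_end; case: ifP => // _.
by rewrite lee_fin !mulr_ge0 ?expR_ge0// (J_ge0 flow_hyp).
Qed.

Lemma outflow_ge0 x : (0 <= outflow g x)%E.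
Proof.
apply: integral_ge0 => s _.
by rewrite mule_ge0// lee_fin mulr_ge0 ?expR_ge0// rate_ge0.
Qed.

Lemma outflow_end_ge0 x : (0 <= outflow_end g x)%E.
Proof.
rewrite /outflow_end; case: ifP => // _.
by rewrite mule_ge0// lee_fin expR_ge0.
Qed.

Lemma R0E x : R0 f fd x = (inflow f x + inflow_end fd x)%E.
Proof. by []. Qed.

Lemma R0_ge0 x : (0 <= R0 f fd x)%E.
Proof. by rewrite R0E adde_ge0 ?inflow_ge0 ?inflow_end_ge0. Qed.

Lemma outflux_ge0 x : (0 <= outflux x)%E.
Proof. by rewrite adde_ge0 ?outflow_ge0 ?outflow_end_ge0. Qed.

Lemma measurable_R0 : measurable_fun (D false : set BT) (R0 f fd).
Proof.
by apply: emeasurable_funD; [exact: measurable_inflow|exact: measurable_inflow_end].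
Qed.

Lemma measurable_outflux : measurable_fun (D true : set BT) outflux.
Proof.
by apply: emeasurable_funD; [exact: measurable_outflow|exact: measurable_outflow_end].
Qed.

Lemma duality :
  (\int[m]_(y in E) (g y * ((q y)%:E * R0 f fd y)) +
   \int[mb true]_(z in G true) (g z * R0 f fd z) =
   \int[m]_(x in E) (outflux x * (f x)%:E) +
   \int[mb false]_(z in G false) (outflux z * (fd z)%:E))%E.
Proof.
have mED b : (E : set BT) `<=` D b by move=> x; left.
have mE0D b : (E0 : set BT) `<=` D b by move=> x; exact: E0_dom.
have GD b : (G b : set BT) `<=` D (~~ b) by move=> x; right; rewrite negbK.
have mR (A : set BT) : measurable A -> A `<=` D false -> measurable_fun A (R0 f fd).
  by move=> mA AD; exact: (measurable_funS (mdom false) AD measurable_R0).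
have mO (A : set BT) : measurable A -> A `<=` D true -> measurable_fun A outflux.
  by move=> mA AD; exact: (measurable_funS (mdom true) AD measurable_outflux).
have mq (A : set BT) : measurable_fun A (fun x : BT => (q x)%:E).
  by apply: measurable_funTS; apply/measurable_EFinP; exact: measurable_rate.
have q0 x : (0 <= (q x)%:E)%E by rewrite lee_fin rate_ge0.
(* The four partial identities are over E0; the rest of E lies in Gamma^- and is negligible. *)
rewrite (integral_state (k := fun y => g y * ((q y)%:E * R0 f fd y))%E); last 2 first.
- apply: emeasurable_funM; first exact: measurable_funTS.
  by apply: emeasurable_funM => //; apply: mR (mED _) => //; exact: mstate.
- by move=> x _; rewrite !mule_ge0 ?R0_ge0.
rewrite (integral_state (k := fun x => outflux x * (f x)%:E)%E); last 2 first.
- apply: emeasurable_funM; last exact/measurable_EFinP/measurable_funTS.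
  by apply: mO (mED _) => //; exact: mstate.
- by move=> x _; rewrite mule_ge0 ?outflux_ge0// lee_fin.
have mI (A : set BT) : measurable A -> A `<=` D false -> measurable_fun A (inflow f).
  by move=> mA AD; exact: (measurable_funS (mdom false) AD measurable_inflow).
have mIe (A : set BT) : measurable A -> A `<=` D false -> measurable_fun A (inflow_end fd).
  by move=> mA AD; exact: (measurable_funS (mdom false) AD measurable_inflow_end).
have mQ (A : set BT) : measurable A -> A `<=` D true -> measurable_fun A (outflow g).
  by move=> mA AD; exact: (measurable_funS (mdom true) AD measurable_outflow).
have mQe (A : set BT) : measurable A -> A `<=` D true -> measurable_fun A (outflow_end g).
  by move=> mA AD; exact: (measurable_funS (mdom true) AD measurable_outflow_end).
have I0 := inflow_ge0; have Ie0 := inflow_end_ge0.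
have O0 := outflow_ge0; have Oe0 := outflow_end_ge0.
transitivity (\int[m]_(y in E0) (g y * ((q y)%:E * inflow f y)) +
   \int[m]_(y in E0) (g y * ((q y)%:E * inflow_end fd y)) +
   (\int[mb true]_(z in G true) (g z * inflow f z) +
    \int[mb true]_(z in G true) (g z * inflow_end fd z)))%E.
  congr (_ + _)%E; rewrite -ge0_integralD//.
  - by apply: eq_integral => y _; rewrite R0E (ge0_muleDr _ (I0 y) (Ie0 y)) ge0_muleDr ?mule_ge0.
  - by move=> x _; rewrite !mule_ge0.
  - apply: emeasurable_funM; first exact: measurable_funTS.
    by apply: emeasurable_funM => //; exact: mI.
  - by move=> x _; rewrite !mule_ge0.
  - apply: emeasurable_funM; first exact: measurable_funTS.
    by apply: emeasurable_funM => //; exact: mIe.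
  - by apply: eq_integral => y _; rewrite R0E ge0_muleDr.
  - exact: mGamma.
  - by move=> x _; rewrite !mule_ge0.
  - apply: emeasurable_funM; first exact: measurable_funTS.
    by apply: mI; [exact: mGamma|exact: (GD true)].
  - by move=> x _; rewrite !mule_ge0.
  - apply: emeasurable_funM; first exact: measurable_funTS.
    by apply: mIe; [exact: mGamma|exact: (GD true)].
rewrite (duality_state_state mf f0 mg g0) (duality_boundary_state mfd fd0 mg g0).
rewrite (duality_state_boundary mf f0 mg g0) (duality_boundary_boundary mfd fd0 mg g0).
(* The terms, so far grouped by the end of the trajectory, are regrouped by its start. *)
rewrite addeACA; congr (_ + _)%E; rewrite -ge0_integralD//.
- by apply: eq_integral => y _; rewrite /outflux (ge0_muleDl _ (O0 y) (Oe0 y)).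
- by move=> x _; rewrite mule_ge0// lee_fin.
- by apply: emeasurable_funM; [exact: mQ|exact/measurable_EFinP/measurable_funTS].
- by move=> x _; rewrite mule_ge0// lee_fin.
- by apply: emeasurable_funM; [exact: mQe|exact/measurable_EFinP/measurable_funTS].
- by apply: eq_integral => y _; rewrite /outflux (ge0_muleDl _ (O0 y) (Oe0 y)).
- exact: mGamma.
- by move=> x _; rewrite mule_ge0// lee_fin.
- apply: emeasurable_funM; last exact/measurable_EFinP/measurable_funTS.
  by apply: mQ; [exact: mGamma|exact: (GD false)].
- by move=> x _; rewrite mule_ge0// lee_fin.
- apply: emeasurable_funM; last exact/measurable_EFinP/measurable_funTS.
  by apply: mQe; [exact: mGamma|exact: (GD false)].
Qed.

End nonnegative.

(** * Total mass of the transition kernel *)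

Section path_law.
Variable x : T.
Let rate_path s := q (phi s x).

Let measurable_path : measurable_fun setT (rate_path : R -> R).
Proof.
apply: (measurableT_comp measurable_rate (g := (fun s : R => phi s x : BT))).
exact: measurable_phi.
Qed.

Let integrable_path (a b : R) : mu.-integrable `[a, b] (EFin \o rate_path).
Proof. exact: (rate_hyp x a b).1. Qed.

Lemma integral_path t : 0 <= t ->
  (\int[mu]_(s in `]0%R, t[) (expR (- cumul true x s) * q (phi s x))%:E =
   (1 - expR (- cumul true x t))%:E)%E.
Proof.
exact: (@integral_expR_cumul R rate_path (cumul true x) measurable_path
  (fun s => rate_ge0 _) integrable_path erefl).
Qed.

Lemma path_cumul0 : cumul true x 0 = 0.
Proof. exact: (@cumul0 R rate_path (cumul true x) erefl). Qed.

Lemma measurable_path_density (A : set (measurableTypeR R)) :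
  measurable_fun A (fun s => (expR (- cumul true x s) * q (phi s x))%:E).
Proof.
pose k (p : R * BT) := (expR (- cumul true p.2 p.1) * q (phi p.1 p.2))%:E.
by apply: (@measurable_fun_section x A k); rewrite /k; meas.
Qed.

Lemma path_density_ge0 s :
  (0 <= (expR (- cumul true x s) * q (phi s x))%:E)%E.
Proof. by rewrite lee_fin mulr_ge0 ?expR_ge0// rate_ge0. Qed.

Lemma integral_path_infty :
  (\int[mu]_(s in `]0%R, n%:R[) (expR (- cumul true x s) * q (phi s x))%:E)%E
    @[n --> \oo] -->
  (\int[mu]_(s in `]0%R, +oo[) (expR (- cumul true x s) * q (phi s x))%:E)%E.
Proof.
have -> : `]0%R, +oo[%classic = \bigcup_n `]0%R, n%:R[%classic :> set R.
  apply/seteqP; split => s /=; rewrite in_itv/= ?andbT.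
    move=> s0; exists (Num.truncn s).+1 => //=.
    by rewrite in_itv/= s0 truncnS_gt.
  by move=> [n _ /=]; rewrite in_itv/= => /andP[->].
apply: ge0_nondecreasing_set_cvg_integral => //.
- move=> a b ab; rewrite subsetEset; apply: subset_itvl.
  by rewrite bnd_simp ler_nat.
- by move=> n; exact: measurable_path_density.
- by move=> n s _; exact: path_density_ge0.
Qed.

Lemma outflux1E : outflux (cst 1%E) x =
  (\int[mu]_(s in slice true x) (expR (- cumul true x s) * q (phi s x))%:E +
   if (hit true x < +oo)%E then (expR (- cumul true x (fine (hit true x))))%:E
   else 0)%E.
Proof.
rewrite /outflux /outflow /outflow_end /=; congr (_ + _)%E.
  by apply: eq_integral => s _; rewrite mule1.
by rewrite mule1.
Qed.

(** Up to the exit the density integrates to one minus an exponential, which the atom at the exit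
    restores. Without an exit the mass is a limit of such integrals. *)
Lemma outflux1_le1 : (outflux (cst 1%E) x <= 1)%E.
Proof.
rewrite outflux1E; case hx : (hit true x) (hit_ge0 true x) => [t| |//].
  rewrite lee_fin ltry /= => t0; rewrite (slice_exit hx).
  by rewrite integral_path// -EFinD subrK.
move=> _; rewrite ltxx adde0.
rewrite (slice_noexit hx).
rewrite -(cvg_lim _ integral_path_infty)//; apply: lime_le.
  by apply/cvg_ex; eexists; exact: integral_path_infty.
apply: nearW => n; rewrite integral_path// lee_fin lerBlDr lerDl.
exact: expR_ge0.
Qed.

(** Mass can only be lost when there is no exit, and the loss is then the limit of
    [expR (- cumul true x t)]. *)
Lemma outflux1_eq1 : (hit true x = +oo%E ->
  cumul true x t @[t --> +oo] --> +oo) -> outflux (cst 1%E) x = 1%E.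
Proof.
rewrite outflux1E; case hx : (hit true x) (hit_ge0 true x) => [t| |//].
  rewrite lee_fin ltry /= => t0 _; rewrite (slice_exit hx).
  by rewrite integral_path// -EFinD subrK.
move=> _ /(_ erefl) Qoo; rewrite ltxx adde0.
rewrite (slice_noexit hx).
apply: (cvg_unique _ integral_path_infty) => //.
rewrite /= (funext (fun n => integral_path (ler0n R n))).
apply: cvg_EFin; first exact: nearW.
rewrite /= -[X in _ --> X]subr0; apply: cvgB; first exact: cvg_cst.
have Qn : cumul true x n%:R @[n --> \oo] --> +oo.
  exact: (cvg_comp _ _ (cvgr_idn) Qoo).
exact: (cvg_comp _ _ Qn (@cvgr_expR R)).
Qed.

End path_law.

Lemma outflux_le1 (g : BT -> \bar R) x : D true x ->
  measurable_fun setT g -> (forall y, 0 <= g y)%E -> (forall y, g y <= 1)%E ->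
  (outflux g x <= 1)%E.
Proof.
move=> Dx mg g0 g1; apply: le_trans (outflux1_le1 x); apply: leeD.
  apply: ge0_le_integral.
  - exact: measurable_slice.
  - by move=> s _; rewrite mule_ge0// lee_fin mulr_ge0 ?expR_ge0// rate_ge0.
  - pose k (p : R * BT) := ((expR (- cumul true p.2 p.1) * q (phi p.1 p.2))%:E *
      g (phi p.1 p.2))%E.
    by apply: (@measurable_fun_section x _ k); rewrite /k; meas.
  - pose k (p : R * BT) := ((expR (- cumul true p.2 p.1) * q (phi p.1 p.2))%:E *
      cst 1 (phi p.1 p.2))%E.
    by apply: (@measurable_fun_section x _ k); rewrite /k; meas.
  - move=> s _; apply: lee_wpmul2l; last exact: g1.
    by rewrite lee_fin mulr_ge0 ?expR_ge0// rate_ge0.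
rewrite /outflow_end; case: ifP => // _; apply: lee_wpmul2l; last exact: g1.
by rewrite lee_fin expR_ge0.
Qed.

Lemma eq_outflux1 (g : BT -> \bar R) x : D true x ->
  (forall y, (E `|` G true) y -> g y = 1%E) ->
  outflux g x = outflux (cst 1%E) x.
Proof.
move=> Dx g1; congr (_ + _)%E.
  apply: eq_integral => s /set_mem [s0 sx]; congr (_ * _)%E; apply: g1; left.
  by have /= := path_state Dx s0 sx.
rewrite /outflow_end; case: ifP => // hx; congr (_ * _)%E; apply: g1; right.
exact: (phi_well_posed Dx).2.
Qed.

Local Notation qR0 := (qR0 phi E0 q J).
Local Notation GB b := (G b : set BT).
Local Notation EB := (E : set BT).

(** By well-posedness the formula evaluates [f] on E and [fd] on Gamma^- only. Representatives may
    thus be set to zero elsewhere, which makes them measurable on the whole space. *)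
Lemma eq_R0 (f f' fd fd' : BT -> R) x : D false x ->
  (forall y, E y -> f y = f' y) -> (forall y, G false y -> fd y = fd' y) ->
  R0 f fd x = R0 f' fd' x.
Proof.
move=> Dx ff' fdfd'; congr (_ + _)%E.
  apply: eq_integral => s /set_mem [s0 sx]; congr (_ * _ * _)%:E.
  by apply: ff'; exact: (path_state Dx s0 sx).
case: ifP => // hx /=; congr (_ * _ * _)%:E; apply: fdfd'.
exact: (phi_well_posed Dx).2.
Qed.

(** * The inflow of signed functions *)

Section signed.
Variables (f fd : BT -> R).
Hypotheses (mf : measurable_fun setT f) (mfd : measurable_fun setT fd).

Let back (h : BT -> R) (p : R * BT) :=
  (expR (- cumul false p.2 p.1) * h (phi (- p.1) p.2) * J (- p.1) p.2)%:E.

Let mback h (x : BT) (A : set (measurableTypeR R)) : measurable_fun setT h ->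
  measurable_fun A (fun s => back h (s, x)).
Proof.
by move=> mh; apply: (@measurable_fun_section x A (back h)); rewrite /back; meas.
Qed.

Let abs_back h p : `|back h p|%E = back (Num.norm \o h) p.
Proof.
by rewrite /= !normrM (ger0_norm (expR_ge0 _)) (ger0_norm (J_ge0 flow_hyp _ _)).
Qed.

Lemma abs_R0_le x : D false x ->
  (`|R0 f fd x| <= R0 (Num.norm \o f) (Num.norm \o fd) x)%E.
Proof.
move=> Dx; apply: le_trans (lee_abs_add _ _) _; apply: leeD.
  apply: (le_trans (le_abse_integral mu (measurable_slice Dx) (@mback f x _ mf))).
  by under eq_integral do rewrite abs_back.
case: ifP => // _; last by rewrite abse0.
by have := abs_back fd (fine (hit false x), x); rewrite /back /= => ->.
Qed.

Lemma integrable_back x : D false x ->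
  (R0 (Num.norm \o f) (Num.norm \o fd) x < +oo)%E ->
  mu.-integrable (slice false x) (fun s => back f (s, x)).
Proof.
move=> Dx foo; apply/integrableP; split; first exact: mback.
under eq_integral do rewrite abs_back.
apply: le_lt_trans foo; rewrite -[leLHS]adde0 leeD//.
by apply: inflow_end_ge0 => y /=.
Qed.

Lemma R0_fin_num x : D false x ->
  (R0 (Num.norm \o f) (Num.norm \o fd) x < +oo)%E -> R0 f fd x \is a fin_num.
Proof.
by move=> Dx foo; rewrite fin_num_abs; apply: le_lt_trans foo; exact: abs_R0_le.
Qed.

(** The positive and negative parts pass through the nonnegative factors of the integrand, so
    [inflow] is a difference of two nonnegative cases, even at points where it does not converge
    absolutely. *)
Lemma measurable_signed_R0 : measurable_fun (D false : set BT) (R0 f fd).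
Proof.
have maxM (a b c : R) : 0 <= a -> 0 <= c ->
    Num.max (a * b * c) 0 = a * Num.max b 0 * c.
  by move=> a0 c0; rewrite maxr_pMr// mulr0 maxr_pMl// mul0r.
have fE x : inflow f x = (inflow f^\+%R x - inflow f^\-%R x)%E.
  rewrite /inflow integralE; congr (_ - _)%E; apply: eq_integral => s _.
    rewrite funeposE /= -EFin_max; congr EFin.
    by rewrite maxM ?expR_ge0//; exact: (J_ge0 flow_hyp).
  rewrite funenegE /= -EFin_max; congr EFin.
  by rewrite -mulNr -mulrN maxM ?expR_ge0//; exact: (J_ge0 flow_hyp).
apply: emeasurable_funD; last exact: measurable_inflow_end.
rewrite (_ : (fun x => _) = (fun x => inflow f^\+%R x - inflow f^\-%R x)%E); last first.
  exact/funext.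
apply: emeasurable_funB; apply: measurable_inflow.
- exact: measurable_funrpos.
- by move=> y; exact: funrpos_ge0.
- exact: measurable_funrneg.
- by move=> y; exact: funrneg_ge0.
Qed.

End signed.

(** Linearity is only available where the formula converges absolutely, whence the two finiteness
    conditions. *)
Lemma R0_linear (a : R) (f f' fd fd' : BT -> R) x : D false x ->
  measurable_fun setT f -> measurable_fun setT f' ->
  measurable_fun setT fd -> measurable_fun setT fd' ->
  (R0 (Num.norm \o f) (Num.norm \o fd) x < +oo)%E ->
  (R0 (Num.norm \o f') (Num.norm \o fd') x < +oo)%E ->
  R0 (a \*: f \+ f') (a \*: fd \+ fd') x = (a%:E * R0 f fd x + R0 f' fd' x)%E.
Proof.
move=> Dx mf mf' mfd mfd' foo foo'.
have If := integrable_back mf Dx foo; have If' := integrable_back mf' Dx foo'.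
have ms := measurable_slice Dx.
rewrite !R0E muleDr//; last first.
  by apply: fin_num_adde_defl; rewrite /inflow_end; case: ifP.
rewrite addeACA; congr (_ + _)%E.
  rewrite /inflow -integralZl// -integralD//; last exact: integrableZl.
  apply: eq_integral => s _; rewrite -EFinM -EFinD; congr EFin.
  by rewrite /= /GRing.scale /=; ring.
rewrite /inflow_end; case: ifP => _; last by rewrite mule0 adde0.
by rewrite -EFinM -EFinD; congr EFin; rewrite /= /GRing.scale /=; ring.
Qed.

Local Notation L1E f := (@L1 _ BT R m E f).
Local Notation L1G b f := (@L1 _ BT R (mb b) (G b) f).

Lemma measurable_patch (A : set BT) (nu : {measure set BT -> \bar R})
    (f : BT -> R) : measurable A -> L1 nu A f -> measurable_fun setT (f \_ A).
Proof.
move=> mA /measurable_int/measurable_EFinP mf.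
exact/(measurable_restrictT _ mA).
Qed.

Lemma integral_norm_patch (A : set BT) (nu : {measure set BT -> \bar R})
    (f : BT -> R) :
  (\int[nu]_(x in A) ((Num.norm \o (f \_ A)) x)%:E =
   \int[nu]_(x in A) `|f x|%:E)%E.
Proof. by apply: eq_integral => x xA; rewrite /= patchE xA. Qed.

Section weighted_inflow.
Variables (rho : {measure set BT -> \bar R}) (A : set BT) (c : BT -> R).
Hypotheses (mA : measurable A) (AD : A `<=` D false).
Hypotheses (mc : measurable_fun setT c) (c0 : forall x, 0 <= c x).
Hypothesis mass_le : forall f fd : BT -> R,
  measurable_fun setT f -> (forall x, 0 <= f x) ->
  measurable_fun setT fd -> (forall x, 0 <= fd x) ->
  (\int[rho]_(x in A) ((c x)%:E * R0 f fd x) <=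
   \int[m]_(x in E) (f x)%:E + \int[mb false]_(x in G false) (fd x)%:E)%E.

(** The weight [q] on E with [m] and the weight 1 on Gamma^+ with [mb true] yield the two arguments
    of [P0] and [Pd]. For integrable data, [fine] replaces infinite values by 0 on a null set
    only. *)
Definition weighted (f fd : BT -> R) (x : BT) : R :=
  fine ((c x)%:E * R0 f fd x).

Let R0n (f fd : BT -> R) :=
  R0 (Num.norm \o (f \_ EB)) (Num.norm \o (fd \_ (GB false))).

Let R0n_ge0 (f fd : BT -> R) (x : BT) : (0 <= R0n f fd x)%E.
Proof. by apply: R0_ge0 => y /=. Qed.

Let measurable_cR0 (f fd : BT -> R) : measurable_fun setT f -> measurable_fun setT fd ->
  measurable_fun A (fun x => (c x)%:E * R0 f fd x)%E.
Proof.
move=> mf mfd; apply: emeasurable_funM.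
  by apply/measurable_EFinP; exact: measurable_funTS.
exact: (measurable_funS (mdom false) AD (measurable_signed_R0 mf mfd)).
Qed.

Let mE (f : BT -> R) : L1E f -> measurable_fun setT (f \_ EB).
Proof. by apply: measurable_patch; exact: mstate. Qed.

Let mG (f : BT -> R) : L1G false f -> measurable_fun setT (f \_ (GB false)).
Proof. by apply: measurable_patch; exact: mGamma. Qed.

Let mnorm (h : BT -> R) : measurable_fun setT h ->
  measurable_fun setT (Num.norm \o h).
Proof. by move=> mh; apply: measurableT_comp. Qed.

Let R0n_mass (f fd : BT -> R) : L1E f -> L1G false fd ->
  (\int[rho]_(x in A) ((c x)%:E * R0n f fd x) <=
   \int[m]_(x in E) `|f x|%:E + \int[mb false]_(x in G false) `|fd x|%:E)%E.
Proof.
move=> Lf Lfd.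
have := mass_le (mnorm (mE Lf)) (fun x => normr_ge0 _)
                (mnorm (mG Lfd)) (fun x => normr_ge0 _).
rewrite (integral_norm_patch E m f).
by rewrite (integral_norm_patch (G false) (mb false) fd).
Qed.

Let integrable_R0n (f fd : BT -> R) : L1E f -> L1G false fd ->
  rho.-integrable A (fun x => (c x)%:E * R0n f fd x)%E.
Proof.
move=> Lf Lfd; apply/integrableP; split.
  exact: (measurable_cR0 (mnorm (mE Lf)) (mnorm (mG Lfd))).
under eq_integral do rewrite gee0_abs ?mule_ge0 ?lee_fin ?R0n_ge0//.
apply: le_lt_trans (R0n_mass Lf Lfd) _; apply: lte_add_pinfty.
  by have /integrableP[_] := Lf.
by have /integrableP[_] := Lfd.
Qed.

(** The mass bound makes the weighted inflow of the absolute values integrable. Where [c] vanishes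
    this says nothing about [R0], but the weighted value is then zero anyway. *)
Let ae_finite (f fd : BT -> R) : L1E f -> L1G false fd ->
  \forall x \ae rho, A x -> c x = 0 \/ (R0n f fd x < +oo)%E.
Proof.
move=> Lf Lfd; have := integrable_ae mA (integrable_R0n Lf Lfd).
apply: filterS => x /[apply] Rfin.
have [->|cx] := eqVneq (c x) 0; [by left|right].
move: Rfin (R0n_ge0 f fd x); case: (R0n f fd x) => [r| |]//=.
- by rewrite ltry.
- by rewrite gt0_muley// lte_fin lt_neqAle eq_sym cx c0.
Qed.

Let R0_patch (f fd : BT -> R) (x : BT) : A x -> R0 f fd x = R0 (f \_ EB) (fd \_ (GB false)) x.
Proof.
by move=> /AD Dx; apply: eq_R0 => // y Ay; rewrite patchE mem_set.
Qed.

Let R0_lin (a : R) (f f' fd fd' : BT -> R) (x : BT) : A x ->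
  L1E f -> L1E f' -> L1G false fd -> L1G false fd' ->
  (R0n f fd x < +oo)%E -> (R0n f' fd' x < +oo)%E ->
  R0 (a \*: f \+ f') (a \*: fd \+ fd') x = (a%:E * R0 f fd x + R0 f' fd' x)%E.
Proof.
move=> Ax Lf Lf' Lfd Lfd' foo foo'; rewrite (R0_patch f fd Ax) (R0_patch f' fd' Ax).
rewrite -(R0_linear a (AD Ax) (mE Lf) (mE Lf') (mG Lfd) (mG Lfd') foo foo').
apply: eq_R0 (AD Ax) _ _ => y By; rewrite /= !patchE mem_set//.
Qed.

Let fin_R0 (f fd : BT -> R) (x : BT) : A x -> L1E f -> L1G false fd -> (R0n f fd x < +oo)%E ->
  R0 f fd x \is a fin_num.
Proof.
move=> Ax Lf Lfd foo; rewrite (R0_patch f fd Ax).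
exact: (R0_fin_num (mE Lf) (AD Ax) foo).
Qed.

Lemma weighted_L1 (f fd : BT -> R) : L1E f -> L1G false fd -> L1 rho A (weighted f fd).
Proof.
move=> Lf Lfd; apply: le_integrable (integrable_R0n Lf Lfd) => //.
  apply/measurable_EFinP; apply: (eq_measurable_fun
      (fine \o (fun x => (c x)%:E * R0 (f \_ EB) (fd \_ (GB false)) x)%E)).
    by move=> x /set_mem Ax; rewrite /weighted (R0_patch f fd Ax).
  by apply: measurableT_comp => //; exact: (measurable_cR0 (mE Lf) (mG Lfd)).
move=> x Ax; rewrite [leRHS]gee0_abs ?mule_ge0 ?lee_fin//.
apply: (@le_trans _ _ `|(c x)%:E * R0 f fd x|%E).
  by rewrite /weighted /=; case: (_ * _)%E => [r| |] //=; rewrite normr0 leey.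
rewrite abseM gee0_abs ?lee_fin//; apply: lee_wpmul2l; first by rewrite lee_fin.
by rewrite (R0_patch f fd Ax); exact: (abs_R0_le _ (mE Lf) (AD Ax)).
Qed.

(** By linearity it suffices to treat the difference pair [h], [k]: its norm is zero, so by the mass
    bound the weighted inflow of its absolute values vanishes almost everywhere. *)
Lemma weighted_ae (f f' fd fd' : BT -> R) :
  L1E f -> L1E f' -> L1G false fd -> L1G false fd' ->
  ae_eq m E f f' -> ae_eq (mb false) (G false) fd fd' ->
  ae_eq rho A (weighted f fd) (weighted f' fd').
Proof.
move=> Lf Lf' Lfd Lfd' ff' fdfd'.
pose h := ((-1) \*: f \+ f'); pose k := ((-1) \*: fd \+ fd').
have Lh : L1E h by apply: L1_linear => //; exact: mstate.
have Lk : L1G false k by apply: L1_linear => //; exact: mGamma.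
have : ae_eq rho A (fun x => (c x)%:E * R0n h k x)%E (cst 0%E).
  apply: ge0_integral_eq0_ae => //.
  - exact: (measurable_cR0 (mnorm (mE Lh)) (mnorm (mG Lk))).
  - by move=> x _; rewrite mule_ge0 ?lee_fin.
  apply/eqP; rewrite eq_le; apply/andP; split; last first.
    by apply: integral_ge0 => x _; rewrite mule_ge0 ?lee_fin.
  apply: le_trans (R0n_mass Lh Lk) _.
  have zero (nu : {measure set BT -> \bar R}) (B : set BT) (u v : BT -> R) :
      measurable B -> L1 nu B ((-1) \*: u \+ v) -> ae_eq nu B u v ->
      (\int[nu]_(x in B) `|((-1) \*: u \+ v) x|%:E = 0)%E.
    move=> mB Luv uv.
    have /measurable_int muv := Luv.
    rewrite (_ : (fun x => _) = abse \o (EFin \o ((-1) \*: u \+ v)))//.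
    apply/(ae_eq_integral_abs _ mB muv); apply: filterS uv => x /[apply] uvx.
    by rewrite /= uvx scaleN1r addNr.
  by rewrite !zero ?adde0//; [exact: mGamma|exact: mstate].
have := ae_finite Lf' Lfd'; have := ae_finite Lf Lfd.
apply: filterS3 => x fin1 fin2 h0 Ax.
have [cx|foo] := fin1 Ax; first by rewrite /weighted cx !mul0e.
have [cx|foo'] := fin2 Ax; first by rewrite /weighted cx !mul0e.
have [cx|cx] := eqVneq (c x) 0; first by rewrite /weighted cx !mul0e.
have Rh0 : R0n h k x = 0%E.
  by apply/eqP; have /eqP := h0 Ax; rewrite mule_eq0 eqe (negbTE cx).
have hk0 : R0 h k x = 0%E.
  apply/eqP; rewrite -abse_eq0 eq_le abse_ge0 andbT -Rh0 (R0_patch h k Ax).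
  exact: (abs_R0_le _ (mE Lh) (AD Ax)).
have := R0_lin (-1) Ax Lf Lf' Lfd Lfd' foo foo'; rewrite -/h -/k hk0.
have := fin_R0 Ax Lf Lfd foo; have := fin_R0 Ax Lf' Lfd' foo'.
rewrite /weighted; case: (R0 f fd x) => // r; case: (R0 f' fd' x) => // r' _ _.
by rewrite -EFinM -EFinD => -[rr']; congr (fine (_ * _%:E)%E); lra.
Qed.

Lemma weighted_linear (a : R) (f f' fd fd' : BT -> R) :
  L1E f -> L1E f' -> L1G false fd -> L1G false fd' ->
  ae_eq rho A (weighted (a \*: f \+ f') (a \*: fd \+ fd'))
              (a \*: weighted f fd \+ weighted f' fd').
Proof.
move=> Lf Lf' Lfd Lfd'.
apply: filterS2 (ae_finite Lf Lfd) (ae_finite Lf' Lfd') => x fin1 fin2 Ax.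
have c00 : c x = 0 -> weighted (a \*: f \+ f') (a \*: fd \+ fd') x =
    (a \*: weighted f fd \+ weighted f' fd') x.
  by move=> cx; rewrite /= /weighted cx !mul0e /= scaler0 addr0.
have [//|foo] := fin1 Ax; have [//|foo'] := fin2 Ax; try exact: c00.
rewrite /= /weighted (R0_lin a Ax Lf Lf' Lfd Lfd' foo foo').
have := fin_R0 Ax Lf Lfd foo; have := fin_R0 Ax Lf' Lfd' foo'.
case: (R0 f fd x) => // r; case: (R0 f' fd' x) => // r' _ _ /=.
by rewrite /GRing.scale /=; ring.
Qed.

Lemma weighted_operator :
  @positive_linear_operator _ BT R m E (mb false) (G false) rho A weighted.
Proof.
split; [exact: weighted_L1|exact: weighted_ae|exact: weighted_linear|].
move=> f fd Lf Lfd f0 fd0.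
have := weighted_ae Lf (L1_funrpos mstate Lf) Lfd (L1_funrpos (mGamma _) Lfd)
  (ae_ge0_funrpos f0) (ae_ge0_funrpos fd0).
apply: filterS => x /[apply] ->; rewrite /weighted.
by rewrite fine_ge0// mule_ge0 ?lee_fin//; apply: R0_ge0 => y; exact: funrpos_ge0.
Qed.

End weighted_inflow.

(** The duality with [g = 1], combined with a total mass of at most one. All integrability of [R0]
    rests on this estimate. *)
Lemma inflow_mass (f fd : BT -> R) :
  measurable_fun setT f -> (forall x, 0 <= f x) ->
  measurable_fun setT fd -> (forall x, 0 <= fd x) ->
  (\int[m]_(y in E) ((q y)%:E * R0 f fd y) + \int[mb true]_(z in G true) R0 f fd z <=
   \int[m]_(x in E) (f x)%:E + \int[mb false]_(x in G false) (fd x)%:E)%E.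
Proof.
move=> mf f0 mfd fd0.
have c1 : measurable_fun setT (cst 1%E : BT -> \bar R) by exact: measurable_cst.
have := duality mf f0 mfd fd0 c1 (fun _ => lee01).
under eq_integral do rewrite mul1e.
under [in X in _ + X]eq_integral do rewrite mul1e.
move=> ->; apply: leeD; apply: ge0_le_integral => //.
- exact: mstate.
- by move=> x _; rewrite mule_ge0 ?lee_fin ?outflux_ge0// => y; exact: lee01.
- apply: emeasurable_funM; last exact/measurable_EFinP/measurable_funTS.
  apply: (measurable_funS (mdom true)) (measurable_outflux c1 _) => [x|y]; first by left.
  exact: lee01.
- exact/measurable_EFinP/measurable_funTS.
- move=> x _; rewrite -[leRHS]mul1e; apply: lee_wpmul2r; first by rewrite lee_fin.
  exact: outflux1_le1.
- exact: mGamma.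
- by move=> x _; rewrite mule_ge0 ?lee_fin ?outflux_ge0// => y; exact: lee01.
- apply: emeasurable_funM; last exact/measurable_EFinP/measurable_funTS.
  apply: (measurable_funS (mdom true)) (measurable_outflux c1 _) => [x|y]; first by right.
  exact: lee01.
- exact/measurable_EFinP/measurable_funTS.
- move=> x _; rewrite -[leRHS]mul1e; apply: lee_wpmul2r; first by rewrite lee_fin.
  exact: outflux1_le1.
Qed.

Let R0_integral_ge0 (nu : {measure set BT -> \bar R}) (A : set BT) f fd :
  (forall x, 0 <= f x) -> (forall x, 0 <= fd x) ->
  (0 <= \int[nu]_(z in A) R0 f fd z)%E.
Proof. by move=> f0 fd0; apply: integral_ge0 => z _; exact: R0_ge0. Qed.

Lemma mass_state (f fd : BT -> R) :
  measurable_fun setT f -> (forall x, 0 <= f x) ->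
  measurable_fun setT fd -> (forall x, 0 <= fd x) ->
  (\int[m]_(y in E) ((q y)%:E * R0 f fd y) <=
   \int[m]_(x in E) (f x)%:E + \int[mb false]_(x in G false) (fd x)%:E)%E.
Proof.
move=> mf f0 mfd fd0; apply: le_trans (inflow_mass mf f0 mfd fd0).
by rewrite leeDl// R0_integral_ge0.
Qed.

Lemma mass_boundary (f fd : BT -> R) :
  measurable_fun setT f -> (forall x, 0 <= f x) ->
  measurable_fun setT fd -> (forall x, 0 <= fd x) ->
  (\int[mb true]_(y in G true) ((cst 1 y : R)%:E * R0 f fd y) <=
   \int[m]_(x in E) (f x)%:E + \int[mb false]_(x in G false) (fd x)%:E)%E.
Proof.
move=> mf f0 mfd fd0; apply: le_trans (inflow_mass mf f0 mfd fd0).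
under eq_integral do rewrite mul1e.
rewrite leeDr//; apply: integral_ge0 => z _.
by rewrite mule_ge0 ?R0_ge0// lee_fin rate_ge0.
Qed.

Let ED : (E : set BT) `<=` D false.
Proof. by move=> x; left. Qed.

Let GD : (G true : set BT) `<=` D false.
Proof. by move=> x; right. Qed.

Lemma state_inflow_operator :
  @positive_linear_operator _ BT R m E (mb false) (G false) m E
    (fun f fd => fine \o qR0 f fd).
Proof. exact: (weighted_operator mstate ED measurable_rate rate_ge0 mass_state). Qed.

Lemma boundary_inflow_operator :
  @positive_linear_operator _ BT R m E (mb false) (G false) (mb true) (G true)
    (fun f fd => fine \o R0 f fd).
Proof.
have := weighted_operator (mGamma true) GD (@measurable_cst _ _ _ _ setT (1 : R))
  (fun _ => ler01) mass_boundary.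
congr (positive_linear_operator _ _ _ _ _ _ _).
by apply/funext => f; apply/funext => fd; apply/funext => x; rewrite /weighted mul1e.
Qed.

Lemma integrable_inflow (f fd : BT -> R) : L1E f -> L1G false fd ->
  (forall x, E x -> 0 <= f x) -> (forall x, G false x -> 0 <= fd x) ->
  m.-integrable E (qR0 f fd) /\ (mb true).-integrable (G true) (R0 f fd).
Proof.
move=> Lf Lfd f0 fd0.
have mf := measurable_patch mstate Lf.
have mfd := measurable_patch (mGamma false) Lfd.
have fE0 x : 0 <= (f \_ EB) x by apply: restrict_ge0.
have fdG0 x : 0 <= (fd \_ (GB false)) x by apply: restrict_ge0.
have R0p x : D false x -> R0 f fd x = R0 (f \_ EB) (fd \_ (GB false)) x.
  by move=> Dx; apply: eq_R0 => // y By; rewrite patchE mem_set.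
have mR : measurable_fun (D false : set BT) (R0 (f \_ EB) (fd \_ (GB false))).
  exact: measurable_R0.
have fin : (\int[m]_(x in E) ((f \_ EB) x)%:E +
    \int[mb false]_(x in G false) ((fd \_ (GB false)) x)%:E < +oo)%E.
  rewrite (eq_integral (fun x => (f x)%:E)) => [|x xE]; last by rewrite patchE xE.
  rewrite [X in (_ + X)%E](eq_integral (fun x => (fd x)%:E)) => [|x xG]; last first.
    by rewrite patchE xG.
  apply: lte_add_pinfty; first exact: (integrable_lty mstate Lf).
  exact: (integrable_lty (mGamma false) Lfd).
split.
  apply: (@eq_integrable _ _ _ m E mstate
      (fun x => (q x)%:E * R0 (f \_ EB) (fd \_ (GB false)) x)%E) => //.
    by move=> x /set_mem Ex; rewrite -R0p//; left.
  apply/integrableP; split.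
    apply: emeasurable_funM; last exact: (measurable_funS (mdom false) ED mR).
    by apply: measurable_funTS; apply/measurable_EFinP; exact: measurable_rate.
  under eq_integral do rewrite gee0_abs ?mule_ge0 ?lee_fin ?rate_ge0 ?R0_ge0//.
  exact: le_lt_trans (mass_state mf fE0 mfd fdG0) fin.
apply: (@eq_integrable _ _ _ (mb true) (G true) (mGamma true)
    (R0 (f \_ EB) (fd \_ (GB false)))) => //.
  by move=> x /set_mem Gx; rewrite -R0p//; right.
apply/integrableP; split; first exact: (measurable_funS (mdom false) GD mR).
under eq_integral do rewrite gee0_abs ?R0_ge0//.
apply: le_lt_trans fin; apply: le_trans (mass_boundary mf fE0 mfd fdG0).
by rewrite (eq_integral (fun x : BT => ((cst 1 x : R)%:E *
  R0 (f \_ EB) (fd \_ (GB false)) x)%E))// => x _; rewrite mul1e.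
Qed.

(** * The operator K *)

Variables (P : R.-pker BT ~> BT) (P0 Pd : (T -> R) -> (T -> R) -> T -> R).
Hypothesis P_state : jump_kernel_on_state phi E0 P.
Hypothesis jump_hyp : jump_assumption phi E0 P m mb P0 Pd.
Local Notation calK := (kernelK phi E0 q P).
Local Notation K := (opK phi E0 q J P0 Pd).

Lemma kernelKE x F : calK x F = outflux (P^~ F) x.
Proof. by []. Qed.

Lemma prob_le1 x (F : set BT) : measurable F -> (P x F <= 1)%E.
Proof.
by move=> mF; rewrite -(@prob_kernel _ _ _ _ _ P x) le_measure ?inE.
Qed.

Lemma prob_state x : (E `|` G true) x -> P x E = 1%E.
Proof.
move=> Ex; have mE := mstate; rewrite -(@prob_kernel _ _ _ _ _ P x) -(setUv EB).
have := measureU (P x) mE (measurableC mE) (setICr EB).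
by move=> ->; rewrite [X in (_ + X)%E](P_state Ex) adde0.
Qed.

Lemma measurable_kernelK (F : set BT) : measurable F ->
  measurable_fun (D true : set BT) (calK ^~ F).
Proof.
move=> mF; exact: (measurable_outflux (measurable_kernel P F mF)
                                      (fun y => measure_ge0 (P y) F)).
Qed.

Lemma kernelK_ge0 x (F : set BT) : (0 <= calK x F)%E.
Proof. by rewrite kernelKE outflux_ge0. Qed.

Lemma kernelK_le1 x (F : set BT) : D true x -> measurable F -> (calK x F <= 1)%E.
Proof.
move=> Dx mF; rewrite kernelKE; apply: outflux_le1 => //; first exact: measurable_kernel.
by move=> y; exact: prob_le1.
Qed.

Lemma kernelK_state x : D true x -> calK x EB = outflux (cst 1%E) x.
Proof. by move=> Dx; rewrite kernelKE; apply: eq_outflux1 => // y; exact: prob_state. Qed.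

Section nonnegative_identity.
Variables (f fd : BT -> R) (F : set BT).
Hypotheses (Lf : L1E f) (f0 : forall x, 0 <= f x).
Hypotheses (Lfd : L1G false fd) (fd0 : forall x, 0 <= fd x).
Hypotheses (mF : measurable F) (FE : F `<=` EB).

Let fE := f \_ EB.
Let fdG := fd \_ (GB false).

Lemma L1_inflow : L1E (fine \o qR0 f fd) /\ L1G true (fine \o R0 f fd).
Proof.
by split; [exact: (plo_L1 state_inflow_operator)|exact: (plo_L1 boundary_inflow_operator)].
Qed.

(** [P0] and [Pd] act on real functions; an integrable [k] is finite almost everywhere, so passing
    to real values keeps the integral. *)
Lemma integral_fine_weight (nu : {measure set BT -> \bar R}) (A : set BT)
    (k : BT -> \bar R) : measurable A -> nu.-integrable A k ->
  (forall x, A x -> 0 <= k x)%E ->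
  (\int[nu]_(x in A) (P x F * k x) =
   \int[nu]_(x in A) (P x F * (fine (k x))%:E))%E.
Proof.
move=> mA ik k0; have mP : measurable_fun A (P^~ F).
  by apply: measurable_funTS; exact: measurable_kernel.
have mk := measurable_int _ ik.
apply: ge0_ae_eq_integral => //.
- exact: emeasurable_funM.
- apply: emeasurable_funM => //; apply/measurable_EFinP.
  exact: measurableT_comp.
- by move=> x Ax; rewrite mule_ge0// k0.
- by move=> x Ax; rewrite mule_ge0// lee_fin fine_ge0// k0.
- by apply: filterS (integrable_ae mA ik) => x kx Ax; rewrite fineK// kx.
Qed.

(** The duality with [g = P^~ F] turns the left side into integrals of [P^~ F] against [qR0] and
    [R0], to which the jump assumption applies. *)
Lemma kernel_identity_ge0 :
  (\int[m]_(x in E) (calK x F * (f x)%:E) +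
   \int[mb false]_(x in G false) (calK x F * (fd x)%:E) =
   \int[m]_(x in F `&` E0) (P0 (fine \o qR0 f fd) (fine \o R0 f fd) x)%:E +
   \int[mb false]_(x in F `&` G false)
      (Pd (fine \o qR0 f fd) (fine \o R0 f fd) x)%:E)%E.
Proof.
have [LS1 LS2] := L1_inflow.
have R0pos x : (0 <= R0 f fd x)%E by exact: R0_ge0.
have qR0pos x : (0 <= qR0 f fd x)%E by rewrite mule_ge0// lee_fin rate_ge0.
have [i1 i2] := integrable_inflow Lf Lfd (fun x _ => f0 x) (fun x _ => fd0 x).
rewrite -(P_operators jump_hyp mF FE LS1 LS2); last 2 first.
- by move=> x _; rewrite /= fine_ge0.
- by move=> x _; rewrite /= fine_ge0.
have := integral_fine_weight mstate i1 (fun x _ => qR0pos x).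
have := integral_fine_weight (mGamma true) i2 (fun x _ => R0pos x).
move=> /= <- <-.
have fE0 x : 0 <= fE x by exact: restrict_ge0.
have fdG0 x : 0 <= fdG x by exact: restrict_ge0.
have := duality (measurable_patch mstate Lf) fE0 (measurable_patch (mGamma false) Lfd) fdG0
  (measurable_kernel P F mF) (fun y => measure_ge0 (P y) F).
have R0p x : D false x -> R0 f fd x = R0 fE fdG x.
  by move=> Dx; apply: eq_R0 => // y By; rewrite /fE /fdG patchE mem_set.
move=> dual; apply: etrans (etrans (esym dual) _).
  congr (_ + _)%E; apply: eq_integral => x xA; first by rewrite /fE patchE xA.
  by rewrite /fdG patchE xA.
congr (_ + _)%E; apply: eq_integral => x /set_mem Ax.
  by rewrite /Defs.qR0 R0p//; left.
by rewrite R0p//; right.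
Qed.

End nonnegative_identity.

Let image0_operator := plo_comp mstate (mGamma false) mstate (mGamma true)
  state_inflow_operator boundary_inflow_operator (P0_operator jump_hyp).

Let imaged_operator := plo_comp mstate (mGamma false) mstate (mGamma true)
  state_inflow_operator boundary_inflow_operator (Pd_operator jump_hyp).

Lemma opK_operator : @positive_pair_operator _ BT R m E (mb false) (G false) K.
Proof.
split.
  exact: (plo_signed_extension mstate (mGamma false) mstate image0_operator).
exact: (plo_signed_extension mstate (mGamma false) (mGamma false) imaged_operator).
Qed.

Lemma integrable_kernelK (nu : {measure set BT -> \bar R}) (A F : set BT) (f : BT -> R) :
  measurable A -> A `<=` D true -> measurable F -> L1 nu A f ->
  nu.-integrable A (fun x => calK x F * (f x)%:E)%E.
Proof.
move=> mA AD mF Lf; apply: (le_integrable mA _ _ Lf).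
  apply: emeasurable_funM; last exact: (measurable_int _ Lf).
  exact: (measurable_funS (mdom true) AD (measurable_kernelK mF)).
move=> x Ax; rewrite abseM gee0_abs ?kernelK_ge0// -[leRHS]mul1e.
by apply: lee_wpmul2r => //; exact: (kernelK_le1 (AD _ Ax)).
Qed.

(** The identity for the positive parts minus the one for the negative parts. The terms can be
    regrouped because the subtracted integrals are finite, the kernel being at most one. *)
Lemma kernel_identity (F : set BT) (f fd : BT -> R) :
  measurable F -> F `<=` EB -> L1E f -> L1G false fd ->
  (\int[m]_(x in E) (calK x F * (f x)%:E) +
   \int[mb false]_(x in G false) (calK x F * (fd x)%:E) =
   \int[m]_(x in F `&` E0) ((K f fd).1 x)%:E +
   \int[mb false]_(x in F `&` G false) ((K f fd).2 x)%:E)%E.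
Proof.
move=> mF FE Lf Lfd.
have K0 x : (0 <= calK x F)%E by exact: kernelK_ge0.
have Lp := L1_funrpos mstate Lf; have Ln := L1_funrneg mstate Lf.
have Ldp := L1_funrpos (mGamma false) Lfd; have Ldn := L1_funrneg (mGamma false) Lfd.
have mEF : measurable (F `&` E0 : set BT) by exact: measurableI.
have mGF : measurable (F `&` G false : set BT).
  by apply: measurableI => //; exact: mGamma.
have sE : F `&` E0 `<=` EB by move=> x [/FE].
have sG : F `&` G false `<=` GB false by move=> x [].
rewrite (integral_signed m EB f K0) (integral_signed (mb false) (GB false) fd K0).
have idp := kernel_identity_ge0 Lp (funrpos_ge0 f) Ldp (funrpos_ge0 fd) mF FE.
have idn := kernel_identity_ge0 Ln (funrneg_ge0 f) Ldn (funrneg_ge0 fd) mF FE.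
have [p0 pd] := (image0_operator, imaged_operator).
rewrite (integralB_L1 mstate mEF sE (plo_L1 p0 Lp Ldp) (plo_L1 p0 Ln Ldn)).
rewrite (integralB_L1 (mGamma false) mGF sG (plo_L1 pd Lp Ldp) (plo_L1 pd Ln Ldn)).
have ED1 : EB `<=` D true by move=> x; left.
have GD1 : GB false `<=` D true by move=> x; right.
have finE u : L1E u -> (\int[m]_(x in E) (calK x F * (u x)%:E))%E \is a fin_num.
  by move=> Lu; apply: integrable_fin_num; [exact: mstate|exact: (integrable_kernelK mstate ED1)].
have finP u (A : set BT) (nu : {measure set BT -> \bar R}) (B : set BT) :
    measurable A -> measurable B -> B `<=` A -> L1 nu A u ->
    (\int[nu]_(x in B) (u x)%:E)%E \is a fin_num.
  by move=> mA mB BA Lu; apply: integrable_fin_num; [|exact: (integrableS mA mB BA)].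
have addeBACA (a b c d : \bar R) : b \is a fin_num ->
    (a - b + (c - d) = (a + c) - (b + d))%E.
  by move=> bfin; rewrite [in RHS]oppeD ?fin_num_adde_defr// addeACA.
apply: etrans (addeBACA _ _ _ _ (finE _ Ln)) _; apply/esym.
apply: etrans (addeBACA _ _ _ _ _) _.
  exact: (finP _ EB m _ mstate mEF sE (plo_L1 p0 Ln Ldn)).
by rewrite idp idn.
Qed.

Let opK1 := ppo_1 opK_operator.
Let opK2 := ppo_2 opK_operator.

Lemma opK_boundary_state (f fd : BT -> R) : L1E f -> L1G false fd ->
  \forall x \ae mb false, (G false `\` E) x -> (K f fd).2 x = 0.
Proof.
move=> Lf Lfd.
have Lp := L1_funrpos mstate Lf; have Ln := L1_funrneg mstate Lf.
have Ldp := L1_funrpos (mGamma false) Lfd; have Ldn := L1_funrneg (mGamma false) Lfd.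
have [p1 p2] := L1_inflow Lp Ldp; have [n1 n2] := L1_inflow Ln Ldn.
have ff := @ae_filter_ringOfSetsType _ BT R (mb false).
apply: filterS2 (Pd_state jump_hyp p1 p2) (Pd_state jump_hyp n1 n2) => x xp xn Ax.
by rewrite /opK /opK_ge0 /= xp// xn// subrr.
Qed.

(** The identity with [F = E] computes the norm after two corrections: [m] does not charge Gamma^-,
    and the second component vanishes almost everywhere on the part of Gamma^- outside E, which the
    identity does not see. *)
Lemma norm_opK_ge0 (f fd : BT -> R) : L1E f -> L1G false fd ->
  (\forall x \ae m, E x -> 0 <= f x) ->
  (\forall x \ae mb false, G false x -> 0 <= fd x) ->
  (pair_norm m E (mb false) (G false) (K f fd).1 (K f fd).2 =
   \int[m]_(x in E) (calK x E * (f x)%:E) +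
   \int[mb false]_(x in G false) (calK x E * (fd x)%:E))%E.
Proof.
move=> Lf Lfd f0 fd0; rewrite (kernel_identity mstate (@subset_refl _ _) Lf Lfd).
have LK1 := plo_L1 opK1 Lf Lfd; have LK2 := plo_L1 opK2 Lf Lfd.
have p1 := plo_ge0 opK1 Lf Lfd f0 fd0; have p2 := plo_ge0 opK2 Lf Lfd f0 fd0.
have m1 := measurable_int _ LK1; have m2 := measurable_int _ LK2.
have mE := mstate; have mG := mGamma false.
have EE0 : E `&` E0 = E0 by apply: setIidr => x; left.
congr (_ + _)%E.
  rewrite integral_state//; last exact: (measurableT_comp (@abse_measurable R setT) m1).
  rewrite EE0; apply: ae_eq_integral => //.
  - apply: (measurable_funS mE (@subsetUl _ _ _)).
    exact: (measurableT_comp (@abse_measurable R setT) m1).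
  - exact: (measurable_funS mE (@subsetUl _ _ _) m1).
  - by apply: filterS p1 => x Kx E0x; rewrite /= ger0_norm// Kx//; left.
rewrite [RHS](integral_mkcondl (mb false) (GB false) EB); apply: ae_eq_integral => //.
- exact: (measurableT_comp (@abse_measurable R setT) m2).
- apply/(measurable_restrict _ mE mG); apply: (measurable_funS mG _ m2).
  exact: subIsetl.
- apply: filterS2 p2 (opK_boundary_state Lf Lfd) => x Kx K0 Gx.
  rewrite patchE; case: ifPn => [_|]; first by rewrite /= ger0_norm// Kx.
  by rewrite notin_setE => nEx; rewrite (K0 (conj Gx nEx)) normr0.
Qed.

Lemma opK_substochastic : @substochastic _ BT R m E (mb false) (G false) K.
Proof.
split; first exact: opK_operator.
move=> f fd Lf Lfd; have mE := mstate; have mG := mGamma false.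
have Lnf : L1E (Num.norm \o f) by exact: (integrable_norm Lf).
have Lnfd : L1G false (Num.norm \o fd) by exact: (integrable_norm Lfd).
have n0 (nu : {measure set BT -> \bar R}) (A : set BT) (h : BT -> R) :
  \forall x \ae nu, A x -> 0 <= (Num.norm \o h) x by apply: aeW => x _ /=.
apply: le_trans (leeD (norm_ge0_operator_le mE mG mE opK1 Lf Lfd)
                      (norm_ge0_operator_le mE mG mG opK2 Lf Lfd)) _.
have := norm_opK_ge0 Lnf Lnfd (n0 _ _ _) (n0 _ _ _); rewrite /pair_norm => ->.
have le (nu : {measure set BT -> \bar R}) (A : set BT) (h : BT -> R) :
    measurable A -> A `<=` D true -> L1 nu A (Num.norm \o h) ->
    (\int[nu]_(x in A) (calK x E * ((Num.norm \o h) x)%:E) <=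
     \int[nu]_(x in A) `|h x|%:E)%E.
  move=> mA AD Lh; apply: ge0_le_integral => //.
  - by move=> x _; rewrite mule_ge0 ?kernelK_ge0// lee_fin /=.
  - exact: (measurable_int _ (integrable_kernelK mA AD mE Lh)).
  - exact: (measurable_int _ Lh).
  - move=> x Ax; rewrite -[leRHS]mul1e; apply: lee_wpmul2r; first by rewrite lee_fin normr_ge0.
    exact: (kernelK_le1 (AD _ Ax) mE).
have EDt : EB `<=` D true by move=> x; left.
have GDt : GB false `<=` D true by move=> x; right.
exact: (leeD (le _ _ _ mE EDt Lnf) (le _ _ _ mG GDt Lnfd)).
Qed.

(** The norm is preserved once the kernel has mass one at every starting point. These include the
    points of Gamma^- outside E, hence the range of the divergence condition. *)
Lemma opK_stochastic :
  (forall x, (E `|` G false) x -> hit true x = +oo%E ->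
     cumul true x t @[t --> +oo] --> +oo) ->
  @stochastic _ BT R m E (mb false) (G false) K.
Proof.
move=> Qoo; split; first exact: opK_operator.
move=> f fd Lf Lfd f0 fd0; rewrite norm_opK_ge0// /pair_norm.
have mE := mstate; have mG := mGamma false.
have eq (nu : {measure set BT -> \bar R}) (A : set BT) (h : BT -> R) :
    measurable A -> A `<=` D true -> L1 nu A h ->
    (\forall x \ae nu, A x -> 0 <= h x) ->
    (\int[nu]_(x in A) (calK x E * (h x)%:E) = \int[nu]_(x in A) `|h x|%:E)%E.
  move=> mA AD Lh h0; apply: ae_eq_integral => //.
  - exact: (measurable_int _ (integrable_kernelK mA AD mE Lh)).
  - exact: (measurableT_comp (@abse_measurable R setT) (measurable_int _ Lh)).
  apply: filterS h0 => x hx Ax; rewrite kernelK_state ?outflux1_eq1 ?mul1e; last exact: AD.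
    by rewrite ger0_norm// hx.
  exact: Qoo (AD _ Ax).
have EDt : EB `<=` D true by move=> x; left.
have GDt : GB false `<=` D true by move=> x; right.
by rewrite (eq _ _ _ mE EDt Lf f0) (eq _ _ _ mG GDt Lfd fd0).
Qed.

(** * The first jump of the process *)

Section jump_time.
Context d (Omega : measurableType d) (Pr : probability Omega R).
Variables (s : Omega -> \bar R) (x : T).
Hypotheses (Ex : D true x) (ms : measurable_fun setT s) (s0 : forall o, (0 <= s o)%E).
Hypothesis s_law : forall t, 0 <= t ->
  Pr [set o | (t%:E < s o)%E] = (survival phi E0 q x t)%:E.

Let finite : set Omega := [set o | (s o < +oo)%E].
Let p (u : measurableTypeR R) : R := expR (- cumul true x u) * q (phi u x).
Let pT (u : measurableTypeR R) : R := (p \_ (slice true x)) u.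
Let c : R :=
  if (hit true x < +oo)%E then expR (- cumul true x (fine (hit true x))) else 0.

Let mfinite : measurable finite.
Proof.
by rewrite -[finite]setTI; apply: emeasurable_fun_infty_o.
Qed.

Let mfine : measurable_fun setT (fine \o s : Omega -> measurableTypeR R).
Proof. exact: measurableT_comp. Qed.

Let c0 : 0 <= c.
Proof. by rewrite /c; case: ifP => // _; exact: expR_ge0. Qed.

Let mpT : measurable_fun setT pT.
Proof.
apply/measurable_EFinP.
have := measurable_path_density x (A := setT) => /measurable_EFinP mp.
apply/measurable_EFinP.
by apply/(measurable_restrictT _ (measurable_slice Ex)); exact: measurable_funTS.
Qed.

Let pT0 u : 0 <= pT u.
Proof.
apply: restrict_ge0 => v _.
by have := path_density_ge0 x v; rewrite lee_fin.
Qed.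

Let density (A : set (measurableTypeR R)) : \bar R := (\int[mu]_(u in A) (pT u)%:E)%E.

Let density0 : density set0 = 0%E.
Proof. exact: integral_set0. Qed.

Let density_ge0 A : (0 <= density A)%E.
Proof. by apply: integral_ge0 => u _; rewrite lee_fin. Qed.

Let density_sigma_additive : semi_sigma_additive density.
Proof.
apply: semi_sigma_additive_nng_induced => //.
exact/measurable_EFinP.
Qed.

HB.instance Definition _ := isMeasure.Build _ _ _ density
  density0 density_ge0 density_sigma_additive.

(** The candidate law of the finite jump time: a density and an atom at the exit. Without an exit
    the weight [c] is zero, so it does not matter that [fine] then places the atom at 0. *)
Let law : {measure set (measurableTypeR R) -> \bar R} := measure_add density
  (mscale (NngNum c0) (@dirac _ (measurableTypeR R) (fine (hit true x)) R)).

Let integral_ray_density (t : R) : density `]-oo, t]%classic =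
  (\int[mu]_(u in `]-oo, t]%classic `&` slice true x) (p u)%:E)%E.
Proof.
rewrite /density integral_mkcondr; apply: eq_integral => u _.
by rewrite /pT !patchE; case: ifP.
Qed.
Let lawE (A : set (measurableTypeR R)) :
  law A = (density A + c%:E * \d_(fine (hit true x) : measurableTypeR R) A)%E.
Proof. exact: measure_addE. Qed.

Let mp A : measurable_fun A (fun u : measurableTypeR R => (p u)%:E).
Proof. exact: measurable_path_density. Qed.

Let c_exit T0 : hit true x = T0%:E -> c = expR (- cumul true x T0).
Proof. by rewrite /c => ->; rewrite ltry. Qed.

Let c_noexit : hit true x = +oo%E -> c = 0.
Proof. by rewrite /c => ->; rewrite ltxx. Qed.

Let integral_density_ray (t : R) : 0 <= t ->
  (\int[mu]_(u in `]0%R, t]) (p u)%:E = (1 - expR (- cumul true x t))%:E)%E.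
Proof.
by move=> t0; rewrite -integral_itv_bndo_bndc ?(integral_path x t0)//; exact: mp.
Qed.

Let law_ray (t : R) :
  law `]-oo, t]%classic = (if 0 <= t then 1 - survival phi E0 q x t else 0)%:E.
Proof.
rewrite lawE integral_ray_density diracE.
have hit0 := hit_ge0 true x.
case: (leP 0 t) => [t0|t0]; last first.
  rewrite (_ : _ `&` _ = set0); last first.
    apply/seteqP; split => // u [] /=; rewrite in_itv/= => ut [u0 _].
    by move: (lt_trans u0 (le_lt_trans ut t0)); rewrite ltxx.
  rewrite integral_set0 add0e memNset ?mule0//= in_itv/=.
  by apply/negP; rewrite -ltNge (lt_le_trans t0)// fine_ge0.
have [tx|xt] := ltP t%:E (hit true x).
  have -> : `]-oo, t]%classic `&` slice true x = `]0, t]%classic.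
    apply/seteqP; split => u /=; rewrite !in_itv/=; first by move=> [-> [->]].
    move=> /andP[u0 ut]; split=> //; split => //.
    by rewrite (le_lt_trans _ tx)// lee_fin.
  rewrite (integral_density_ray t0) /survival tx.
  move: tx hit0; case hx : (hit true x) => [T0| |]// tx _; last first.
    by rewrite (c_noexit hx) mul0e adde0.
  rewrite memNset ?mule0 ?adde0//= in_itv/=.
  by apply/negP; rewrite -ltNge -lte_fin.
move: xt hit0; case hx : (hit true x) => [T0| |]//; rewrite !lee_fin => xt T00.
have -> : `]-oo, t]%classic `&` slice true x = `]0, T0[%classic.
  rewrite (slice_exit hx); apply: setIidr => u /=; rewrite !in_itv/= => /andP[_ ut].
  exact: ltW (lt_le_trans ut xt).
rewrite (integral_path x T00) (c_exit hx) mem_set/= ?in_itv// mule1.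
by rewrite /survival hx lte_fin ltNge xt /= subr0 -EFinD subrK.
Qed.

(** Both measures have the same distribution function. Infinite jump times are removed on the left,
    as [fine] would count them at 0. *)
Let time_law (A : set (measurableTypeR R)) : measurable A ->
  Pr (finite `&` (fine \o s) @^-1` A) = law A.
Proof.
pose m1_ : {measure set (measurableTypeR R) -> \bar R} :=
  pushforward (mrestr Pr mfinite) (fine \o s : Omega -> measurableTypeR R).
pose m1 := m1_ mfine.
have m1E (B : set (measurableTypeR R)) :
    m1 B = Pr (finite `&` (fine \o s) @^-1` B).
  by rewrite setIC.
move=> mA; rewrite -m1E; apply: measure_unique_rays mA => t; last first.
  rewrite m1E; apply: le_lt_trans (probability_le1 Pr _) (ltry _).
  apply: measurableI => //.
  by rewrite -[X in measurable X]setTI; apply: mfine => //; exact: measurable_itv.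
rewrite law_ray m1E.
have [t0|t0] := leP 0 t; last first.
  rewrite (_ : _ `&` _ = set0) ?measure0//; apply/seteqP; split => // o [_] /=.
  rewrite in_itv/= => ot; move: (le_lt_trans ot t0).
  by rewrite ltNge fine_ge0.
rewrite (_ : _ `&` _ = ~` [set o | (t%:E < s o)%E]).
  rewrite probability_setC ?s_law//.
  by rewrite -[X in measurable X]setTI; exact: emeasurable_fun_o_infty.
apply/seteqP; split => o /=; rewrite in_itv/=.
  move=> [so ot]; apply/negP; rewrite -leNgt.
  by rewrite -(fineK (_ : s o \is a fin_num)) ?lee_fin// ge0_fin_numE.
move=> /negP; rewrite -leNgt => ot.
have so : (s o < +oo)%E by exact: le_lt_trans ot (ltry _).
by split => //; rewrite -lee_fin fineK// ge0_fin_numE.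
Qed.

Lemma integral_jump_time (k : measurableTypeR R -> \bar R) :
  measurable_fun setT k -> (forall u, 0 <= k u)%E ->
  (\int[Pr]_(o in [set o | s o < +oo]) k (fine (s o)) =
   \int[mu]_(u in slice true x) ((expR (- cumul true x u) * q (phi u x))%:E * k u) +
   if hit true x < +oo then
     (expR (- cumul true x (fine (hit true x))))%:E * k (fine (hit true x))
   else 0)%E.
Proof.
move=> mk k0.
have -> : (\int[Pr]_(o in finite) k (fine (s o)) = \int[law]_u (k u * 1%:E))%E.
  apply: (@integral_image_density _ _ Omega (measurableTypeR R) R Pr law
    finite setT (fine \o s) (cst 1)) => //.
  - exact: measurable_funTS.
  - move=> F mF _; apply: etrans (time_law mF) (esym _).
    exact: etrans (integral_cst law mF 1%E) (mul1e _).
under eq_integral do rewrite mule1.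
rewrite ge0_integral_measure_add// ge0_integral_mscale// integral_dirac// diracT mul1e.
congr (_ + _)%E.
  have -> : (\int[density]_u k u = \int[mu]_u (k u * (pT u)%:E))%E.
    apply: (@integral_image_density _ _ (measurableTypeR R) (measurableTypeR R) R
      density mu setT setT id pT) => // F mF _.
    by rewrite setTI.
  rewrite [RHS]integral_mkcond; apply: eq_integral => u _.
  rewrite /pT !patchE; case: ifP => _; first by rewrite muleC.
  by rewrite mule0.
by rewrite /= /c; case: ifP => //; rewrite mul0e.
Qed.

End jump_time.

(** * From the process to the transition kernel *)

Section process.
Context d (Omega : measurableType d) (Pr : probability Omega R).
Variables (X : nat -> Omega -> option T) (sigma : nat -> Omega -> \bar R) (x : T).
Hypothesis process : minimal_process phi E0 q P Pr X sigma.
Hypotheses (Ex : E x) (X0x : \forall o \ae Pr, X 0%N o = Some x).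
Variable F : set BT.
Hypotheses (mF : measurable F) (FE : F `<=` EB).

Local Notation jump_into n := (X n @^-1` (Some @` F)).

Lemma tauS n o : (tau sigma n.+1 o = tau sigma n o + sigma n.+1 o)%E.
Proof. by rewrite /tau big_nat_recr. Qed.

Lemma tau0 o : tau sigma 0 o = 0%E.
Proof. by rewrite /tau big_geq. Qed.

Lemma tau1 o : tau sigma 1 o = sigma 1 o.
Proof. by rewrite tauS tau0 add0e. Qed.

Lemma tau_le n k o : (n <= k)%N -> (tau sigma n o <= tau sigma k o)%E.
Proof.
elim: k => [|k IH]; first by rewrite leqn0 => /eqP ->.
rewrite leq_eqVlt ltnS => /predU1P[->//|/IH nk]; apply: le_trans nk _.
by rewrite tauS leeDl// (sigma_ge0 process).
Qed.

Lemma measurable_tau n : measurable_fun setT (tau sigma n).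
Proof.
elim: n => [|n IH]; first by rewrite (funext tau0); exact: measurable_cst.
rewrite (funext (tauS n)); apply: emeasurable_funD => //.
exact: (sigma_measurable process).
Qed.

Lemma flow_ext0 y : flow_ext phi 0%E y = y.
Proof. by case: y => //= y; rewrite (flow0 phi_flow). Qed.

(** Since the jump times are monotone, [n] is the only step whose time interval contains
    [tau sigma n o], so the choice in [jump_path] is forced. *)
Lemma jump_path_tau n o : (tau sigma n o < tau sigma n.+1 o)%E ->
  jump_path phi X sigma (tau sigma n o) o = X n o.
Proof.
move=> nS; have nfin : tau sigma n o \is a fin_num.
  rewrite ge0_fin_numE; last by rewrite -(tau0 o) tau_le.
  exact: lt_le_trans nS (leey _).
apply: xget_unique.
  by exists n; rewrite ?lexx ?nS// subee// flow_ext0.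
move=> y [k /andP[kn nk] ->]; have -> : k = n.
  apply/eqP; rewrite eqn_leq; apply/andP; split; rewrite leqNgt; apply/negP.
    by move=> /(tau_le o); rewrite leNgt (le_lt_trans kn nS).
  by move=> /(tau_le o); rewrite leNgt nk.
by rewrite subee// flow_ext0.
Qed.

Let event : set Omega :=
  [set o | (Some @` F) (jump_path phi X sigma (tau sigma 1 o) o)].

(** Several jumps may occur at the same time, and the path then shows the last of them. The union
    over its index exhibits the event as measurable. *)
Let eventE : event = \bigcup_n
  ([set o | tau sigma n o = tau sigma 1 o /\
            (tau sigma n o < tau sigma n.+1 o)%E] `&` jump_into n).
Proof.
apply/seteqP; split => [r|r [n _ [] [n1 nS] /= Xn]]; last first.
  by rewrite /event /= -n1 jump_path_tau.
rewrite /event /= => -[y Fy jy].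
pose A := [set y : option T |
  exists2 n, (tau sigma n r <= tau sigma 1 r < tau sigma n.+1 r)%E &
    y = flow_ext phi (tau sigma 1 r - tau sigma n r)%E (X n r)].
have [n n1 jE] : A (jump_path phi X sigma (tau sigma 1 r) r).
  apply: contrapT => nA; suff jN : jump_path phi X sigma (tau sigma 1 r) r = None.
    by rewrite jN in jy.
  rewrite /jump_path; case: xgetP => // z _ Az.
  exfalso; apply: nA; rewrite /jump_path.
  by case: xgetP => // /(_ z).
move: n1 => /andP[n1 nS].
have n0 : (0 < n)%N.
  by rewrite lt0n; apply/eqP => n0; move: nS; rewrite n0 ltxx.
have tn : tau sigma n r = tau sigma 1 r by apply/eqP; rewrite eq_le n1 tau_le.
rewrite -tn in nS; exists n => //; split => //=.
by exists y => //; rewrite jy -tn jump_path_tau.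
Qed.

Let measurable_jump_into n : measurable (jump_into n).
Proof. exact: (X_measurable process). Qed.

Let measurable_event : measurable event.
Proof.
rewrite eventE; apply: bigcupT_measurable => n; apply: measurableI => //.
have -> : [set o | tau sigma n o = tau sigma 1 o /\
                   (tau sigma n o < tau sigma n.+1 o)%E] =
  [set o | (tau sigma n o <= tau sigma 1 o)%E] `&`
  [set o | (tau sigma 1 o <= tau sigma n o)%E] `&`
  [set o | (tau sigma n o < tau sigma n.+1 o)%E].
  apply/seteqP; split => o /=; first by move=> [-> ?]; rewrite lexx.
  by move=> [[n1 n2] nS]; split => //; apply/eqP; rewrite eq_le n1 n2.
have mt := measurable_tau.
apply: measurableI; last first.
  by rewrite -[X in measurable X]setTI; exact: measurable_lte.
by apply: measurableI; rewrite -[X in measurable X]setTI; exact: measurable_lee.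
Qed.

Let sigma_algebra_history n k : sigma_algebra setT (history X sigma n k).
Proof. exact: smallest_sigma_algebra. Qed.

Let historyT n k : history X sigma n k setT.
Proof.
have [h0 hC _] := sigma_algebra_history n k.
by rewrite -(setD0 setT); exact: hC.
Qed.

Let survival_ext0 n o : survival_ext phi E0 q (X n o) 0 = 1.
Proof.
case Xn : (X n o) => [y|//]; have Ey := X_state process Xn.
rewrite /= /survival path_cumul0 oppr0 expR0 ifT//.
apply: hit_gt0; case/state_cases: Ey => [|[]]; by [left|right].
Qed.

(** The law of [sigma 2] is taken at time 0, where every survival function is one because hitting
    times from E are positive. *)
Let sigma2_gt0 : \forall o \ae Pr, (0 < sigma 2 o)%E.
Proof.
have mpos : measurable [set o | (0 < sigma 2 o)%E].
  rewrite -[X in measurable X]setTI; apply: emeasurable_fun_o_infty => //.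
  exact: (sigma_measurable process).
have P1 : Pr [set o | (0 < sigma 2 o)%E] = 1%E.
  have := sigma_law process (@historyT 1 1) (lexx (0 : R)).
  rewrite setTI => ->.
  under eq_integral do rewrite survival_ext0.
  by rewrite integral_cst// mul1e; exact: probability_setT.
exists (~` [set o | (0 < sigma 2 o)%E]); split => //.
- exact: measurableC.
- by apply: etrans (probability_setC Pr mpos) _; rewrite P1 subee.
Qed.

Let history_event (n k i : nat) (t : R) : (1 <= i <= k)%N ->
  history X sigma n k [set o | (t%:E < sigma i o)%E].
Proof. by move=> ik; apply: sub_gen_smallest; right; exists i => //; exists t. Qed.

Let history_sigma_infty : history X sigma 0 1 [set o | sigma 1 o = +oo%E].
Proof.
have [h0 hC hU] := sigma_algebra_history 0 1.
have -> : [set o | sigma 1 o = +oo%E] =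
    setT `\` \bigcup_n (setT `\` [set o | (n%:R%:E < sigma 1 o)%E]).
  apply/seteqP; split => o /=.
    by move=> so; split => // -[n _ [_]]; rewrite /= so ltry.
  move=> [_ nU]; have := sigma_ge0 process 0 o; case so : (sigma 1 o) => [r| |]// _.
  exfalso; apply: nU; exists (Num.truncn r).+1 => //; split => //=.
  by rewrite so lte_fin => rt; have := lt_trans (truncnS_gt r) rt; rewrite ltxx.
exact: (hC _ (hU _ (fun n => hC _ (@history_event 0%N 1%N 1%N n%:R isT)))).
Qed.

(** After an infinite waiting time the process is dead, and [jump_ext] gives the dead state no mass
    on [F]. *)
Let sigma_infty_jump : \forall o \ae Pr, ~ (sigma 1 o = +oo%E /\ jump_into 1 o).
Proof.
have mB : measurable ([set o | sigma 1 o = +oo%E] `&` jump_into 1).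
  apply: measurableI => //; rewrite -[X in measurable X]setTI.
  by apply: (sigma_measurable process 0 _ (emeasurable_set1 +oo%E)).
exists ([set o | sigma 1 o = +oo%E] `&` jump_into 1); split => //; last first.
  by move=> o /= /contrapT.
apply: etrans (X_law process history_sigma_infty mF FE) _.
by apply: integral0_eq => o /= ->; case: (X 0 o).
Qed.

(** Almost surely, either the first jump time is finite and the second strictly later, so that the
    path shows [X 1], or it is infinite and neither event occurs. *)
Let event_ae : Pr event = Pr (jump_into 1).
Proof.
rewrite -[in LHS](setIT event) -[in RHS](setIT (jump_into 1)).
rewrite -!integral_indic//; apply: ae_eq_integral => //.
- exact/measurable_EFinP/measurable_indic.
- exact/measurable_EFinP/measurable_indic.
apply: filterS2 sigma2_gt0 sigma_infty_jump => r s2 sj _; congr (nat_of_bool _)%:R%:E.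
have [so|so] := eqVneq (sigma 1 r) +oo%E.
  rewrite !memNset//; first by move=> Xr; apply: sj.
  rewrite eventE => -[n _ [] [n1 +] _]; rewrite n1 tau1 so.
  by rewrite ltNge leey.
have t12 : (tau sigma 1 r < tau sigma 2 r)%E.
  rewrite (tauS 1) lteDl// tau1 ge0_fin_numE; last exact: (sigma_ge0 process).
  by rewrite lt_neqAle so leey.
by apply/idP/idP => /set_mem h; apply/mem_set; move: h; rewrite /event /= jump_path_tau.
Qed.

(** The initial condition as an event of the history, on which the conditional laws can be
    evaluated; it is measurable because points are closed, and it has probability one. *)
Let A0 : set Omega := X 0 @^-1` (Some @` [set x]).

Let A0P o : A0 o <-> X 0 o = Some x.
Proof.
split; first by move=> [y /= -> ->].
by move=> Xo; exists x.
Qed.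

Let measurable_singleton : measurable ([set x] : set BT).
Proof.
rewrite -(setCK [set x]); apply: measurableC; apply: sub_gen_smallest.
apply: closed_openC; apply: accessible_closed_set1.
by apply: hausdorff_accessible; exact: metric_hausdorff.
Qed.

Let history_A0 k : history X sigma 0 k A0.
Proof.
apply: sub_gen_smallest; left; exists 0%N => //.
by exists [set x].
Qed.

Let measurable_A0 : measurable A0.
Proof. exact: (X_measurable process). Qed.

Let null_A0 : Pr (~` A0) = 0%E.
Proof.
have [N [mN N0 sN]] := X0x; apply: (subset_measure0 (measurableC measurable_A0) mN _ N0).
by move=> o nA; apply: sN => /A0P.
Qed.

Let integral_A0 (D : set Omega) (g : Omega -> \bar R) : measurable D ->
  measurable_fun D g -> (forall o, 0 <= g o)%E ->
  (\int[Pr]_(o in A0 `&` D) g o = \int[Pr]_(o in D) g o)%E.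
Proof.
move=> mD mg g0; rewrite [RHS](ge0_negligible_integral (measurableC measurable_A0))//.
by rewrite setDE setCK setIC.
Qed.

Let probability_A0 (D : set Omega) : measurable D -> Pr (A0 `&` D) = Pr D.
Proof.
move=> mD; have := integral_A0 mD (measurable_cst 1%E) (fun=> lee01).
by rewrite !integral_cst// ?mul1e//; exact: measurableI.
Qed.

Let sigma1_law t : 0 <= t ->
  Pr [set o | (t%:E < sigma 1 o)%E] = (survival phi E0 q x t)%:E.
Proof.
move=> t0; rewrite -probability_A0; last first.
  rewrite -[X in measurable X]setTI; apply: emeasurable_fun_o_infty => //.
  exact: (sigma_measurable process).
apply: etrans (sigma_law process (@history_A0 0) t0) _.
rewrite (eq_integral (cst (survival phi E0 q x t)%:E)) => [|o /set_mem/A0P -> //].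
have A01 : Pr A0 = 1%E.
  by have := probability_A0 measurableT; rewrite setIT probability_setT.
apply: etrans (integral_cst Pr measurable_A0 _) _.
by rewrite [X in (_ * X)%E]A01 mule1.
Qed.

Lemma first_jump : Pr event = calK x F.
Proof.
have ms : measurable_fun setT (sigma 1) by exact: (sigma_measurable process).
have s0 := sigma_ge0 process 0.
have Dx : D true x by left.
pose k (u : measurableTypeR R) : \bar R := P (phi u x) F.
have k0 u : (0 <= k u)%E by exact: measure_ge0.
have mk : measurable_fun setT k.
  apply: (measurableT_comp (measurable_kernel P F mF)
    (g := (fun u : measurableTypeR R => phi u x : BT))).
  exact: measurable_phi.
have := integral_jump_time Dx ms s0 sigma1_law mk k0; rewrite -/(calK x F) => <-.
have mfin : measurable [set o | (sigma 1 o < +oo)%E].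
  by rewrite -[X in measurable X]setTI; apply: emeasurable_fun_infty_o.
have mks : measurable_fun setT (fun o => k (fine (sigma 1 o))).
  apply: (measurableT_comp mk (g := (fun o => fine (sigma 1 o) : measurableTypeR R))).
  exact: measurableT_comp.
rewrite event_ae -probability_A0//.
apply: etrans (X_law process (@history_A0 1) mF FE) _.
have mksf : measurable_fun [set o | (sigma 1 o < +oo)%E] (fun o => k (fine (sigma 1 o))).
  exact: measurable_funTS.
apply: etrans (integral_A0 mfin mksf (fun o => k0 _)).
rewrite [RHS]integral_mkcondr; apply: eq_integral => o /set_mem/A0P Xo.
rewrite patchE Xo /= /k; case so : (sigma 1 o) => [r| |].
- by rewrite mem_set//= so ltry.
- by rewrite memNset//= so.
- by have := s0 o; rewrite so.
Qed.

End process.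

End transport.

Theorem theorem2p11 (R : realType) (T : pmetricType R)
  (phi : R -> T -> T) (E0 : set T)
  (J : R -> T -> R) (m : {sigma_finite_measure set (borel T) -> \bar R})
  (mb : bool -> {finite_measure set (borel T) -> \bar R})
  (q : T -> R) (P : R.-pker (borel T) ~> (borel T))
  (P0 Pd : (T -> R) -> (T -> R) -> T -> R)
  (T_separable : separable T)
  (phi_flow : flow phi)
  (E0_measurable : measurable (E0 : set (borel T)))
  (phi_boundary : boundary_measurable phi E0)
  (phi_well_posed : well_posed phi E0)
  (q_rate : rate_function phi E0 q)
  (P_state : jump_kernel_on_state phi E0 P)
  (flow_hyp : flow_assumption phi E0 J m)
  (rate_hyp : rate_assumption phi q)
  (boundary_hyp : boundary_measure_assumption phi E0 J m mb)
  (jump_hyp : jump_assumption phi E0 P m mb P0 Pd) :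
  let E := state phi E0 in
  let Gp := Gamma phi E0 true in
  let Gm := Gamma phi E0 false in
  let calK := kernelK phi E0 q P in
  let K := opK phi E0 q J P0 Pd in
  [/\ (* calK is the transition kernel: P_x(X(tau_1) \in F) = calK x F *)
      forall (d : measure_display) (Omega : measurableType d)
        (Px : probability Omega R)
        (X : nat -> Omega -> option T) (sigma : nat -> Omega -> \bar R) (x : T),
        minimal_process phi E0 q P Px X sigma ->
        E x -> (\forall o \ae Px, X 0%N o = Some x) ->
        forall F : set (borel T), measurable F -> F `<=` E ->
          Px [set o | (Some @` F) (jump_path phi X sigma (tau sigma 1 o) o)] =
          calK x F,
      (* the arguments of P0 and Pd in the definition of K are in L^1 *)
      forall f fd : T -> R,
        @L1 _ (borel T) R m E f -> @L1 _ (borel T) R (mb false) Gm fd ->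
        (forall x, E x -> 0 <= f x) -> (forall x, Gm x -> 0 <= fd x) ->
        m.-integrable E (qR0 phi E0 q J f fd) /\
        (mb true).-integrable Gp (R0 phi E0 q J f fd),
      @substochastic _ (borel T) R m E (mb false) Gm K,
      forall (F : set (borel T)) (f fd : T -> R),
        measurable F -> F `<=` E ->
        @L1 _ (borel T) R m E f -> @L1 _ (borel T) R (mb false) Gm fd ->
        (\int[m]_(x in E) (calK x F * (f x)%:E) +
         \int[mb false]_(x in Gm) (calK x F * (fd x)%:E) =
         \int[m]_(x in F `&` E0) ((K f fd).1 x)%:E +
         \int[mb false]_(x in F `&` Gm) ((K f fd).2 x)%:E)%E &
      (forall x, (E `|` Gm) x -> hit phi E0 true x = +oo%E ->
         cumul phi q true x t @[t --> +oo] --> +oo) ->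
      @stochastic _ (borel T) R m E (mb false) Gm K].
Proof.
split.
- move=> d Omega Px X sigma x process Ex X0x F mF FE.
  exact: (first_jump phi_flow phi_well_posed E0_measurable phi_boundary q_rate
    rate_hyp process Ex X0x mF FE).
- move=> f fd Lf Lfd f0 fd0.
  exact: (integrable_inflow phi_flow phi_well_posed E0_measurable phi_boundary
    q_rate rate_hyp flow_hyp boundary_hyp Lf Lfd f0 fd0).
- exact: (opK_substochastic phi_flow phi_well_posed E0_measurable phi_boundary
    q_rate rate_hyp flow_hyp boundary_hyp jump_hyp).
- move=> F f fd mF FE Lf Lfd.
  exact: (kernel_identity phi_flow phi_well_posed E0_measurable phi_boundary
    q_rate rate_hyp flow_hyp boundary_hyp jump_hyp mF FE Lf Lfd).
- exact: (opK_stochastic phi_flow phi_well_posed E0_measurable phi_boundary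
    q_rate rate_hyp flow_hyp boundary_hyp P_state jump_hyp).
Qed.
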